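(* Let $k,r\ge 2$ be integers with $(k,r)\neq(2,2)$, and let $c$ be a constant with $0<c<c_{r,k}$. Let $H=\mathcal{H}_r(n,c/n^{r-1})$. Then asymptotically almost surely (as $n\to\infty$) $s(H)\le (a^*_{r,k}+o(1))\log\log n$, where $a^*_{r,k}=1/\log\bigl(k(r-1)/r\bigr)$.
   Context: $\mathcal{H}_r(n,p)$ denotes the random $r$-uniform hypergraph on vertex set $[n]=\{1,\dots,n\}$ in which each $r$-element subset of $[n]$ is included as an edge independently with probability $p$. The degree of a vertex is the number of edges containing it. Given a hypergraph $H$ and a positive integer $k$, the parallel peeling algorithm proceeds in rounds: in each round it simultaneously removes all vertices of degree less than $k$ (in the current hypergraph) together with all their incident edges; it terminates when no vertex of degree less than $k$ remains, and its output is the $k$-core of $H$. $s(H)$ denotes the number of rounds the algorithm takes on $H$. $c_{r,k}$ denotes the threshold constant for the emergence of a non-empty $k$-core in $\mathcal{H}_r(n,c/n^{r-1})$: for constant $c<c_{r,k}$ the $k$-core is a.a.s. empty, and for constant $c>c_{r,k}$ it is a.a.s. non-empty. ''Asymptotically almost surely'' (a.a.s.) means with probability tending to $1$ as $n\to\infty$; the $o(1)$ term tends to $0$ as $n\to\infty$. Logarithms are natural. *)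

(* Defs.v *)
(* Library world: MathComp with MathComp-Analysis. *)
From HB Require Import structures.
From mathcomp Require Import all_boot all_order all_algebra.
From mathcomp Require Import all_classical all_reals all_analysis.

Set Implicit Arguments.
Unset Strict Implicit.
Unset Printing Implicit Defensive.

Import Order.TTheory GRing.Theory Num.Theory.
Import numFieldNormedType.Exports.

Local Open Scope ring_scope.

Record hypergraph (T : finType) := Hypergraph {
  vertices : {set T};
  edges : {set {set T}} }.

Section Peeling.
Variables (T : finType) (k : nat).
Implicit Type H : hypergraph T.

Definition degree H (v : T) : nat := #|[set e in edges H | v \in e]%SET|.

Definition light H : {set T} := [set v in vertices H | (degree H v < k)%N]%SET.

Definition peel H : hypergraph T :=
  Hypergraph (vertices H :\: light H)
             [set e in edges H | [disjoint e & light H]]%SET.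

Definition after_rounds H (t : nat) : hypergraph T := iter t peel H.

Lemma peeling_terminates H : exists t, light (after_rounds H t) == finset.set0.
Proof.
have [m] := ubnP #|vertices H|; elim: m H => // m IH H Hm.
have [L0|LN0] := eqVneq (light H) finset.set0.
  by exists 0; rewrite /after_rounds /= L0.
have [|t Ht] := IH (peel H); last by exists t.+1; rewrite /after_rounds iterSr.
rewrite -ltnS; apply: leq_trans Hm; rewrite ltnS; apply: proper_card.
have [v vL] := set0Pn _ LN0.
have vV : v \in vertices H by move: vL; rewrite inE => /andP[].
apply/properP; split; first exact: finset.subsetDl.
by exists v => //; rewrite /= inE vL.
Qed.

Definition rounds H : nat := ex_minn (peeling_terminates H).

Definition core H : hypergraph T := after_rounds H (rounds H).

Definition empty_core H : bool := vertices (core H) == finset.set0.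

End Peeling.

Section RandomHypergraph.
Local Open Scope classical_set_scope.
Variable R : realType.

Definition rsubsets (n r : nat) : {set {set 'I_n}} :=
  [set e : {set 'I_n} | #|e| == r]%SET.

(* The edge set E of H_r(n, p) has the product Bernoulli(p) law on the family of
   all r-subsets.  This is a probability law only for 0 <= p <= 1; below,
   p = c / n ^ (r - 1) may exceed 1 for finitely many n, which does not affect
   limits. *)
Definition hgraph_prob (r n : nat) (p : R) (A : pred (hypergraph 'I_n)) : R :=
  \sum_(E : {set {set 'I_n}} |
          (E \subset rsubsets n r) && A (Hypergraph [set: 'I_n]%SET E))
    \prod_(e in rsubsets n r) (if e \in E then p else 1 - p).

(* The property A holds asymptotically almost surely in H_r(n, c / n ^ (r-1)). *)
Definition aas (r : nat) (c : R) (A : forall n, pred (hypergraph 'I_n)) : Prop :=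
  (fun n => hgraph_prob r (c / n%:R ^+ r.-1) (@A n)) @ \oo --> (1 : R).

(* There is at most one such c0, so this predicate characterizes c_{r,k}. *)
Definition core_threshold (r k : nat) (c0 : R) : Prop :=
  [/\ 0 < c0,
      forall c : R, 0 < c -> c < c0 -> aas r c (fun n H => empty_core k H)
    & forall c : R, c0 < c -> aas r c (fun n H => ~~ empty_core k H)].

End RandomHypergraph.

(* Main.v *)
(* The error term can be taken to be 0, because the argument below gives the
   rate 1 / ln ((k - 1) (r - 1)), which is strictly smaller than a^*.

   Let T be about a^* ln ln n.  A union bound shows that a.a.s. every family of
   m = O(T) edges covers at least (r - 1) m vertices, so that the breadth-first
   exploration from any vertex meets at most one cycle in its first T levels.
   Hence, if some vertex survives more than T rounds, then some vertex is the root of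
   a tree of edge-disjoint branches of depth about T in which every vertex has at least
   k - 1 child edges.  By an inequality of van den Berg - Kesten type this has
   probability at most q_T, where q_(t+1) = P(Bin(N, p q_t^(r-1)) >= k - 1) and
   N = C(n-1, r-1).  Once q_t is small, q_(t+1) is at most a constant times
   q_t^((k-1)(r-1)); the decay is doubly exponential and n q_T tends to 0.

   That q_t does become small is where c < c_{r,k} enters: it suffices that
   P(Poisson(c' x^(r-1) / (r-1)!) >= k - 1) < x for 0 < x <= 1 and some c' > c.  If this
   failed at some x and some c' < c_{r,k}, then the core would be a.a.s. non-empty
   slightly above c'.  Indeed, replace the edges by uniform words of length r and peel
   one edge at a time, removing a clone of a light vertex and r - 1 uniform clones.  The
   expected number of clones that will lie on heavy vertices when a proportion x^r of
   the edges is left is a martingale with increments at most k; by Chebyshev it is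
   a.a.s. close to its initial value, which exceeds the number of clones then left.
   So a.a.s. peeling is stuck before. *)
From HB Require Import structures.
From mathcomp Require Import all_boot all_order all_algebra.
From mathcomp Require Import zify ring lra.

Set Implicit Arguments.
Unset Strict Implicit.
Unset Printing Implicit Defensive.

Import Order.TTheory GRing.Theory Num.Theory.

Local Open Scope ring_scope.

(** * Disjoint occurrence *)

(** The martingale is handled by exact counting of words. Given the vector of degrees, the words are
    uniform, and they stay so during peeling because the light vertex is chosen from the degrees
    alone: removing its edge shows [r - 1] uniform clones. So the probability of an empty core is
    bounded by induction on counts of words with prescribed degrees. The initial value of the
    martingale is computable because the binomials ['C(d, l)] are eigenfunctions of drawing one of
    [T] clones, with eigenvalue [1 - l / T]. The number of clones on heavy vertices is not a finite
    combination of them; a Bonferroni polynomial below it suffices, as only a lower bound is wanted.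
    With [al n] rows and [mu = r al x^(r-1)] the limit per vertex is [mu P(Poisson(mu) >= k - 1)],
    against [mu x] clones left, so the surplus is exactly the condition
    [x < P(Poisson(mu) >= k - 1)]. Going back from words to sets of edges costs a constant factor: a
    word with [O(n)] rows is free of repetitions with probability bounded away from 0. This loss is
    harmless since Chebyshev gives a bound of order [1 / n]. *)

Section BernoulliSubsets.
Variables (R : realFieldType) (T : finType) (p : R).
Implicit Types (s : seq T) (f g : {set T} -> R).

Fixpoint bernE s f : R :=
  if s is x :: s' then (1 - p) * bernE s' f + p * bernE s' (fun E => f (x |: E))
  else f set0.

Lemma eq_bernE s f g : f =1 g -> bernE s f = bernE s g.
Proof.
elim: s f g => [|x s IH] f g fg /=; first exact: fg.
by rewrite (IH _ _ fg) (IH (fun E => f (x |: E)) (fun E => g (x |: E))) // => E; exact: fg.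
Qed.

Lemma bernED s f g : bernE s (fun E => f E + g E) = bernE s f + bernE s g.
Proof. by elim: s f g => [|x s IH] f g //=; rewrite !IH; ring. Qed.

Lemma bernEZ s a f : bernE s (fun E => a * f E) = a * bernE s f.
Proof. by elim: s f => [|x s IH] f //=; rewrite !IH; ring. Qed.

Lemma bernE_cst s a : bernE s (fun=> a) = a.
Proof. by elim: s => [|x s IH] //=; rewrite IH; ring. Qed.

Lemma bernE_sum s (I : Type) (r : seq I) (F : I -> {set T} -> R) :
  bernE s (fun E => \sum_(i <- r) F i E) = \sum_(i <- r) bernE s (F i).
Proof.
elim: r => [|i r IH].
  rewrite big_nil -[RHS](bernE_cst s).
  by apply: eq_bernE => E; rewrite big_nil.
by rewrite big_cons -IH -bernED; apply: eq_bernE => E; rewrite big_cons.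
Qed.

(** Links the recursion, made for induction on one coordinate, with the product weights of
    [hgraph_prob]. Without [uniq] a repeated coordinate would be drawn twice. *)
Lemma bernE_setE (s : seq T) f : uniq s ->
  bernE s f = \sum_(E : {set T} | E \subset [set x in s])
    (\prod_(x in [set x in s]) (if x \in E then p else 1 - p)) * f E.
Proof.
elim: s f => [|x s IH] f /=.
  move=> _; rewrite (big_pred1 set0) => [|E].
    by rewrite big1 ?mul1r // => x; rewrite inE.
  by rewrite set_nil subset0.
case/andP=> xs us; rewrite !IH //.
have Hx : x \notin [set y in s] by rewrite inE.
rewrite set_cons.
set D := [set y in s] in Hx *.
rewrite [RHS](bigID (fun E : {set T} => x \in E)) /= addrC; congr (_ + _).
  rewrite big_distrr /=; apply: eq_big => E.
    apply/idP/andP => [ED|[ED xE]].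
      split; first exact: subset_trans ED (subsetUr _ _).
      by apply: contra Hx; move/(subsetP ED).
    apply/fintype.subsetP => y yE; move/subsetP: ED => /(_ y yE).
    by rewrite in_setU1 => /orP[/eqP yx|//]; rewrite -yx yE in xE.
  move=> ED; rewrite big_setU1 //= mulrA; congr (_ * _ * _).
  by case: ifP => // /(subsetP ED); rewrite (negbTE Hx).
rewrite big_distrr /=.
rewrite [RHS](reindex_onto (fun E => x |: E) (fun E => E :\ x)) /=; last first.
  by move=> E /andP[_ xE]; rewrite setD1K.
apply: eq_big => E.
  apply/idP/andP => [ED|[/andP[ED _] /eqP xE]].
    by rewrite setUS // setU11 setU1K ?eqxx //; apply: contra Hx; move/(subsetP ED).
  apply/fintype.subsetP => y yE; have: y \in x |: E by rewrite in_setU1 yE orbT.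
  move/(subsetP ED); rewrite in_setU1 => /orP[/eqP yx|//].
  by move: yE; rewrite -xE yx !inE eqxx.
move=> ED; rewrite big_setU1 //= setU11 mulrA; congr (_ * _ * _).
apply: eq_bigr => y yD; rewrite in_setU1.
by case: eqP => // yx; rewrite yx (negbTE Hx) in yD.
Qed.

Hypothesis p01 : 0 <= p <= 1.

Lemma bernE_le s f g :
  (forall E : {set T}, E \subset [set x in s] -> f E <= g E) -> bernE s f <= bernE s g.
Proof.
have [p0 p1] := andP p01.
elim: s f g => [|x s IH] f g fg /=; first exact/fg/sub0set.
have sS : [set y in s] \subset [set y in x :: s] by rewrite set_cons subsetUr.
apply: lerD; apply: ler_wpM2l; rewrite ?subr_ge0 //; apply: IH => E Es.
  by apply: fg; apply: subset_trans sS.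
by apply: fg; rewrite set_cons setUS.
Qed.

(** A relation between the two parts, rather than a pair of events: revealing a coordinate leads to
    the disjunction [FU] of two shifted relations, which is not a product even if [F] is one. *)
Definition disjoint_occurrence (F : {set T} -> {set T} -> bool) (E : {set T}) :=
  [exists S : {set T}, (S \subset E) && F S (E :\: S)].

(* Giving the second argument its own copy of the coordinate [x] only increases
   the probability, and this reduces to an inequality between the four
   possible memberships of [x]. *)
Lemma bernE_disjoint_occurrence s (F : {set T} -> {set T} -> bool) :
  (forall A A' B B' : {set T}, A \subset A' -> B \subset B' -> F A B -> F A' B') ->
  bernE s (fun E => (disjoint_occurrence F E)%:R) <=
  bernE s (fun E => bernE s (fun E' => (F E E')%:R)).
Proof.
have [p0 p1] := andP p01.
elim: s F => [|x s IH] F Fmono /=.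
  rewrite ler_nat; case H: (disjoint_occurrence _ _) => //.
  case/existsP: H => S /andP[S0 FS]; move: FS.
  by rewrite subset0 in S0; rewrite (eqP S0) setD0 => ->.
pose F10 A B := F (x |: A) B; pose F01 A B := F A (x |: B).
pose F11 A B := F (x |: A) (x |: B); pose FU A B := F10 A B || F01 A B.
have SU (A : {set T}) : A \subset x |: A by exact: subsetUr.
have L1 := IH F Fmono.
(* A present [x] can serve only one side: it lies in [S] or in the complement, hence the disjunction
   [FU]. *)
have L2 : bernE s (fun E => (disjoint_occurrence F (x |: E))%:R) <=
    bernE s (fun E => bernE s (fun E' => (FU E E')%:R)).
  apply: le_trans (IH FU _); last first.
    move=> A A' B B' AA BB /orP[] H; apply/orP; [left|right];
      by apply: Fmono H; rewrite ?setUS.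
  apply: bernE_le => E _; rewrite ler_nat; case H: (disjoint_occurrence _ _) => //.
  rewrite lt0b; case/existsP: H => S /andP[SE FS]; apply/existsP.
  have [xS|xS] := boolP (x \in S).
    exists (S :\ x); rewrite subDset SE /=; apply/orP; left; rewrite /F10.
    apply: Fmono FS; first by rewrite setD1K.
    apply/fintype.subsetP => y; rewrite !inE => /andP[yS /orP[/eqP yx|yE]].
      by rewrite yx xS in yS.
    by rewrite yE (negbTE yS) andbF.
  exists S; apply/andP; split.
    apply/fintype.subsetP => y yS; move/subsetP: SE => /(_ y yS).
    by rewrite in_setU1 => /orP[/eqP yx|//]; rewrite -yx yS in xS.
  apply/orP; right; apply: Fmono FS => //.
  apply/fintype.subsetP => y; rewrite !inE => /andP[-> /orP[->//|->]].
  by rewrite orbT.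
apply: le_trans (lerD (ler_wpM2l _ L1) (ler_wpM2l p0 L2)) _; first by rewrite subr_ge0.
rewrite -!bernEZ -!bernED; apply: bernE_le => E _.
rewrite -!bernEZ -!bernED -!bernEZ -!bernED; apply: bernE_le => E' _.
(* With [E] and [E'] fixed, the claim is [(1 - p) F + p (F10 || F01) <= (1 - p)^2 F + p (1 - p) (F10
   + F01) + p^2 F11], and monotonicity leaves few patterns of truth values. *)
have m1 : F E E' -> F10 E E' by apply: Fmono.
have m2 : F E E' -> F01 E E' by apply: Fmono.
have m3 : F10 E E' -> F11 E E' by apply: Fmono.
have m4 : F01 E E' -> F11 E E' by apply: Fmono.
have pp : 0 <= p * (1 - p) by rewrite mulr_ge0 // subr_ge0.
move: m1 m2 m3 m4; rewrite -/(F10 E E') -/(F01 E E') -/(F11 E E') /FU.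
by case: (F E E'); case: (F10 E E'); case: (F01 E E'); case: (F11 E E') => m1 m2 m3 m4;
  rewrite /= ?(mulr1, mulr0, addr0, add0r); (try by [have := m1 isT|have := m2 isT|have := m3 isT|have := m4 isT]); nra.
Qed.

End BernoulliSubsets.

Section DisjointOccurrence.
Variables (R : realFieldType) (T : finType) (p : R) (s : seq T).
Hypothesis p01 : 0 <= p <= 1.
Implicit Types P Q C : {set T} -> bool.

Definition bernP P : R := bernE p s (fun E => (P E)%:R).

Definition increasing P := forall A B : {set T}, A \subset B -> P A -> P B.

Definition box P Q := disjoint_occurrence (fun A B => P A && Q B).

Lemma bernP_ge0 P : 0 <= bernP P.
Proof.
rewrite -(bernE_cst p s 0) /bernP; by apply: bernE_le.
Qed.

Lemma bernP_le1 P : bernP P <= 1.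
Proof.
rewrite -[leRHS](bernE_cst p s 1) /bernP; by apply: bernE_le => // E _; rewrite lern1 leq_b1.
Qed.

Lemma bernP_le P Q :
  (forall E : {set T}, E \subset [set x in s] -> P E -> Q E) -> bernP P <= bernP Q.
Proof.
move=> PQ; apply: bernE_le => // E Es; rewrite ler_nat.
by case H: (P E) => //; rewrite (PQ _ Es H).
Qed.

Lemma bernP_true : bernP (fun=> true) = 1.
Proof. exact: bernE_cst. Qed.

Lemma box_increasing P Q : increasing P -> increasing Q -> increasing (box P Q).
Proof.
move=> mP mQ A B AB /existsP[S /andP[SA /andP[PS QS]]]; apply/existsP; exists S.
rewrite (subset_trans SA AB) PS /=; apply: mQ QS; exact: finset.setSD.
Qed.

(** Shaped for one step of [box_atleast]: [C] asks for [m + 1] successes among the later indices and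
    [Q] for [m]. In the relation [F] the first copy decides [P], after which the second one has to
    satisfy [Q] or [C]. *)
Lemma bernP_or_box C P Q :
  increasing C -> increasing P -> increasing Q -> (forall E, C E -> Q E) ->
  bernP (fun E => C E || box P Q E) <= (1 - bernP P) * bernP C + bernP P * bernP Q.
Proof.
move=> mC mP mQ CQ.
pose F (A B : {set T}) := C B || P A && Q B.
have mF (A A' B B' : {set T}) : A \subset A' -> B \subset B' -> F A B -> F A' B'.
  move=> AA BB /orP[cB|/andP[pA qB]]; apply/orP; [left; exact: mC cB|right].
  by rewrite (mP _ _ AA pA) (mQ _ _ BB qB).
apply: (@le_trans _ _ (bernE p s (fun E => (disjoint_occurrence F E)%:R))).
  apply: bernP_le => E _ /orP[cE|/existsP[S /andP[SE PQS]]]; apply/existsP.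
    by exists set0; rewrite sub0set /F setD0 cE.
  by exists S; rewrite SE /F PQS orbT.
apply: le_trans (bernE_disjoint_occurrence p01 _ mF) _.
have EF (A : {set T}) : bernE p s (fun B => (F A B)%:R) =
    bernP C + (P A)%:R * (bernP Q - bernP C).
  rewrite /F; case: (P A) => /=.
    rewrite mul1r addrC subrK; apply: eq_bernE => B; case cB: (C B) => //=.
    by rewrite (CQ _ cB).
  by rewrite mul0r addr0; apply: eq_bernE => B; rewrite orbF.
rewrite (eq_bernE _ _ EF) bernED bernE_cst.
rewrite (@eq_bernE _ _ p s _ (fun A => (bernP Q - bernP C) * (P A)%:R)); last first.
  by move=> A; rewrite mulrC.
rewrite bernEZ -/(bernP P); lra.
Qed.

Lemma bernP_box P Q : increasing P -> increasing Q ->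
  bernP (box P Q) <= bernP P * bernP Q.
Proof.
move=> mP mQ.
have := @bernP_or_box (fun=> false) P Q (fun _ _ _ H => H) mP mQ (fun E H => False_ind _ (notF H)).
have -> : bernP (fun=> false) = 0 by apply: bernE_cst.
by rewrite mulr0 add0r.
Qed.

Variables (I : eqType).
Implicit Types (F : I -> {set T} -> bool) (r : seq I).

Fixpoint box_all F r : {set T} -> bool :=
  if r is i :: r' then box (F i) (box_all F r') else fun=> true.

Fixpoint box_atleast (m : nat) F r : {set T} -> bool :=
  match r, m with
  | _, 0%N => fun=> true
  | [::], _ => fun=> false
  | i :: r', m'.+1 =>
      fun E => box_atleast m F r' E || box (F i) (box_atleast m' F r') E
  end.

Lemma box_all_increasing F r :
  (forall i, increasing (F i)) -> increasing (box_all F r).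
Proof. by move=> mF; elim: r => [|i r IH] //=; apply: box_increasing. Qed.

Lemma box_atleast_increasing m F r :
  (forall i, increasing (F i)) -> increasing (box_atleast m F r).
Proof.
move=> mF; elim: r m => [|i r IH] [|m] //= A B AB /orP[H|H]; apply/orP.
  by left; apply: IH H.
by right; apply: box_increasing H.
Qed.

Lemma box_atleastS m F r E : (forall i, increasing (F i)) ->
  box_atleast m.+1 F r E -> box_atleast m F r E.
Proof.
move=> mF; elim: r m E => [|i r IH] [|m] E //= /orP[H|H].
  by apply/orP; left; apply: IH H.
case/existsP: H => S /andP[SE /andP[_ H]].
have: box_atleast m.+1 F r E.
  by apply: box_atleast_increasing H => //; exact: finset.subsetDl.
by move=> ->.
Qed.

Lemma bernP_box_all F r a :
  (forall i, increasing (F i)) -> (forall i, i \in r -> bernP (F i) <= a) ->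
  bernP (box_all F r) <= a ^+ size r.
Proof.
move=> mF; elim: r => [|i r IH] ale; first by rewrite /= bernP_true.
rewrite exprS; apply: le_trans (bernP_box _ _) _ => //.
  exact: box_all_increasing.
apply: ler_pM; rewrite ?bernP_ge0 ?ale ?mem_head ?IH // => j jr.
by apply: ale; rewrite inE jr orbT.
Qed.

(** The probability that a binomial variable with parameters [N] and [a] is at least [m], by
    conditioning on one trial, as in the recursion of [box_atleast]. *)
Fixpoint binom_tail (m N : nat) (a : R) : R :=
  match N, m with
  | _, 0%N => 1
  | 0%N, _ => 0
  | N'.+1, m'.+1 => (1 - a) * binom_tail m N' a + a * binom_tail m' N' a
  end.

Lemma bernP_box_atleast m F r a : 0 <= a <= 1 ->
  (forall i, increasing (F i)) -> (forall i, i \in r -> bernP (F i) <= a) ->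
  bernP (box_atleast m F r) <= binom_tail m (size r) a.
Proof.
move=> /andP[a0 a1] mF; elim: r m => [|i r IH] [|m] ale /=; rewrite ?bernP_true //.
  by rewrite /bernP (bernE_cst p s 0).
have ale' j : j \in r -> bernP (F j) <= a.
  by move=> jr; apply: ale; rewrite inE jr orbT.
apply: le_trans (bernP_or_box _ _ _ _) _ => //; try exact: box_atleast_increasing.
  by move=> E; apply: box_atleastS.
have C := IH m.+1 ale'; have D := IH m ale'.
(* This makes the convex combination nondecreasing in the probability of [F i], which may then be
   raised to [a]. *)
have CD : bernP (box_atleast m.+1 F r) <= bernP (box_atleast m F r).
  by apply: bernP_le => E _; apply: box_atleastS.
have Fi : bernP (F i) <= a by apply: ale; rewrite mem_head.
have := bernP_ge0 (F i); nra.
Qed.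

Lemma box_all_intro F r (A : I -> {set T}) (E : {set T}) :
  (forall i, increasing (F i)) -> uniq r ->
  (forall i, i \in r -> F i (A i) && (A i \subset E)) ->
  (forall i j, i \in r -> j \in r -> i != j -> [disjoint A i & A j]) ->
  box_all F r E.
Proof.
move=> mF; elim: r E => [|i r IH] E //= /andP[ir ur] FA dA.
have /andP[Fi AiE] := FA i (mem_head _ _).
apply/existsP; exists (A i); rewrite AiE Fi /=; apply: IH => // [j jr|j l jr lr].
  have jr' : j \in i :: r by rewrite inE jr orbT.
  have /andP[-> AjE] := FA j jr'; rewrite finset.subsetD AjE /=.
  by apply: dA; rewrite ?mem_head //; apply: contraNneq ir => <-.
by apply: dA; rewrite inE ?jr ?lr orbT.
Qed.

Lemma box_atleast_intro m F r (a : pred I) (A : I -> {set T}) (E : {set T}) :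
  (forall i, increasing (F i)) -> uniq r -> (m <= count a r)%N ->
  (forall i, i \in r -> a i -> F i (A i) && (A i \subset E)) ->
  (forall i j, a i -> a j -> i != j -> [disjoint A i & A j]) ->
  box_atleast m F r E.
Proof.
move=> mF; elim: r m E => [|i r IH] [|m] E //= /andP[ir ur] cm FA dA.
have FA' j : j \in r -> a j -> F j (A j) && (A j \subset E).
  by move=> jr; apply: FA; rewrite inE jr orbT.
have [ai|ai] := boolP (a i); last first.
  by move: cm; rewrite (negbTE ai) add0n => cm; rewrite (IH m.+1).
rewrite ai add1n ltnS in cm.
have /andP[Fi AiE] := FA i (mem_head _ _) ai.
apply/orP; right; apply/existsP; exists (A i); rewrite AiE Fi /=.
apply: IH => // j jr aj.
have /andP[-> AjE] := FA' j jr aj; rewrite finset.subsetD AjE /=.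
by apply: dA => //; apply: contraNneq ir => <-.
Qed.

End DisjointOccurrence.

Section BinomTail.
Variable R : realFieldType.
Implicit Types (m N : nat) (a b : R).

Lemma binom_tail_ge0 m N a : 0 <= a <= 1 -> 0 <= binom_tail m N a.
Proof.
move=> /andP[a0 a1]; elim: N m => [|N IH] [|m] //=.
by rewrite addr_ge0 ?mulr_ge0 ?IH ?subr_ge0.
Qed.

Lemma binom_tailS m N a : 0 <= a <= 1 -> binom_tail m.+1 N a <= binom_tail m N a.
Proof.
move=> a01; have /andP[a0 a1] := a01; elim: N m => [|N IH] [|m] //=.
  have := IH 0%N; case: {IH} N => [|N] /=; nra.
by apply: lerD; apply: ler_wpM2l; rewrite ?IH ?subr_ge0.
Qed.

Lemma binom_tail_le1 m N a : 0 <= a <= 1 -> binom_tail m N a <= 1.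
Proof.
move=> a01; elim: m => [|m IH]; first by case: N.
exact: le_trans (binom_tailS _ _ a01) IH.
Qed.

Lemma binom_tail_le m N N' a : 0 <= a <= 1 -> (N <= N')%N ->
  binom_tail m N a <= binom_tail m N' a.
Proof.
move=> a01 /subnK <-; have /andP[a0 a1] := a01.
elim: (N' - N)%N => [|i IH] //; apply: le_trans IH _; rewrite addSn.
case: m => [|m] /=; first by case: (i + N)%N.
have := binom_tailS m (i + N) a01; nra.
Qed.

(** A union bound over [m]-tuples of trials. It turns the recursion of [tree_bound] into a power law
    once the values are small. *)
Lemma binom_tail_le_exp m N a : 0 <= a <= 1 -> binom_tail m N a <= (N%:R * a) ^+ m.
Proof.
move=> a01; have /andP[a0 a1] := a01; elim: N m => [|N IH] [|m] //=; rewrite ?expr0 //.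
  by rewrite mul0r expr0n.
have h1 := IH m.+1; have h2 := IH m.
have b1 := binom_tail_ge0 m.+1 N a01.
have N0 : 0 <= N%:R * a by rewrite mulr_ge0.
apply: (@le_trans _ _ ((N%:R * a + a) * (N%:R * a) ^+ m)).
  by rewrite [leRHS]mulrDl -exprS; nra.
have -> : N.+1%:R * a = N%:R * a + a by rewrite -natr1 mulrDl mul1r.
rewrite exprS; apply: ler_wpM2l; first by rewrite addr_ge0.
by apply: lerXn2r; rewrite ?nnegrE ?addr_ge0 // lerDl.
Qed.

End BinomTail.

(** * Branching witnesses of long peeling *)

Section TreeWitness.
Variables (R : realFieldType) (V : finType) (m : nat).
Implicit Types u : V.

(* In [tree_witness Om t u E], branches use pairwise disjoint sets of edges of [E], but
   their vertices may coincide. *)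
Fixpoint tree_witness (Om : seq {set V}) t u : {set {set V}} -> bool :=
  if t is t'.+1 then
    box_atleast m
      (fun e : {set V} => box (fun E : {set {set V}} => e \in E) (box_all (tree_witness Om t') (enum (e :\ u))))
      [seq e : {set V} <- Om | u \in e]
  else fun=> true.

Lemma mem_increasing (e : {set V}) : increasing (fun E : {set {set V}} => e \in E).
Proof. by move=> A B AB; apply: (fintype.subsetP AB). Qed.

Lemma tree_witness_increasing Om t u : increasing (tree_witness Om t u).
Proof.
elim: t u => [|t IH] u //=; apply: box_atleast_increasing => e.
by apply: box_increasing; [exact: mem_increasing|exact: box_all_increasing].
Qed.

Fixpoint tree_bound (r N : nat) (p : R) t : R :=
  if t is t'.+1 then binom_tail m N (p * tree_bound r N p t' ^+ r.-1) else 1.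

Lemma tree_bound_ge0_le1 r N p t : 0 <= p <= 1 -> 0 <= tree_bound r N p t <= 1.
Proof.
move=> p01; have /andP[p0 p1] := p01.
elim: t => [|t /andP[IH0 IH1]] /=; first by rewrite ler01 lexx.
have H : 0 <= p * tree_bound r N p t ^+ r.-1 <= 1.
  by rewrite mulr_ge0 ?exprn_ge0 //= mulr_ile1 ?exprn_ge0 ?exprn_ile1.
by rewrite binom_tail_ge0 // binom_tail_le1.
Qed.

Lemma bernP_mem (p : R) (T : finType) (s : seq T) (x : T) :
  0 <= p <= 1 -> uniq s -> bernP p s (fun E : {set T} => x \in E) <= p.
Proof.
move=> p01; have /andP[p0 p1] := p01.
have N0 s' : x \notin s' -> bernP p s' (fun E : {set T} => x \in E) <= 0.
  move=> xs; rewrite -(bernE_cst p s' 0) /bernP; apply: bernE_le => // E Es.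
  case H: (x \in E) => //; move: (fintype.subsetP Es _ H).
  by rewrite inE (negbTE xs).
elim: s => [|y s IH] /=; first by rewrite /bernP /= inE.
case/andP=> ys us; rewrite /bernP /=.
have [yx|xy] := eqVneq y x.
  rewrite {}yx {y} in ys *.
  rewrite (@eq_bernE _ _ p s (fun E => (x \in x |: E)%:R) (fun=> 1)); last first.
    by move=> E; rewrite setU11.
  rewrite bernE_cst mulr1 gerDr; apply: mulr_ge0_le0; rewrite ?subr_ge0 //.
  exact: N0.
rewrite (@eq_bernE _ _ p s (fun E => (x \in y |: E)%:R) (fun E => (x \in E)%:R)).
  rewrite -/(bernP p s (fun E : {set T} => x \in E)) -mulrDl subrK mul1r; exact: IH.
by move=> E; rewrite in_setU1 eq_sym (negbTE xy).
Qed.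

(** Thanks to disjointness a child edge with its [r - 1] branches costs [p * q ^ (r - 1)], and [N]
    bounds the number of candidate child edges. *)
Lemma bernP_tree_witness (p : R) (Om : seq {set V}) r N t u : 0 <= p <= 1 -> uniq Om ->
  (forall e, e \in Om -> #|e| = r) ->
  (forall u, (size [seq e : {set V} <- Om | u \in e] <= N)%N) ->
  bernP p Om (tree_witness Om t u) <= tree_bound r N p t.
Proof.
move=> p01 uOm cOm degN; have /andP[p0 p1] := p01.
elim: t u => [|t IH] u /=; first by rewrite bernP_true.
have /andP[q0 q1] := tree_bound_ge0_le1 r N t p01.
set a := p * tree_bound r N p t ^+ r.-1.
have a01 : 0 <= a <= 1.
  by rewrite mulr_ge0 ?exprn_ge0 //= mulr_ile1 ?exprn_ge0 ?exprn_ile1.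
apply: le_trans (binom_tail_le _ a01 (degN u)).
apply: bernP_box_atleast => // [e|e].
  apply: box_increasing; first exact: mem_increasing.
  by apply: box_all_increasing => w; exact: tree_witness_increasing.
rewrite mem_filter => /andP[ue eOm].
have mall : increasing (box_all (tree_witness Om t) (enum (e :\ u))).
  by apply: box_all_increasing => w; exact: tree_witness_increasing.
apply: le_trans (bernP_box _ p01 (@mem_increasing e) mall) _.
apply: ler_pM; rewrite ?bernP_ge0 ?bernP_mem //.
have <- : size (enum (e :\ u)) = r.-1.
  by rewrite -cardE -(cOm e eOm) (cardsD1 u e) ue.
by apply: bernP_box_all => // w; exact: tree_witness_increasing.
Qed.

End TreeWitness.

Lemma disjointPn (T : finType) (A B : {set T}) :
  reflect (exists2 x, x \in A & x \in B) (~~ [disjoint A & B]).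
Proof.
rewrite -setI_eq0; apply: (iffP (set0Pn _)) => [[x]|[x xA xB]].
  by rewrite inE => /andP[xA xB]; exists x.
by exists x; rewrite inE xA.
Qed.

(** * Breadth-first exploration and its defects *)

Section Exploration.
Variables (V : finType) (E : {set {set V}}) (r : nat) (v : V) (B : nat).
Hypothesis r_gt1 : (1 < r)%N.
Hypothesis E_card : forall e, e \in E -> #|e| = r.
Hypothesis B_gt0 : (0 < B)%N.

Fixpoint ball i : {set V} :=
  if i is i'.+1 then ball i' :|: \bigcup_(e in E | ~~ [disjoint e & ball i']) e
  else [set v].

(* Graph distance to [v], truncated at [B]. *)
Definition dist w := find (fun i => w \in ball i) (iota 0 B).

Lemma ballS i j : (i <= j)%N -> ball i \subset ball j.
Proof.
move/subnK <-; elim: (j - i)%N => [|l IH] //.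
by apply: subset_trans IH _; rewrite addSn /= subsetUl.
Qed.

Lemma dist_le w i : (i < B)%N -> (dist w <= i)%N = (w \in ball i).
Proof.
move=> iB; apply/idP/idP => [di|wi].
  apply: (fintype.subsetP (ballS di)).
  have dB : (dist w < B)%N by exact: leq_ltn_trans iB.
  have hw : has (fun i => w \in ball i) (iota 0 B) by rewrite has_find size_iota.
  by have := nth_find 0 hw; rewrite nth_iota.
rewrite leqNgt; apply/negP => /(before_find 0).
by rewrite nth_iota // wi.
Qed.

Lemma dist_eq0 w : (dist w == 0)%N = (w == v).
Proof. by rewrite -leqn0 dist_le // inE. Qed.

Lemma dist_edge e x w : e \in E -> x \in e -> w \in e -> ((dist x).+1 < B)%N ->
  (dist w <= (dist x).+1)%N.
Proof.
move=> eE xe we dB; rewrite dist_le //= in_setU; apply/orP; right.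
apply/bigcupP; exists e => //; rewrite eE /=; apply/disjointPn; exists x => //.
by rewrite -dist_le // ltnW.
Qed.

Lemma dist_pred w : (0 < dist w < B)%N ->
  exists2 e, e \in E & (w \in e) && [exists x in e, (dist x).+1 == dist w].
Proof.
case Ed: (dist w) => [|j] //= jB.
have : w \in ball j.+1 by rewrite -dist_le // Ed.
rewrite /= in_setU => /orP[|/bigcupP[e /andP[eE /disjointPn[x xe xj]] we]].
  by rewrite -dist_le ?Ed ?ltnn // ltnW.
exists e => //; rewrite we /=; apply/existsP; exists x; rewrite xe /= eqSS.
have jB' : (j < B)%N by exact: ltnW.
have dxj : (dist x <= j)%N by rewrite dist_le.
rewrite eqn_leq dxj /= -ltnS -Ed; apply: dist_edge eE xe we _.
exact: leq_ltn_trans jB.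
Qed.

(** One edge by which [w] is first reached, chosen once for all; within the truncation the default
    [set0] occurs only at the root. *)
Definition parent w : {set V} :=
  odflt set0 [pick e in E | (w \in e) && [exists x in e, (dist x).+1 == dist w]].

Definition top (e : {set V}) : V :=
  odflt v [pick x in e | [forall y in e, (dist x <= dist y)%N]].

Lemma topP e : e \in E -> (top e \in e) /\ (forall y, y \in e -> (dist (top e) <= dist y)%N).
Proof.
move=> eE; rewrite /top; case: pickP => [x /andP[xe /forall_inP H]|none] //=.
have /card_gt0P[x0 x0e] : (0 < #|e|)%N by rewrite E_card // ltnW.
have [x xe xmin] := arg_minnP dist x0e.
have := none x; rewrite (xe : x \in e) /=.
by move/negbT/forall_inPn => [y ye]; rewrite xmin.
Qed.

Lemma parentP w : w != v -> (dist w < B)%N ->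
  [/\ parent w \in E, w \in parent w & (dist (top (parent w))).+1 = dist w].
Proof.
move=> wv dB; have dw : (0 < dist w < B)%N by rewrite lt0n dist_eq0 wv.
rewrite /parent; case: pickP => [e /and3P[eE we /existsP[x /andP[xe /eqP dx]]]|none] /=.
  split=> //; have [te tmin] := topP eE.
  have tx := tmin _ xe.
  apply/eqP; rewrite eqn_leq; apply/andP; split; first by rewrite -dx ltnS.
  apply: dist_edge eE te we _.
  by apply: leq_ltn_trans dB; rewrite -dx ltnS.
by have [e eE H] := dist_pred dw; have := none e; rewrite /= eE H.
Qed.

Lemma top_eq_root e : e \in E -> v \in e -> top e = v.
Proof.
move=> eE ve; apply/eqP; rewrite -dist_eq0 -leqn0.
have dv : dist v = 0%N by apply/eqP; rewrite dist_eq0.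
by rewrite -dv; apply: (topP eE).2.
Qed.

Definition up w := top (parent w).

(** Within the truncation and off the root, [up] lowers the distance by exactly one, so the number
    of steps is forced. Fixing it gives [below_inj]: vertices at equal distance have no common
    descendant. *)
Definition below x w := (dist x <= dist w)%N && (iter (dist w - dist x) up w == x).

Lemma below_refl x : below x x.
Proof. by rewrite /below leqnn subnn /=. Qed.

Lemma below_inj x y w : dist x = dist y -> below x w -> below y w -> x = y.
Proof. by move=> dxy /andP[_ /eqP <-] /andP[_ /eqP <-]; rewrite dxy. Qed.

Lemma below_up u w : u != v -> (dist u < B)%N -> below u w -> below (up u) w.
Proof.
move=> uv uB /andP[duw /eqP Hu]; have [_ _ du] := parentP uv uB.
rewrite /below -/(up u) in du *.
have -> : (dist w - dist (up u) = (dist w - dist u).+1)%N by lia.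
by rewrite iterS Hu eqxx andbT; lia.
Qed.

Definition edges_below x := [set e in E | below x (top e)].

(* An incidence that closes a cycle in the breadth-first exploration from [v]. *)
Definition defect w e := [&& e \in E, w \in e, w != top e & parent w != e].

Variables (k T : nat) (A : nat -> {set V}).
Hypothesis B_large : (T.+2 < B)%N.
Hypothesis A_deg : forall t x, x \in A t.+1 ->
  (k <= #|[set e in E | (x \in e) && (e \subset A t)]|)%N.

(** [A t] stands for the vertices left after [t] rounds, of which only [A_deg] is retained. Of the
    [k] edges at [x] at most one is its parent edge, hence [k.-1]. Any other one has [x] as top and
    is the parent edge of its other vertices, since a violation would be a defect at [x] or below
    it. The families [edges_below u] of the children are then disjoint. The bound on [dist x + t]
    keeps the tops of all edges met at distance at most [T], where defects are excluded. *)
Lemma tree_witness_below (Om : seq {set V}) t x :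
  uniq Om -> {subset E <= Om} -> x \in A t -> x != v -> (dist x + t <= T.+1)%N ->
  (forall w e, defect w e -> (dist (top e) <= T)%N -> ~~ below x w && ~~ below x (top e)) ->
  tree_witness k.-1 Om t x (edges_below x).
Proof.
move=> uOm EOm; elim: t x => [|t IH] x // xA xv dx nodef.
have dxB : ((dist x).+1 < B)%N by lia.
pose a e := [&& e \in E, x \in e, e \subset A t & e != parent x].
have top_a e : a e -> top e = x.
  case/and4P => eE xe eA ep; apply: contraNeq ep => te.
  rewrite eq_sym; apply: contraT => pe.
  have dfe : defect x e by rewrite /defect eE xe pe andbT /= eq_sym.
  have : (dist (top e) <= T)%N by apply: leq_trans ((topP eE).2 x xe) _; lia.
  by move/(nodef _ _ dfe); rewrite below_refl.
have child e u : a e -> u \in e :\ x ->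
    [/\ u != v, parent u = e & dist u = (dist x).+1].
  move=> ae; rewrite !inE => /andP[ux ue].
  have te := top_a _ ae; case/and4P: ae => eE xe _ _.
  have uv : u != v.
    by apply: contraNneq ux => uv; rewrite uv in ue *; rewrite -te top_eq_root.
  have pu : parent u = e.
    apply/eqP; apply: contraT => pe.
    have dfe : defect u e by rewrite /defect eE ue te ux.
    have : (dist (top e) <= T)%N by rewrite te; lia.
    by move/(nodef _ _ dfe); rewrite te below_refl andbF.
  have uB : (dist u < B)%N by apply: leq_ltn_trans (dxB); exact: (dist_edge eE xe ue).
  by have [_ _ <-] := parentP uv uB; rewrite pu te.
have belowS e u w : a e -> u \in e :\ x -> below u w -> below x w.
  move=> ae uex bu; have [uv pu du] := child _ _ ae uex.
  have := below_up uv _ bu; rewrite /up pu (top_a _ ae); apply.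
  by rewrite du.
pose W e := e |: \bigcup_(u in e :\ x) edges_below u.
have WP e f : a e -> f \in W e ->
    f = e \/ exists2 u, u \in e :\ x & (f \in E) && below u (top f).
  move=> ae; rewrite in_setU1 => /orP[/eqP|/bigcupP[u ue]]; first by left.
  by rewrite inE => H; right; exists u.
apply: (box_atleast_intro (a := a) (A := W)).
- move=> e; apply: box_increasing; first exact: mem_increasing.
  by apply: box_all_increasing => u; exact: tree_witness_increasing.
- exact: filter_uniq.
- have H : #|[set e in E | (x \in e) && (e \subset A t)]| = 
      count (fun e => [&& e \in E, x \in e & e \subset A t]) Om.
    rewrite cardE -size_filter; apply: perm_size; apply: uniq_perm.
    + exact: enum_uniq.
    + exact: filter_uniq.
    + move=> e; rewrite mem_enum mem_filter inE andbC.
      by case: (boolP (e \in E)) => [/EOm ->|]; rewrite ?andbF ?andbT.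
  have Hk := A_deg xA; rewrite H in Hk.
  rewrite count_filter.
  have : (count (fun e => [&& e \in E, x \in e & e \subset A t]) Om <=
          count (predI a (fun e => x \in e)) Om + count (pred1 (parent x)) Om)%N.
    rewrite -count_predUI; apply: leq_trans (leq_addr _ _).
    apply: sub_count => e /= /and3P[eE xe eA]; rewrite /a eE xe eA /=.
    by case: eqP; rewrite ?orbT.
  rewrite (count_uniq_mem _ uOm) => /(leq_trans Hk).
  by move: (count (predI _ _) _) (parent x \in Om) => D []; lia.
- move=> e; rewrite mem_filter => /andP[xe eOm] ae.
  apply/andP; split; last first.
    apply/fintype.subsetP => f /(WP _ _ ae)[->|[u ue /andP[fE bf]]]; rewrite inE.
      by rewrite (top_a _ ae) below_refl andbT; case/and4P: ae.
    by rewrite fE; exact: (belowS _ _ _ ae ue bf).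
  apply/existsP; exists [set e].
  rewrite sub1set setU11 set11 /=.
  apply: (box_all_intro (A := edges_below)).
  + by move=> u; exact: tree_witness_increasing.
  + exact: enum_uniq.
  + move=> u; rewrite mem_enum => ue; have [uv pu du] := child _ _ ae ue.
    have uA : u \in A t.
      case/and4P: ae => _ _ /fintype.subsetP sA _; apply: sA.
      by move: ue; rewrite inE => /andP[].
    apply/andP; split.
      apply: IH => //; first by rewrite du addSn -addnS.
      move=> w f df dT; have /andP[n1 n2] := nodef _ _ df dT.
      by apply/andP; split; [apply: contra n1|apply: contra n2]; exact: (belowS _ _ _ ae ue).
    apply/fintype.subsetP => f fb; rewrite in_setD in_set1 in_setU1.
    have -> /= : f != e.
      apply: contraTneq fb => ->; rewrite inE (top_a _ ae) negb_and.
      by apply/orP; right; rewrite /below negb_and du ltnn.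
    by apply/orP; right; apply/bigcupP; exists u.
  + move=> u u'; rewrite !mem_enum => ue ue' uu'; apply: contraT => /disjointPn[f].
    rewrite !inE => /andP[_ b1] /andP[_ b2].
    have [_ _ du] := child _ _ ae ue; have [_ _ du'] := child _ _ ae ue'.
    by case/eqP: uu'; apply: below_inj b1 b2; rewrite du du'.
- move=> e f ae af ef; apply: contraT => /disjointPn[g /(WP _ _ ae) ge /(WP _ _ af) gf].
  have no h h' u : a h -> a h' -> u \in h' :\ x -> below u (top h) -> false.
    move=> ah ah' uh'; rewrite (top_a _ ah) => /andP[].
    by have [_ _ ->] := child _ _ ah' uh'; rewrite ltnn.
  case: ge gf => [->|[u ue /andP[gE bu]]] [gf|[u' uf /andP[_ bu']]].
  + by rewrite gf eqxx in ef.
  + exact: no ae af uf bu'.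
  + by rewrite gf in bu; exact: no af ae ue bu.
  + have [_ pu du] := child _ _ ae ue; have [_ pu' du'] := child _ _ af uf.
    have uu : u = u' by apply: below_inj bu bu'; rewrite du du'.
    by case/eqP: ef; rewrite -pu -pu' uu.
Qed.

(* The incidences [(w, f)] with [w != top f] number [(r - 1) #|F|], and every
   vertex covered by [F] except [v] has one; each defect is one more. *)
Lemma defect_unique (w1 w2 : V) (e1 e2 : {set V}) :
  (forall F : {set {set V}}, F \subset E -> F != set0 -> (#|F| <= 4 * T.+2)%N ->
     (r.-1 * #|F| <= #|cover F|)%N) ->
  defect w1 e1 -> defect w2 e2 -> (dist (top e1) <= T)%N -> (dist (top e2) <= T)%N ->
  (w1, e1) = (w2, e2).
Proof.
move=> sparse d1 d2 l1 l2; apply/eqP; apply: contraT => ne12.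
pose upe (e : {set V}) := parent (top e).
have upeP e : e \in E -> top e != v -> (dist (top e) <= T.+1)%N ->
    upe e \in E /\ (dist (top (upe e))).+1 = dist (top e).
  move=> eE tv dT; have dB : (dist (top e) < B)%N by lia.
  by have [-> _ ->] := parentP tv dB.
have [chain [chainP mem_chain size_chain]] : exists chain : {set V} -> seq {set V},
    [/\ forall e f, e \in E -> (dist (top e) <= T.+1)%N -> f \in chain e ->
          [/\ f \in E, (dist (top f) <= T.+1)%N & top f != v -> upe f \in chain e],
        forall e, e \in chain e & forall e, size (chain e) = (dist (top e)).+1].
  exists (fun e => traject upe e (dist (top e)).+1).
  split=> [e f eE eT /trajectP[i iN ->]|e|e]; last 2 first.
  - by rewrite trajectS mem_head.
  - by rewrite size_traject.
  have [fE fd] : iter i upe e \in E /\ (dist (top (iter i upe e)) + i = dist (top e))%N.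
    elim: i iN => [|i IH] iN; first by rewrite addn0.
    have [fE fd] := IH (ltnW iN); rewrite iterS.
    have [] := upeP _ fE _ _; first by rewrite -dist_eq0; lia.
      by lia.
    by move=> -> /=; lia.
  split=> //; first by rewrite -fd in eT; apply: leq_trans eT; exact: leq_addr.
  move=> tv; rewrite -/(iter i.+1 upe e); apply/trajectP; exists i.+1 => //.
  have : (0 < dist (top (iter i upe e)))%N by rewrite lt0n dist_eq0.
  by rewrite ltnS -fd; lia.
have defP w e : defect w e -> (dist (top e) <= T)%N ->
    [/\ w != v, parent w \in E, w \in parent w, w != top (parent w) &
       (dist (top (parent w)) <= T.+1)%N].
  case/and4P=> eE we wt _ dT.
  have wv : w != v by apply: contraNneq wt => wv; rewrite wv in we *; rewrite top_eq_root.
  have dw : (dist w <= (dist (top e)).+1)%N.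
    by apply: dist_edge eE (topP eE).1 we _; lia.
  have wB : (dist w < B)%N by lia.
  have [pE wp dp] := parentP wv wB; split=> //; last by lia.
  by apply/eqP => wE; move: dp; rewrite -wE; lia.
have [v1 p1E w1p t1 dp1] := defP _ _ d1 l1.
have [v2 p2E w2p t2 dp2] := defP _ _ d2 l2.
have /and4P[e1E we1 wt1 pe1] := d1; have /and4P[e2E we2 wt2 pe2] := d2.
(* Both ways from each defect back to the root. A chain has at most [T.+2] edges, which is where the
   bound [4 * T.+2] comes from; what matters is that [L] is closed under [upe]. *)
pose L := chain e1 ++ chain (parent w1) ++ chain e2 ++ chain (parent w2).
have LP f : f \in L -> [/\ f \in E, (dist (top f) <= T.+1)%N & top f != v -> upe f \in L].
  have l1' := leqW l1; have l2' := leqW l2.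
  have sub e f' : e \in E -> (dist (top e) <= T.+1)%N -> {subset chain e <= L} ->
      f' \in chain e -> [/\ f' \in E, (dist (top f') <= T.+1)%N & top f' != v -> upe f' \in L].
    by move=> eE eT cL /(chainP _ _ eE eT)[-> -> U]; split=> // /U /cL.
  have inL e : e \in [:: e1; parent w1; e2; parent w2] -> {subset chain e <= L}.
    by rewrite !inE => /or4P[] /eqP -> h hc; rewrite !mem_cat hc ?orbT.
  move=> fL; have : [|| f \in chain e1, f \in chain (parent w1), f \in chain e2
      | f \in chain (parent w2)] by rewrite -!mem_cat.
  case/or4P=> H.
  - by apply: (sub _ _ e1E l1' _ H); apply: inL; rewrite mem_head.
  - by apply: (sub _ _ p1E dp1 _ H); apply: inL; rewrite !inE eqxx orbT.
  - by apply: (sub _ _ e2E l2' _ H); apply: inL; rewrite !inE eqxx !orbT.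
  - by apply: (sub _ _ p2E dp2 _ H); apply: inL; rewrite !inE eqxx !orbT.
pose F := [set f in L].
have FE : F \subset E by apply/fintype.subsetP => f; rewrite inE => /LP[].
have e1F : e1 \in F by rewrite inE !mem_cat mem_chain.
have p1F : parent w1 \in F by rewrite inE !mem_cat mem_chain !orbT.
have e2F : e2 \in F by rewrite inE !mem_cat mem_chain !orbT.
have p2F : parent w2 \in F by rewrite inE !mem_cat mem_chain !orbT.
have cF : (#|F| <= 4 * T.+2)%N.
  rewrite cardsE; apply: leq_trans (card_size L) _.
  by rewrite /L !size_cat !size_chain; clear -l1 l2 dp1 dp2; lia.
have F0 : F != set0 by apply/set0Pn; exists e1.
have := sparse F FE F0 cF; rewrite leqNgt => /negP; case.
pose inc := [set x : {set V} * V | (x.1 \in F) && (x.2 \in x.1 :\ top x.1)].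
have -> : (r.-1 * #|F| = #|inc|)%N.
  transitivity (\sum_(f in F) \sum_(w in f :\ top f) 1)%N; last first.
    by rewrite pair_big_dep /= sum1dep_card.
  rewrite mulnC -sum_nat_const; apply: eq_bigr => f fF.
  have fE := fintype.subsetP FE f fF.
  rewrite sum1_card; have := cardsD1 (top f) f; rewrite E_card // (topP fE).1.
  by clear; lia.
(* A vertex is charged to its parent edge whenever that is in [F], so the pair of a defect is never
   charged ([nJ]). Otherwise [w] cannot be the top of an edge of [F], as [F] is closed under [upe],
   and any edge of [F] at [w] will do. *)
pose g w := if parent w \in F then parent w
            else odflt set0 [pick f in F | (w \in f) && (w != top f)].
have gP w : w \in cover F :\ v -> [&& g w \in F, w \in g w & w != top (g w)].
  rewrite in_setD1 => /andP[wv /bigcupP[f fF wf]].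
  have fE := fintype.subsetP FE f fF.
  have dw : (dist w < B)%N.
    have fL : f \in L by rewrite inE in fF.
    have [_ dT _] := LP _ fL.
    have dB : ((dist (top f)).+1 < B)%N by apply: leq_ltn_trans B_large.
    exact: leq_ltn_trans (dist_edge fE (topP fE).1 wf dB) dB.
  have [pE wp dp] := parentP wv dw.
  rewrite /g; case: ifP => pF.
    by rewrite pF wp /=; apply/eqP => wE; move: dp; rewrite -wE; clear; lia.
  case: pickP => [h /and3P[hF wh wt]|none] /=; first by rewrite hF wh wt.
  have := none f; rewrite /= fF wf /= => /negbFE/eqP wE.
  have fL : f \in L by rewrite inE in fF.
  have [_ _ U] := LP _ fL.
  by move: pF; rewrite inE wE U // -wE.
have gF w : w \in cover F :\ v -> g w \in F by move/gP => /andP[].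
pose J := [set (g w, w) | w in cover F :\ v].
have Jinc : (e1, w1) |: ((e2, w2) |: J) \subset inc.
  apply/fintype.subsetP => x; rewrite !in_setU1 => /or3P[/eqP->|/eqP->|/imsetP[w wC ->]];
    rewrite inE /= in_setD1.
  - by rewrite e1F we1 wt1.
  - by rewrite e2F we2 wt2.
  - by have /and3P[-> -> ->] := gP _ wC.
have nJ w e : parent w \in F -> parent w != e -> (e, w) \notin J.
  by move=> pF ne; apply/imsetP => -[u _ [eg uw]]; rewrite -uw /g pF in eg; rewrite eg eqxx in ne.
have := subset_leq_card Jinc.
rewrite !cardsU1 !in_setU1 xpair_eqE andbC -xpair_eqE (negbTE ne12) /= !nJ //= card_imset; last by move=> a b [].
have := cardsD1 v (cover F); case: (v \in _) => /=; clear; lia.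
Qed.

(** For [r = 2] the [k >= 3] edges have distinct other ends. For [r >= 3] two neighbours would leave
    room for a single edge only. The case [(2, 2)] has to be excluded: a vertex on a cycle has just
    two neighbours. *)
Lemma degree_cover_ge3 (S : {set {set V}}) (U : {set V}) : (1 < k)%N ->
  (k, r) <> (2%N, 2%N) -> (k <= #|S|)%N ->
  (forall e, e \in S -> [/\ #|e| = r, v \in e & e :\ v \subset U]) -> (2 < #|U|)%N.
Proof.
move=> k1 kr kS SP; rewrite ltnNge; apply/negP => U2.
have eU e : e \in S -> e \subset v |: U.
  by move=> /SP[_ ve eU]; rewrite -(setD1K ve); apply: finset.setUS.
have [r2|r3] := leqP r 2.
  have r2' : r = 2%N by lia.
  have k3 : (2 < k)%N by have : k <> 2%N by [move=> k2; apply: kr; rewrite k2 r2']; lia.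
  have : S \subset [set [set v; u] | u in U].
    apply/fintype.subsetP => e eS; have [ce ve eDU] := SP _ eS.
    have : #|e :\ v| == 1%N by have := cardsD1 v e; rewrite ce ve r2'; lia.
    case/cards1P => u eu; apply/imsetP; exists u.
      by apply: (fintype.subsetP eDU); rewrite eu set11.
    by rewrite -(setD1K ve) eu.
  move/subset_leq_card => SU; have := leq_trans SU (leq_imset_card _ _).
  by move: kS k3 U2; clear; lia.
have cvU : (#|v |: U| <= 3)%N by rewrite cardsU1; case: (v \notin U) => /=; lia.
have : S \subset [set v |: U].
  apply/fintype.subsetP => e eS; rewrite in_set1; have [ce _ _] := SP _ eS.
  rewrite eqEcard (eU _ eS) ce; lia.
by move/subset_leq_card; rewrite cards1; lia.
Qed.

(* The root has at least three neighbours, and only the vertex and the edge of the unique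
   defect can spoil the branches of a neighbour, each at most one of them. *)
Lemma exists_tree_witness (Om : seq {set V}) : uniq Om -> {subset E <= Om} ->
  (1 < k)%N -> (k, r) <> (2%N, 2%N) ->
  (forall F : {set {set V}}, F \subset E -> F != set0 -> (#|F| <= 4 * T.+2)%N ->
     (r.-1 * #|F| <= #|cover F|)%N) ->
  v \in A T.+1 -> exists u, tree_witness k.-1 Om T u E.
Proof.
move=> uOm EOm k1 kr sparse vA.
pose S := [set e in E | (v \in e) && (e \subset A T)].
pose U := \bigcup_(e in S) (e :\ v).
have U3 : (2 < #|U|)%N.
  apply: (@degree_cover_ge3 S) => // [|e eS]; first exact: A_deg.
  have /and3P[eE ve _] : [&& e \in E, v \in e & e \subset A T] by rewrite inE in eS.
  by split; [exact: E_card| |exact: (bigcup_sup e eS)].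
have UP u : u \in U -> [/\ u \in A T, u != v & dist u = 1%N].
  case/bigcupP => e; rewrite inE => /and3P[eE ve eA]; rewrite !inE => /andP[uv ue].
  split=> //; first exact: (fintype.subsetP eA).
  have dv : dist v = 0%N by apply/eqP; rewrite dist_eq0.
  apply/eqP; rewrite eqn_leq lt0n dist_eq0 uv andbT -dv.
  by apply: dist_edge eE ve ue _; rewrite dv; lia.
have fin u : u \in U ->
    (forall w e, defect w e -> (dist (top e) <= T)%N -> ~~ below u w && ~~ below u (top e)) ->
    exists u, tree_witness k.-1 Om T u E.
  move=> /UP[uA uv du] nodef; exists u.
  apply: (tree_witness_increasing (A := edges_below u)).
    by apply/fintype.subsetP => f; rewrite inE => /andP[].
  by apply: tree_witness_below => //; rewrite du.
have [/existsP[[w0 e0] /= /andP[df0 dT0]]|nodef] :=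
    boolP [exists x : V * {set V}, defect x.1 x.2 && (dist (top x.2) <= T)%N].
  have [/exists_inP[u uU ok]|all_bad] :=
      boolP [exists u in U, ~~ below u w0 && ~~ below u (top e0)].
    apply: (fin u uU) => w e df dT.
    by have [-> ->] := defect_unique sparse df df0 dT dT0.
  have one z : (#|[set u in U | below u z]| <= 1)%N.
    rewrite leqNgt; apply/negP => /card_gt1P[x [y [+ + xy]]].
    rewrite !inE => /andP[/UP[_ _ dx] bx] /andP[/UP[_ _ dy] byy].
    by case/eqP: xy; apply: below_inj bx byy; rewrite dx dy.
  have : U \subset [set u in U | below u w0] :|: [set u in U | below u (top e0)].
    apply/fintype.subsetP => u uU; rewrite !inE uU /=; apply: contraT; rewrite negb_or => ok.
    by case/negP: all_bad; apply/exists_inP; exists u.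
  move/subset_leq_card; rewrite cardsU.
  by have := one w0; have := one (top e0); lia.
have /card_gt0P[u uU] : (0 < #|U|)%N by lia.
apply: (fin u uU) => w e df dT; case/negP: nodef.
by apply/existsP; exists (w, e); rewrite df dT.
Qed.

End Exploration.

(** * First moment of dense edge families *)

Section DenseSubfamilies.
Variables (R : realFieldType) (V : finType).

Definition dense_family r (F : {set {set V}}) := (#|cover F| < r.-1 * #|F|)%N.

Lemma bernP_exists (T : finType) (p : R) (s : seq T) (I : finType) (P : I -> {set T} -> bool) :
  0 <= p <= 1 -> bernP p s (fun E => [exists i, P i E]) <= \sum_i bernP p s (P i).
Proof.
move=> p01; rewrite /bernP -bernE_sum; apply: bernE_le => // E _.
case: (boolP [exists _, _]) => [/existsP[i Pi]|_]; last by rewrite sumr_ge0.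
by rewrite (bigD1 i) //= Pi lerDl sumr_ge0.
Qed.

Lemma bernP_subset (T : finType) (p : R) (s : seq T) (F : {set T}) :
  0 <= p <= 1 -> uniq s -> bernP p s (fun E => F \subset E) <= p ^+ #|F|.
Proof.
move=> p01 us; rewrite cardE.
have inc (x : T) : increasing (fun E : {set T} => x \in E).
  by move=> A B AB; apply: (fintype.subsetP AB).
apply: (@le_trans _ _ (bernP p s (box_all (fun x (E : {set T}) => x \in E) (enum F)))).
  apply: bernP_le => // E _ FE; apply: (box_all_intro (A := fun x => [set x])) => //.
  - exact: enum_uniq.
  - by move=> x; rewrite mem_enum set11 sub1set; apply: (fintype.subsetP FE).
  - by move=> x y _ _ xy; rewrite disjoints1 inE.
by apply: bernP_box_all => // x _; exact: bernP_mem.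
Qed.

(* A dense family is encoded by a list of [(r - 1) m - 1] vertices that contains those it
   covers, and by the positions of the vertices of its edges in this list. *)
Lemma card_dense_family (r m : nat) : (0 < r)%N ->
  (#|[set F : {set {set V}} | [&& #|F| == m.+1, [forall f in F, #|f| == r] & dense_family r F]]| <=
   #|V| ^ (r.-1 * m.+1).-1 * ((r.-1 * m.+1).-1 ^ r) ^ m.+1)%N.
Proof.
move=> r0; set s := (r.-1 * m.+1).-1.
pose dec (x : {ffun 'I_s -> V} * {ffun 'I_m.+1 -> {ffun 'I_r -> 'I_s}}) :=
  [set [set x.1 (x.2 i j) | j : 'I_r] | i : 'I_m.+1].
apply: (@leq_trans #|[set dec x | x in [set: {ffun 'I_s -> V} * {ffun 'I_m.+1 -> {ffun 'I_r -> 'I_s}}]]|).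
  apply: subset_leq_card; apply/fintype.subsetP => F; rewrite inE => /and3P[/eqP cF /forall_inP Fr dF].
  have cs : (#|cover F| <= s)%N by rewrite /dense_family cF in dF; rewrite /s; lia.
  have idx w : w \in cover F -> (index w (enum (cover F)) < s)%N.
    by move=> wF; apply: leq_trans cs; rewrite cardE index_mem mem_enum.
  have [f0 f0F] : exists f0, f0 \in F by apply/card_gt0P; rewrite cF.
  have [w0 w0f] : exists w0, w0 \in f0 by apply/card_gt0P; rewrite (eqP (Fr _ f0F)).
  have w0F : w0 \in cover F by apply/bigcupP; exists f0.
  pose enc w : 'I_s := insubd (Ordinal (idx _ w0F)) (index w (enum (cover F))).
  pose phi := [ffun i : 'I_s => nth w0 (enum (cover F)) i].
  have encK w : w \in cover F -> phi (enc w) = w.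
    move=> wF; rewrite ffunE /enc val_insubd idx // nth_index ?mem_enum //.
  pose edge (i : 'I_m.+1) := nth f0 (enum F) i.
  have edgeF i : edge i \in F by rewrite -mem_enum mem_nth // -cardE cF.
  pose psi := [ffun i : 'I_m.+1 => [ffun j : 'I_r => enc (nth w0 (enum (edge i)) j)]].
  have wcover i w : w \in edge i -> w \in cover F by move=> wi; apply/bigcupP; exists (edge i).
  have psiE i j : psi i j = enc (nth w0 (enum (edge i)) j) by rewrite !ffunE.
  have dpsi i : [set phi (psi i j) | j : 'I_r] = edge i.
    have ci : #|edge i| = r by apply/eqP/Fr.
    have nin (j : 'I_r) : nth w0 (enum (edge i)) j \in edge i.
      by rewrite -mem_enum mem_nth // -cardE ci.
    apply/setP => w; apply/imsetP/idP => [[j _ ->]|wi].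
      by rewrite psiE encK ?nin //; apply: wcover (nin j).
    have jr : (index w (enum (edge i)) < r)%N by rewrite -ci cardE index_mem mem_enum.
    exists (Ordinal jr) => //; rewrite psiE /= nth_index ?mem_enum //.
    by rewrite encK //; apply: wcover wi.
  apply/imsetP; exists (phi, psi); rewrite ?inE // /dec /=.
  apply/setP => f; apply/idP/imsetP => [fF|[i _ ->]]; last by rewrite dpsi.
  have fm : (index f (enum F) < m.+1)%N by rewrite -cF cardE index_mem mem_enum.
  by exists (Ordinal fm) => //; rewrite dpsi /edge nth_index ?mem_enum.
apply: leq_trans (leq_imset_card _ _) _.
by rewrite cardsT card_prod !card_ffun !card_ord.
Qed.

Lemma bernP_dense_family (p : R) (Om : seq {set V}) (r L : nat) : 0 <= p <= 1 -> uniq Om ->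
  (0 < r)%N -> (forall e, e \in Om -> #|e| = r) ->
  bernP p Om (fun E => [exists F : {set {set V}},
     [&& F \subset E, F != finset.set0, (#|F| <= L)%N & dense_family r F]]) <=
  \sum_(m < L) (#|V| ^ (r.-1 * m.+1).-1 * ((r.-1 * m.+1).-1 ^ r) ^ m.+1)%:R * p ^+ m.+1.
Proof.
move=> p01 uOm r0 cOm; have /andP[p0 p1] := p01.
pose bad (m : 'I_L) := [set F : {set {set V}} |
  [&& #|F| == m.+1, [forall f in F, #|f| == r] & dense_family r F]].
apply: (@le_trans _ _ (bernP p Om (fun E => [exists m : 'I_L,
    [exists F : {set {set V}}, (F \in bad m) && (F \subset E)]]))).
  apply: bernP_le => // E /fintype.subsetP EOm /existsP[F /and4P[FE F0 FL dF]].
  have cF : (#|F|.-1 < L)%N by move: F0; rewrite -card_gt0; lia.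
  apply/existsP; exists (Ordinal cF); apply/existsP; exists F; rewrite FE andbT inE /=.
  rewrite prednK ?card_gt0 // eqxx dF andbT /=; apply/forall_inP => f fF.
  by apply/eqP/cOm; have := EOm _ (fintype.subsetP FE _ fF); rewrite inE.
apply: le_trans (bernP_exists _ _ p01) _; apply: ler_sum => m _.
apply: le_trans (bernP_exists _ _ p01) _.
apply: (@le_trans _ _ (\sum_(F in bad m) p ^+ m.+1)).
  rewrite big_mkcond /= [leRHS]big_mkcond /=; apply: ler_sum => F _.
  case: ifP => Fb; last by rewrite /bernP (bernE_cst p Om 0).
  have : #|F| = m.+1 by move: Fb; rewrite inE => /and3P[/eqP].
  by move=> <-; apply: bernP_subset.
rewrite sumr_const -[leLHS]mulr_natl ler_wpM2r ?exprn_ge0 // ler_nat.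
exact: card_dense_family.
Qed.

End DenseSubfamilies.

(** * Peeling random words *)

Section WordSums.
Variable R : realFieldType.

Fixpoint wsum (T : finType) n (F : seq T -> R) : R :=
  if n is n'.+1 then \sum_a wsum n' (fun x => F (a :: x)) else F [::].

Section OneAlphabet.
Variable T : finType.
Implicit Types (F G : seq T -> R).

Lemma eq_wsum n F G : (forall x, size x = n -> F x = G x) -> wsum n F = wsum n G.
Proof.
elim: n F G => [|n IH] F G FG /=; first exact: FG.
by apply: eq_bigr => a _; apply: IH => x sx; apply: FG; rewrite /= sx.
Qed.

Lemma wsum_le n F G : (forall x, size x = n -> F x <= G x) -> wsum n F <= wsum n G.
Proof.
elim: n F G => [|n IH] F G FG /=; first exact: FG.
by apply: ler_sum => a _; apply: IH => x sx; apply: FG; rewrite /= sx.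
Qed.

Lemma wsum0 n : wsum n (fun _ : seq T => 0) = 0.
Proof. by elim: n => [|n IH] //=; rewrite big1. Qed.

Lemma wsum_ge0 n F : (forall x, size x = n -> 0 <= F x) -> 0 <= wsum n F.
Proof. by move=> F0; rewrite -(wsum0 n); apply: wsum_le. Qed.

Lemma wsumD n F G : wsum n (fun x => F x + G x) = wsum n F + wsum n G.
Proof.
elim: n F G => [|n IH] F G //=; rewrite -big_split; apply: eq_bigr => a _.
exact: IH.
Qed.

Lemma wsumZ n a F : wsum n (fun x => a * F x) = a * wsum n F.
Proof.
elim: n F => [|n IH] F //=; rewrite big_distrr; apply: eq_bigr => b _.
exact: IH.
Qed.

Lemma wsum_sum n (I : Type) (r : seq I) (P : pred I) (F : I -> seq T -> R) :
  wsum n (fun x => \sum_(i <- r | P i) F i x) = \sum_(i <- r | P i) wsum n (F i).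
Proof.
elim: n F => [|n IH] F //=; rewrite exchange_big /=; apply: eq_bigr => a _.
exact: IH.
Qed.

Lemma wsum_const n a : wsum n (fun _ : seq T => a) = #|T|%:R ^+ n * a.
Proof.
elim: n => [|n IH] /=; first by rewrite mul1r.
by rewrite IH sumr_const -[LHS]mulr_natl exprS mulrA.
Qed.

Lemma wsum_cat m n F : wsum (m + n) F = wsum m (fun x => wsum n (fun y => F (x ++ y))).
Proof.
elim: m F => [|m IH] F //=.
by apply: eq_bigr => a _; rewrite IH.
Qed.

Lemma sum_tuple n F : \sum_(t : n.-tuple T) F t = wsum n F.
Proof.
elim: n F => [|n IH] F /=.
  by rewrite (big_pred1 [tuple]) // => t; apply/esym/eqP; exact: tuple0.
rewrite (reindex (fun p : T * n.-tuple T => cons_tuple p.1 p.2)) /=; last first.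
  exists (fun t : n.+1.-tuple T => (thead t, behead_tuple t)) => [[a t] _|t _] /=.
    by congr (_, _); apply: val_inj.
  by rewrite [RHS]tuple_eta; apply: val_inj.
rewrite -(pair_big xpredT xpredT (fun a (t : n.-tuple T) => F (a :: t))) /=.
by apply: eq_bigr => a _; rewrite -IH.
Qed.

Lemma wsumS n F : wsum n.+1 F = \sum_a wsum n (fun x => F (a :: x)).
Proof. by []. Qed.

Local Arguments wsum : simpl never.

(** Weighting by the sum of [a] amounts to marking a letter. By symmetry of [F] the mark may be
    moved to the front, hence the factor [n.+1]. *)
Lemma wsum_mark n (a : T -> R) F : (forall x y, perm_eq x y -> F x = F y) ->
  wsum n.+1 (fun x => (\sum_(t <- x) a t) * F x) =
  n.+1%:R * \sum_t a t * wsum n (fun x => F (t :: x)).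
Proof.
elim: n F => [|n IH] F Fperm.
  by rewrite wsumS mul1r; apply: eq_bigr => t _; rewrite /wsum big_seq1.
transitivity (\sum_t (a t * wsum n.+1 (fun x => F (t :: x)) +
    wsum n.+1 (fun x => (\sum_(u <- x) a u) * F (t :: x)))).
  apply: eq_bigr => t _; rewrite -wsumZ -wsumD.
  rewrite -[LHS]/(wsum n.+1 (fun x => (\sum_(u <- t :: x) a u) * F (t :: x))).
  by apply: eq_wsum => x _; rewrite big_cons mulrDl.
rewrite big_split /=.
have -> : \sum_t wsum n.+1 (fun x => (\sum_(u <- x) a u) * F (t :: x)) =
    \sum_t n.+1%:R * \sum_u a u * wsum n (fun x => F (u :: t :: x)).
  apply: eq_bigr => t _; rewrite IH; last first.
    by move=> x y xy; apply: Fperm; rewrite perm_cons.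
  congr (_ * _); apply: eq_bigr => u _; congr (_ * _); apply: eq_wsum => x _.
  by apply: Fperm; apply/permP => P /=; lia.
rewrite -big_distrr exchange_big /=.
have -> : \sum_u \sum_t a u * wsum n (fun x => F (u :: t :: x)) =
    \sum_t a t * wsum n.+1 (fun x => F (t :: x)).
  by apply: eq_bigr => u _; rewrite -big_distrr.
by rewrite -{1}[X in X + _]mul1r -mulrDl nat1r.
Qed.

End OneAlphabet.

Lemma wsum_flatten (T : finType) r M (F : seq T -> R) :
  wsum M (fun X : seq (r.-tuple T) => F (flatten (map val X))) = wsum (r * M) F.
Proof.
elim: M F => [|M IH] F; first by rewrite muln0.
rewrite mulnS wsum_cat -[RHS]sum_tuple /=; apply: eq_bigr => t _.
by rewrite -IH.
Qed.

End WordSums.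

Section Peelable.
Variables (T : finType) (k : nat).
Implicit Types (X Y Z : seq (seq T)).

Definition light_in v X := (0 < count_mem v (flatten X) < k)%N.

(* [X] lists edges with multiplicity, each edge being the word of its vertices; it is
   [peelable] when its [k]-core is empty. *)
Definition peelable X :=
  all (fun Y => (Y == [::]) || [exists v, light_in v Y])
    [seq take i Y | Y <- permutations X, i <- iota 0 (size X).+1].

Lemma peelableP X :
  reflect (forall Y Z, perm_eq X (Y ++ Z) -> Y != [::] -> exists v, light_in v Y)
    (peelable X).
Proof.
apply: (iffP allP) => [H Y Z XYZ Y0|H Y /allpairsP[[W i] /= [WX _ ->]]].
  have /H : Y \in [seq take i Y | Y <- permutations X, i <- iota 0 (size X).+1].
    apply/allpairsP; exists (Y ++ Z, size Y); split.
    - by rewrite mem_permutations /= perm_sym.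
    - by rewrite mem_iota add0n (perm_size XYZ) size_cat ltnS /= leq_addr.
    - by rewrite take_size_cat.
  by rewrite (negbTE Y0) => /existsP.
case: eqP => //= /eqP Y0; apply/existsP; apply: (H _ (drop i W)) => //.
by rewrite cat_take_drop perm_sym -mem_permutations.
Qed.

Lemma peelable_perm X Y : perm_eq X Y -> peelable X = peelable Y.
Proof.
move=> XY; apply/peelableP/peelableP => H A B AB; apply: (H A B).
  exact: perm_trans AB.
by rewrite perm_sym in XY; exact: perm_trans AB.
Qed.

Lemma peelable_behead x X : peelable (x :: X) -> peelable X.
Proof.
move/peelableP => H; apply/peelableP => Y Z XYZ; apply: (H Y (x :: Z)).
by rewrite perm_sym -cat1s perm_catCA /= perm_cons perm_sym.
Qed.

Lemma peelable_light X : peelable X -> X != [::] -> exists v, light_in v X.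
Proof. by move/peelableP/(_ X [::]); rewrite cats0; apply. Qed.

End Peelable.

Section CountVectors.
Variables (R : realFieldType) (V : finType).
Implicit Types (d : {ffun V -> nat}) (x : seq V) (u v : V).

Definition cnt x : {ffun V -> nat} := [ffun u => count_mem u x].

Definition total d := (\sum_u d u)%N.

Definition dec u d : {ffun V -> nat} := [ffun w => d w - (w == u)]%N.

Definition inc u d : {ffun V -> nat} := [ffun w => d w + (w == u)]%N.

Lemma cnt_perm x y : perm_eq x y -> cnt x = cnt y.
Proof. by move/permP => xy; apply/ffunP => u; rewrite !ffunE xy. Qed.

Lemma total_cnt x : total (cnt x) = size x.
Proof.
rewrite /total; under eq_bigr => u _ do rewrite ffunE.
elim: x => [|a x IH] /=; first by rewrite big1.
rewrite big_split /= IH -add1n; congr (_ + _)%N.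
by rewrite (bigD1 a) //= eqxx big1 // => u; rewrite eq_sym => /negbTE ->.
Qed.

Lemma total_dec u d : (0 < d u)%N -> total d = (total (dec u d)).+1.
Proof.
move=> du; rewrite /total (bigD1 u) //= [in RHS](bigD1 u) //= ffunE eqxx subn1.
rewrite -{1}(prednK du) addSn; congr (_.+1); congr (_ + _)%N; apply: eq_bigr => w wu.
by rewrite ffunE (negbTE wu) subn0.
Qed.

Lemma count_le_total u d : (d u <= total d)%N.
Proof. by rewrite /total (bigD1 u) //= leq_addr. Qed.

Lemma cnt_cons u x d : (cnt (u :: x) == d) = (0 < d u)%N && (cnt x == dec u d).
Proof.
apply/eqP/andP => [<-|[du /eqP/ffunP H]].
  rewrite ffunE /= eqxx; split=> //; apply/eqP/ffunP => w; rewrite !ffunE /=.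
  by rewrite eq_sym addKn.
apply/ffunP => w; have := H w; rewrite !ffunE /= => ->.
have [->|wu] := eqVneq w u; first by rewrite ?eqxx subnKC.
by rewrite ?(negbTE wu) ?[u == w]eq_sym ?(negbTE wu) subn0.
Qed.

Definition multinom d : R := (total d)`!%:R * \prod_u ((d u)`!%:R)^-1.

Lemma multinom_ge0 d : 0 <= multinom d.
Proof. by rewrite mulr_ge0 // prodr_ge0 // => u _; rewrite invr_ge0. Qed.

(** The quotient is the probability that a uniform word with counts [d] begins with [u]; it turns
    sums over the first letter into the weights of [draw]. *)
Lemma multinom_dec u d : (0 < d u)%N ->
  multinom (dec u d) = multinom d * ((d u)%:R / (total d)%:R).
Proof.
move=> du; rewrite /multinom (total_dec du) factS natrM.
rewrite (bigD1 u) //= [in RHS](bigD1 u) //= ffunE eqxx subn1.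
have -> : \prod_(w | w != u) ((dec u d w)`!%:R)^-1 = \prod_(w | w != u) ((d w)`!%:R)^-1 :> R.
  by apply: eq_bigr => w wu; rewrite ffunE (negbTE wu) subn0.
rewrite -(prednK du) factS natrM /=.
have h1 : (d u).-1.+1%:R != 0 :> R by rewrite pnatr_eq0.
have h2 : ((d u).-1)`!%:R != 0 :> R by rewrite pnatr_eq0 -lt0n fact_gt0.
have h3 : (total (dec u d)).+1%:R != 0 :> R by rewrite pnatr_eq0.
move: ((d u).-1.+1%:R : R) ((d u).-1`!%:R : R) ((total (dec u d)).+1%:R : R) h1 h2 h3.
by move=> a b c' a0 b0 c0; field; rewrite a0 b0 c0.
Qed.

Lemma wsum_cnt m d : total d = m -> wsum m (fun x => (cnt x == d)%:R) = multinom d.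
Proof.
elim: m d => [|m IH] d dm.
  have d0 u : d u = 0%N by apply/eqP; rewrite -leqn0 -dm count_le_total.
  rewrite /= /multinom dm fact0 mul1r big1 => [|u _]; last by rewrite d0 fact0 invr1.
  have -> : cnt [::] = d by apply/ffunP => u; rewrite ffunE d0.
  by rewrite eqxx ?mulr1 ?mul1r.
rewrite wsumS; transitivity (\sum_u multinom d * ((d u)%:R / (total d)%:R)).
  apply: eq_bigr => u _; have [du|du] := posnP (d u).
    rewrite du mul0r mulr0 -(wsum0 R V m); apply: eq_wsum => x _.
    by rewrite cnt_cons du.
  rewrite -multinom_dec // -(IH (dec u d)); last by move: (total_dec du); lia.
  by apply: eq_wsum => x _; rewrite cnt_cons du.
rewrite -big_distrr /= -mulr_suml -natr_sum dm.
by rewrite -[X in X%:R / _]/(total d) dm divff ?mulr1 ?pnatr_eq0.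
Qed.

End CountVectors.

Section Variance.
Variable R : realFieldType.

(** The variance of [D] is at most its second moment. This is one step of the Chebyshev estimates,
    both for drawing and for adding clones. *)
Lemma weighted_square_le (I : finType) (w D : I -> R) (a K : R) :
  (forall i, 0 <= w i) -> \sum_i w i = 1 -> (forall i, 0 < w i -> `|D i| <= K) ->
  \sum_i w i * (a + D i) ^+ 2 <= (a + \sum_i w i * D i) ^+ 2 + K ^+ 2.
Proof.
move=> w0 w1 DK; set m := \sum_i w i * D i.
have -> : \sum_i w i * (a + D i) ^+ 2 = a ^+ 2 + 2 * a * m + \sum_i w i * D i ^+ 2.
  rewrite -[X in X + _ + _]mulr1 -{1}w1 /m 2!big_distrr -!big_split /=.
  by apply: eq_bigr => i _; ring.
have H : \sum_i w i * D i ^+ 2 <= K ^+ 2.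
  rewrite -[leRHS]mul1r -w1 big_distrl /=; apply: ler_sum => i _.
  have [wi|wi] := eqVneq (w i) 0; first by rewrite wi !mul0r.
  apply: ler_wpM2l => //; rewrite -[D i ^+ 2]real_normK ?num_real //.
  apply: lerXn2r; rewrite ?nnegrE ?normr_ge0 //.
    by apply: le_trans (DK i _); rewrite ?normr_ge0 // lt0r wi w0.
  by apply: DK; rewrite lt0r wi w0.
have := sqr_ge0 m; nra.
Qed.

End Variance.

Section HeavyPotential.
Variables (R : realFieldType) (k : nat).
Implicit Types (h : nat -> R).

(** Vanishing below [k] makes the removal of a clone of a light vertex free. The increment [k%:R] is
    the jump of [heavy] from [k - 1] to [k], and bounds the martingale increments. *)
Definition slow h := (forall d, (d < k)%N -> h d = 0) /\
  (forall d, 0 <= h d.+1 - h d <= k%:R).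

(* One of [T] clones is drawn and removed: a vertex with [d] clones loses one
   with probability [d / T]. *)
Definition draw T h d : R := (1 - Num.min 1 (d%:R / T%:R)) * h d + Num.min 1 (d%:R / T%:R) * h d.-1.

Definition heavy d : R := if (k <= d)%N then d%:R else 0.

Lemma draw_weight T d : 0 <= Num.min 1 (d%:R / T%:R : R) <= 1.
Proof. by rewrite le_min ler01 divr_ge0 //= ge_min lexx. Qed.

Lemma heavy_slow : (0 < k)%N -> slow heavy.
Proof.
move=> k0; split=> [d dk|d]; first by rewrite /heavy leqNgt dk.
rewrite /heavy; case: (leqP k d) => kd.
  by rewrite (leqW kd) -natr1 addrC addKr ler01 /= ler1n.
case: (leqP k d.+1) => kd'; last by rewrite subr0 lexx ler0n.
by rewrite subr0 ler0n ler_nat.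
Qed.

(** The new increment is a combination [(1 - z) * a + y * b] of two old ones with [y <= z <= 1].
    From [d = T] on, the cut-off by [Num.min 1] makes [draw] a mere shift of [h]. *)
Lemma draw_slow T h : (0 < T)%N -> slow h -> slow (draw T h).
Proof.
move=> T0 [h0 hd]; split=> [d dk|d].
  by rewrite /draw !h0 ?mulr0 ?addr0 //; apply: leq_ltn_trans dk; exact: leq_pred.
have TT : 0 < T%:R :> R by rewrite ltr0n.
have /andP[a0 ak] := hd d.
rewrite /draw /=; have [Td|Td] := leqP T d.
  have E e : (T <= e)%N -> Num.min 1 (e%:R / T%:R) = 1 :> R.
    by move=> Te; apply/min_idPl; rewrite ler_pdivlMr // mul1r ler_nat.
  rewrite !E ?(leqW Td) // !subrr !mul0r !add0r !mul1r.
  by have := hd d.-1; rewrite prednK //; apply: leq_trans Td.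
have E e : (e <= T)%N -> Num.min 1 (e%:R / T%:R) = e%:R / T%:R :> R.
  by move=> eT; apply/min_idPr; rewrite ler_pdivrMr // mul1r ler_nat.
rewrite !E ?(ltnW Td) //.
set y : R := d%:R / T%:R; set z : R := d.+1%:R / T%:R.
have z1 : z <= 1 by rewrite /z ler_pdivrMr // mul1r ler_nat.
have y0 : 0 <= y by rewrite /y divr_ge0.
have yz : y <= z by rewrite /y /z ler_pM2r ?invr_gt0 // ler_nat.
have -> : (1 - z) * h d.+1 + z * h d - ((1 - y) * h d + y * h d.-1) =
   (1 - z) * (h d.+1 - h d) + y * (h d - h d.-1) by ring.
have /andP[b0 bk] : 0 <= h d - h d.-1 <= k%:R.
  by case: (d) => [|e] /=; rewrite ?subrr ?lexx ?ler0n // hd.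
move: a0 ak b0 bk; set a := h d.+1 - _; set b := h d - _ => a0 ak b0 bk.
apply/andP; split; first by apply: addr_ge0; apply: mulr_ge0; rewrite // subr_ge0.
apply: (@le_trans _ _ ((1 - z) * k%:R + z * k%:R)); last by rewrite -mulrDl subrK mul1r.
apply: lerD; first by rewrite ler_wpM2l ?subr_ge0.
by apply: ler_pM.
Qed.

End HeavyPotential.

Section PeelingProcess.
Variables (R : realFieldType) (V : finType) (k r' M1 : nat) (A : R).
Local Notation r := r'.+1.
Hypothesis k_gt0 : (0 < k)%N.
Hypothesis A_large : (r * M1)%:R < A.
Implicit Types (d : {ffun V -> nat}) (u v : V).

(* [heavy_mean i d] is the expected number of clones a vertex with [d] clones
   will contribute once only [r * M1] clones are left, if [i] more are present now:
   in each group of [r] removals one clone belongs to a light vertex and the others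
   are drawn uniformly. *)
Fixpoint heavy_mean i : nat -> R :=
  if i is i'.+1 then
    if (r %| i)%N then heavy_mean i' else draw (r * M1 + i) (heavy_mean i')
  else heavy R k.

Lemma heavy_mean_slow i : slow k (heavy_mean i).
Proof.
elim: i => [|i IH] /=; first exact: heavy_slow.
by case: ifP => // _; apply: draw_slow => //; rewrite addnS.
Qed.

Definition heavy_total i d := \sum_u heavy_mean i (d u).

(* Chebyshev's bound, with variance at most [k ^ 2] per removal: when only [r * M1] clones
   are left, [heavy_total] is at most [r * M1], hence at distance at least [A - r * M1]
   from [A]. *)
Definition peel_bound i d : R :=
  ((heavy_total i d - A) ^+ 2 + k%:R ^+ 2 * i%:R) / (A - (r * M1)%:R) ^+ 2.

Lemma peel_bound_ge0 i d : 0 <= peel_bound i d.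
Proof.
by rewrite divr_ge0 ?sqr_ge0 // addr_ge0 ?sqr_ge0 // mulr_ge0 ?sqr_ge0.
Qed.

Lemma peel_bound0 d : total d = (r * M1)%N -> 1 <= peel_bound 0 d.
Proof.
move=> dM; have A0 : 0 < A - (r * M1)%:R by rewrite subr_gt0.
rewrite /peel_bound mulr0 addr0 ler_pdivlMr ?exprn_gt0 // mul1r.
have : heavy_total 0 d <= (r * M1)%:R.
  rewrite -dM /total natr_sum; apply: ler_sum => u _ /=.
  by rewrite /heavy; case: ifP.
move: (heavy_total 0 d) => X; nra.
Qed.

Lemma heavy_total_dec i u d :
  heavy_total i (dec u d) = heavy_total i d - (heavy_mean i (d u) - heavy_mean i (d u).-1).
Proof.
rewrite /heavy_total (bigD1 u) //= [in RHS](bigD1 u) //= ffunE eqxx subn1.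
under eq_bigr => w wu do rewrite ffunE (negbTE wu) subn0.
ring.
Qed.

Lemma peel_bound_light i v d : (r %| i.+1)%N -> (0 < d v < k)%N ->
  peel_bound i (dec v d) <= peel_bound i.+1 d.
Proof.
move=> ri /andP[dv dk]; have [h0 _] := heavy_mean_slow i.
have -> : peel_bound i.+1 d =
    ((heavy_total i d - A) ^+ 2 + k%:R ^+ 2 * i.+1%:R) / (A - (r * M1)%:R) ^+ 2.
  by rewrite /peel_bound /heavy_total /= ri.
rewrite /peel_bound heavy_total_dec !h0 //; last by apply: leq_ltn_trans dk; exact: leq_pred.
rewrite !subr0 ler_wpM2r ?invr_ge0 ?sqr_ge0 // lerD2l ler_wpM2l ?sqr_ge0 //.
by rewrite ler_nat.
Qed.

(** The mean of [heavy_total i] after a uniform removal is [heavy_total i.+1], by the choice of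
    [draw]; the variance is paid for by passing from [i] to [i.+1] in the term in [k%:R ^+ 2]. *)
Lemma peel_bound_draw i d : ~~ (r %| i.+1)%N -> total d = (r * M1 + i.+1)%N ->
  \sum_u (d u)%:R / (total d)%:R * peel_bound i (dec u d) <= peel_bound i.+1 d.
Proof.
move=> ri dM; have T0 : 0 < (total d)%:R :> R by rewrite ltr0n dM addnS.
pose D u := - (heavy_mean i (d u) - heavy_mean i (d u).-1).
have [_ hd] := heavy_mean_slow i.
have Xi : heavy_total i.+1 d = heavy_total i d + \sum_u (d u)%:R / (total d)%:R * D u.
  rewrite /heavy_total -big_split /=; apply: eq_bigr => u _.
  rewrite (negbTE ri) -dM /draw.
  have -> : Num.min 1 ((d u)%:R / (total d)%:R) = (d u)%:R / (total d)%:R :> R.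
    by apply/min_idPr; rewrite ler_pdivrMr // mul1r ler_nat count_le_total.
  by rewrite /D; ring.
have W1 : \sum_u (d u)%:R / (total d)%:R = 1 :> R.
  by rewrite -mulr_suml -natr_sum divff // gt_eqF.
have E u : (d u)%:R / (total d)%:R * peel_bound i (dec u d) =
    ((d u)%:R / (total d)%:R * (heavy_total i d - A + D u) ^+ 2
     + (d u)%:R / (total d)%:R * (k%:R ^+ 2 * i%:R)) / (A - (r * M1)%:R) ^+ 2.
  rewrite /peel_bound heavy_total_dec -/(D u).
  have -> : heavy_total i d - (heavy_mean i (d u) - heavy_mean i (d u).-1) - A =
            heavy_total i d - A + D u by rewrite /D; ring.
  by rewrite [LHS]mulrA [in LHS]mulrDr.
rewrite (eq_bigr _ (fun u _ => E u)) -mulr_suml /peel_bound.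
rewrite ler_wpM2r ?invr_ge0 ?sqr_ge0 // big_split /= -mulr_suml W1 mul1r.
have := @weighted_square_le _ _ (fun u => (d u)%:R / (total d)%:R) D
  (heavy_total i d - A) k%:R _ W1 _.
rewrite -natr1 mulrDr mulr1 addrCA addrA => H.
apply: (@le_trans _ _ ((heavy_total i.+1 d - A) ^+ 2 + k%:R ^+ 2 + k%:R ^+ 2 * i%:R)).
  rewrite lerD2r Xi addrAC; apply: H => [u|u]; first by rewrite divr_ge0.
  rewrite ltr_pdivlMr // mul0r ltr0n => du; rewrite /D normrN.
  by have := hd (d u).-1; rewrite prednK // => /andP[a0 ak]; rewrite ger0_norm.
by rewrite addrAC -addrA addrC -addrA; lra.
Qed.

Definition flat (X : seq (r.-tuple V)) : seq V := flatten (map val X).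

(** The word [w] holds the clones still to be drawn from the edge being removed: they count in [d],
    but no longer for peelability. *)
Definition peel_count M j d : R := wsum j (fun w : seq V => wsum M (fun X : seq (r.-tuple V) =>
  (peelable k (map val X) && (cnt (w ++ flat X) == d))%:R)).

Lemma peel_countS M j d :
  peel_count M j.+1 d = \sum_u (0 < d u)%N%:R * peel_count M j (dec u d).
Proof.
rewrite /peel_count wsumS; apply: eq_bigr => u _; rewrite -wsumZ.
apply: eq_wsum => w _; rewrite -wsumZ; apply: eq_wsum => X _.
by rewrite cat_cons cnt_cons -natrM mulnb andbCA.
Qed.

(** The left side marks a clone of [v]. Moving its row to the front, then the clone to the front of
    its row, accounts for the factors [M.+1] and [r]. What is left of the row becomes the pending
    word, and the other rows remain peelable. *)
Lemma peel_count_light M v d : (0 < d v < k)%N ->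
  (d v)%:R * peel_count M.+1 0 d <= (r * M.+1)%:R * peel_count M r' (dec v d).
Proof.
move=> /andP[dv dk].
pose Phi X := (peelable k (map val X) && (cnt (flat X) == d))%:R : R.
have PhiP X Y : perm_eq X Y -> Phi X = Phi Y.
  move=> XY; rewrite /Phi /flat (peelable_perm _ (perm_map _ XY)) (cnt_perm (y := flat Y)) //.
  exact/perm_flatten/perm_map.
have -> : (d v)%:R * peel_count M.+1 0 d =
    wsum M.+1 (fun X : seq (r.-tuple V) => (\sum_(t <- X) (count_mem v t)%:R) * Phi X).
  rewrite -[peel_count M.+1 0 d]/(wsum M.+1 Phi) -wsumZ; apply: eq_wsum => X _.
  rewrite /Phi; case: (boolP (_ && _)); last by rewrite !mulr0.
  move=> /andP[_ /eqP/ffunP/(_ v)]; rewrite ffunE => <-; congr (_ * _).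
  rewrite -natr_sum /flat count_flatten sumnE !big_map.
  by rewrite [in RHS]big_seq [in LHS]big_seq.
rewrite wsum_mark //.
pose G (w : seq V) := wsum M (fun X : seq (r.-tuple V) =>
   (peelable k (map val X) && (cnt (w ++ flat X) == d))%:R : R).
have GP x y : perm_eq x y -> G x = G y.
  move=> xy; apply: eq_wsum => X _; rewrite (cnt_perm (y := y ++ flat X)) //.
  by rewrite perm_cat2r.
apply: (@le_trans _ _ (M.+1%:R * \sum_(t : r.-tuple V) (\sum_(u <- t) (u == v)%:R) * G t)).
  rewrite ler_wpM2l //; apply: ler_sum => t _.
  have -> : (count_mem v t)%:R = \sum_(u <- t) (u == v)%:R :> R.
    by rewrite -natr_sum -sum1_count big_mkcond /=; congr (_%:R); apply: eq_bigr => u _; case: eqP.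
  apply: ler_wpM2l; first by rewrite sumr_ge0.
  apply: wsum_le => X _; rewrite /Phi ler_nat /flat /=.
  case: (boolP (peelable k (_ :: _))) => [/peelable_behead -> //|_].
  by rewrite andFb.
rewrite (sum_tuple _ (fun w => (\sum_(u <- w) (u == v)%:R) * G w)) wsum_mark //.
rewrite mulrA -natrM mulnC (bigD1 v) //= eqxx mul1r [X in _ + X]big1 ?addr0; last first.
  by move=> u /negbTE ->; rewrite mul0r.
rewrite ler_wpM2l // /peel_count; apply: wsum_le => w _; apply: wsum_le => X _.
by rewrite cat_cons cnt_cons dv.
Qed.

Lemma peel_count_draws M j d : (j < r)%N -> (M1 <= M)%N -> total d = (r * M + j)%N ->
  (forall d, total d = (r * M)%N ->
     peel_count M 0 d <= multinom R d * peel_bound (r * (M - M1)) d) ->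
  peel_count M j d <= multinom R d * peel_bound (r * (M - M1) + j) d.
Proof.
move=> + MM + H0; elim: j d => [|j IH] d jr dM.
  by move: dM; rewrite !addn0; exact: H0.
rewrite peel_countS.
have T0 : total d = (r * M1 + (r * (M - M1) + j).+1)%N by rewrite -addnS addnA -mulnDr subnKC.
have nr : ~~ (r %| (r * (M - M1) + j).+1)%N.
  by rewrite -addnS dvdn_addr ?dvdn_mulr // gtnNdvd.
rewrite addnS; apply: le_trans (ler_wpM2l (multinom_ge0 _ _) (peel_bound_draw nr T0)).
rewrite big_distrr /=; apply: ler_sum => u _.
have [du|du] := posnP (d u); first by rewrite du !mul0r mulr0.
rewrite mul1r mulrA -multinom_dec //; apply: IH; first exact: ltnW.
by move: (total_dec du); rewrite dM addnS => -[].
Qed.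

(** In a uniform word with counts [d], peelability has probability at most [peel_bound]. If [d] has
    no light vertex, no word is peelable. Otherwise [v] is chosen from [d] alone, so it is the same
    for all words counted: one light removal and [r'] draws lead to the case [m]. *)
Lemma peel_count_le m d : total d = (r * (M1 + m))%N ->
  peel_count (M1 + m) 0 d <= multinom R d * peel_bound (r * m) d.
Proof.
elim: m d => [|m IH] d dM.
  move: dM; rewrite !addn0 muln0 => dM.
  apply: le_trans (ler_peMr (multinom_ge0 _ _) (peel_bound0 dM)).
  rewrite -(wsum_cnt R dM) -wsum_flatten /peel_count /=; apply: wsum_le => X _.
  by rewrite /flat; case: (peelable _ _); case: (_ == d); rewrite ?lexx ?ler01.
have [/existsP[v dv]|nolight] := boolP [exists v, 0 < d v < k]%N; last first.
  apply: le_trans (mulr_ge0 (multinom_ge0 R d) (peel_bound_ge0 _ _)).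
  rewrite /peel_count /= -(wsum0 R (r.-tuple V) (M1 + m.+1)); apply: wsum_le => X sX.
  case: (boolP (_ && _)) => // /andP[/peelable_light pX /eqP dX].
  have [|v] := pX; first by rewrite -size_eq0 size_map sX addnS.
  move=> lv; case/negP: nolight; apply/existsP; exists v; rewrite -dX ffunE; exact: lv.
have dv0 : (0 < d v)%N by case/andP: dv.
have dvR : 0 < (d v)%:R :> R by rewrite ltr0n.
rewrite addnS -(ler_pM2l dvR); apply: le_trans (peel_count_light _ dv) _.
have T0 : total (dec v d) = (r * (M1 + m) + r')%N.
  by move: (total_dec dv0); rewrite dM addnS mulnS addSn addnC => -[].
have D := @peel_count_draws (M1 + m) r' (dec v d) (ltnSn _) (leq_addr _ _) T0.
rewrite addKn in D; apply: le_trans (ler_wpM2l _ (D IH)) _ => //.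
rewrite multinom_dec // dM addnS.
have TR : (r * (M1 + m).+1)%:R != 0 :> R by rewrite pnatr_eq0.
have -> : (r * (M1 + m).+1)%:R * (multinom R d * ((d v)%:R / (r * (M1 + m).+1)%:R) *
     peel_bound (r * m + r') (dec v d)) =
   (d v)%:R * (multinom R d * peel_bound (r * m + r') (dec v d)).
  by move: (_ * _)%:R TR => N N0; field.
rewrite ler_pM2l // ler_wpM2l ?multinom_ge0 //.
have <- : (r * m + r').+1 = (r * m.+1)%N by rewrite mulnS; lia.
by apply: peel_bound_light => //; rewrite -addnS dvdn_addr ?dvdn_mulr.
Qed.

End PeelingProcess.

(** * Random degrees of a uniform word *)

Section WordPhase.
Variables (R : realFieldType) (V : finType) (k : nat).
Hypothesis V_gt0 : (0 < #|V|)%N.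
Local Notation n := #|V|.
Implicit Types (h : nat -> R).

(** The mean of [h] at a vertex with [d] clones after [i] further clones have been placed uniformly
    among the [n] vertices. *)
Fixpoint add_mean h i : nat -> R :=
  if i is i'.+1 then fun d => (1 - n%:R^-1) * add_mean h i' d + n%:R^-1 * add_mean h i' d.+1
  else h.

Lemma inv_card_01 : 0 <= (n%:R^-1 : R) <= 1.
Proof. by rewrite invr_ge0 ler0n /= invf_le1 ?ltr0n // ler1n. Qed.

Lemma add_mean_slow h i : slow k h ->
  forall d, 0 <= add_mean h i d.+1 - add_mean h i d <= k%:R.
Proof.
move=> [_ hd]; have /andP[a0 a1] := inv_card_01.
elim: i => [|i IH] d //=.
have /andP[b0 bk] := IH d; have /andP[c0 ck] := IH d.+1.
move: a0 a1 b0 bk c0 ck; set a := _^-1; set y := add_mean h i d.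
set z := add_mean h i d.+1; set w := add_mean h i d.+2 => a0 a1 b0 bk c0 ck.
have -> : (1 - a) * z + a * w - ((1 - a) * y + a * z) = (1 - a) * (z - y) + a * (w - z) by ring.
apply/andP; split; first by apply: addr_ge0; apply: mulr_ge0; rewrite // subr_ge0.
apply: (@le_trans _ _ ((1 - a) * k%:R + a * k%:R)); last by rewrite -mulrDl subrK mul1r.
by apply: lerD; rewrite ler_wpM2l ?subr_ge0.
Qed.

Lemma wsum_square_le h i (d : {ffun V -> nat}) (A : R) : slow k h ->
  wsum i (fun x : seq V => (\sum_u h (d u + count_mem u x)%N - A) ^+ 2) <=
  n%:R ^+ i * ((\sum_u add_mean h i (d u) - A) ^+ 2 + k%:R ^+ 2 * i%:R).
Proof.
move=> hs; have n0 : n%:R != 0 :> R by rewrite pnatr_eq0 -lt0n.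
elim: i d => [|i IH] d.
  rewrite /= mulr0 addr0 mul1r.
  by under eq_bigr => u _ do rewrite addn0.
rewrite wsumS; set P := \sum_u add_mean h i.+1 _ - A.
apply: (@le_trans _ _ (\sum_w n%:R ^+ i *
    ((\sum_u add_mean h i (inc w d u) - A) ^+ 2 + k%:R ^+ 2 * i%:R))).
  apply: ler_sum => w _; apply: le_trans (IH (inc w d)).
  apply: wsum_le => x _; rewrite le_eqVlt; apply/orP; left; apply/eqP.
  congr ((_ - _) ^+ 2); apply: eq_bigr => u _.
  by rewrite ffunE /= [w == u]eq_sym addnA.
pose D w := add_mean h i (d w).+1 - add_mean h i (d w).
have E w : \sum_u add_mean h i (inc w d u) - A = \sum_u add_mean h i (d u) - A + D w.
  rewrite (bigD1 w) //= [in RHS](bigD1 w) //= ffunE eqxx addn1 /D.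
  under eq_bigr => u uw do rewrite ffunE (negbTE uw) addn0.
  ring.
have W1 : \sum_(w : V) n%:R^-1 = 1 :> R by rewrite sumr_const -[LHS]mulr_natl divff.
have X' : \sum_u add_mean h i (d u) - A + \sum_(w : V) n%:R^-1 * D w =
    P.
  rewrite addrAC -big_split /=; congr (_ - _); apply: eq_bigr => u _.
  by rewrite /D /=; ring.
have key : \sum_w (\sum_u add_mean h i (inc w d u) - A) ^+ 2 <=
    n%:R * (P ^+ 2 + k%:R ^+ 2).
  rewrite -ler_pdivrMl ?ltr0n // -X' big_distrr /=.
  under eq_bigr => w _ do rewrite E.
  apply: weighted_square_le => [w| |w _] //; first by rewrite invr_ge0.
  by rewrite /D; have /andP[a0 ak] := add_mean_slow i hs (d w); rewrite ger0_norm.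
rewrite -big_distrr /= [n%:R ^+ i.+1]exprSr -[leRHS]mulrA; apply: ler_wpM2l; first by rewrite exprn_ge0.
rewrite big_split /= sumr_const -[X in _ + X]mulr_natl.
apply: le_trans (lerD key (lexx _)) _.
by rewrite -natr1 le_eqVlt; apply/orP; left; apply/eqP; ring.
Qed.

(** [A] is the mean of [heavy_total] over uniform words, so that no bias remains in [peel_bound].
    The factor 2 adds a variance [k ^ 2] per clone placed to the [k ^ 2] per removal. *)
Lemma peelable_wsum_le r' M1 m (A := n%:R * add_mean (heavy_mean R k r' M1 (r'.+1 * m)) (r'.+1 * (M1 + m)) 0) :
  (0 < k)%N -> (r'.+1 * M1)%:R < A ->
  wsum (M1 + m) (fun X : seq (r'.+1.-tuple V) => (peelable k (map val X))%:R) <=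
  n%:R ^+ (r'.+1 * (M1 + m)) * (2 * k%:R ^+ 2 * (r'.+1 * (M1 + m))%:R /
     (A - (r'.+1 * M1)%:R) ^+ 2).
Proof.
move=> k0 A0; set N := (r'.+1 * (M1 + m))%N.
pose D := undup [seq cnt (val t) | t <- enum {: N.-tuple V}].
have cntD (x : seq V) : size x = N -> cnt x \in D.
  move=> sx; rewrite mem_undup; apply/mapP; exists (Tuple (introT eqP sx)) => //.
  by rewrite mem_enum.
have DE (x : seq V) (F : {ffun V -> nat} -> R) : size x = N ->
    \sum_(d <- D) (cnt x == d)%:R * F d = F (cnt x).
  move=> /cntD xD; rewrite (bigD1_seq (cnt x)) ?undup_uniq //= eqxx mul1r.
  by rewrite big1 ?addr0 // => d /negbTE; rewrite eq_sym => ->; rewrite mul0r.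
have szflat (X : seq (r'.+1.-tuple V)) : size X = (M1 + m)%N -> size (flat X) = N.
  rewrite /flat size_flatten /shape -map_comp sumnE big_map => sX.
  rewrite (eq_bigr (fun=> r'.+1)) => [|t _]; last by rewrite /= size_tuple.
  by rewrite big_const_seq count_predT sX iter_addn_0 /N mulnC.
have -> : wsum (M1 + m) (fun X : seq (r'.+1.-tuple V) => (peelable k (map val X))%:R) =
    \sum_(d <- D) peel_count R k r' (M1 + m) 0 d.
  rewrite /peel_count /= -wsum_sum; apply: eq_wsum => X sX.
  rewrite -[LHS]mulr1 -[X in _ * X](DE (flat X) (fun=> 1) (szflat X sX)) big_distrr /=.
  by apply: eq_bigr => d _; case: (peelable _ _); rewrite ?mul0r ?mul1r ?mulr1.
apply: (@le_trans _ _ (\sum_(d <- D) multinom R d * peel_bound k r' M1 A (r'.+1 * m) d)).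
  rewrite !big_seq; apply: ler_sum => d; rewrite mem_undup => /mapP[t _ ->].
  by apply: peel_count_le; rewrite // total_cnt size_tuple.
have -> : \sum_(d <- D) multinom R d * peel_bound k r' M1 A (r'.+1 * m) d =
    wsum N (fun x : seq V => peel_bound k r' M1 A (r'.+1 * m) (cnt x)).
  transitivity (\sum_(d <- D) wsum N (fun x : seq V =>
      (cnt x == d)%:R * peel_bound k r' M1 A (r'.+1 * m) d)).
    rewrite !big_seq; apply: eq_bigr => d; rewrite mem_undup => /mapP[t _ ->].
    rewrite -(@wsum_cnt R V N) ?total_cnt ?size_tuple //.
    rewrite mulrC -wsumZ; apply: eq_wsum => x _; exact: mulrC.
  rewrite -wsum_sum; apply: eq_wsum => x sx.
  exact: (DE x (fun d => peel_bound k r' M1 A (r'.+1 * m) d)).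
have A1 : 0 < (A - (r'.+1 * M1)%:R) ^+ 2 by rewrite exprn_gt0 // subr_gt0.
rewrite /peel_bound; under eq_wsum => x _ do rewrite mulrC.
rewrite wsumZ wsumD wsum_const [leLHS]mulrC [leRHS]mulrA ler_pM2r ?invr_gt0 //.
have hs := heavy_mean_slow R r' M1 k0 (r'.+1 * m).
have := wsum_square_le N [ffun=> 0%N] A hs.
rewrite (eq_wsum (G := fun x : seq V => (heavy_total R k r' M1 (r'.+1 * m) (cnt x) - A) ^+ 2)); last first.
  move=> x _; congr ((_ - _) ^+ 2); apply: eq_bigr => u _.
  by rewrite !ffunE.
move=> H; apply: le_trans (lerD H (lexx _)) _.
have -> : \sum_(u : V) add_mean (heavy_mean R k r' M1 (r'.+1 * m)) N ([ffun=> 0%N] u) = A.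
  rewrite (eq_bigr (fun=> add_mean (heavy_mean R k r' M1 (r'.+1 * m)) N 0)); last first.
    by move=> u _; rewrite ffunE.
  by rewrite sumr_const -[LHS]mulr_natl.
rewrite subrr expr0n /= add0r -mulrDr ler_wpM2l ?exprn_ge0 //.
have mN : (r'.+1 * m)%:R <= N%:R :> R by rewrite ler_nat /N; nia.
have := sqr_ge0 (k%:R : R); nra.
Qed.

End WordPhase.

(** * Lower bounds on means by binomial moments *)

Section BinomialMoments.
Variables (R : realFieldType).
Implicit Types (h : nat -> R).

Definition bin_comb (L : seq (R * nat)) (d : nat) : R := \sum_(al <- L) al.1 * 'C(d, al.2)%:R.

Fixpoint draw_factor r' B l i : R :=
  if i is i'.+1 then
    if (r'.+1 %| i)%N then draw_factor r' B l i' else draw_factor r' B l i' * (1 - l%:R / (B + i)%:R)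
  else 1.

(** A given set of [l] clones is spared by one of [T] uniform draws with probability [1 - l / T].
    [draw_factor] is the product of these eigenvalues over the draws. *)
Lemma draw_bin T l d : (0 < T)%N -> (d <= T)%N ->
  draw T (fun d => 'C(d, l)%:R : R) d = (1 - l%:R / T%:R) * 'C(d, l)%:R.
Proof.
move=> T0 dT; have TT : 0 < T%:R :> R by rewrite ltr0n.
rewrite /draw; have -> : Num.min 1 (d%:R / T%:R) = d%:R / T%:R :> R.
  by apply/min_idPr; rewrite ler_pdivrMr // mul1r ler_nat.
case: d dT => [|d] dT /=; first by rewrite !mul0r subr0 mul1r addr0; case: l => [|l]; rewrite ?mul0r ?subr0 ?mul1r //= mulr0.
have : (d.+1%:R * 'C(d.+1, l)%:R - d.+1%:R * 'C(d, l)%:R = l%:R * 'C(d.+1, l)%:R :> R).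
  case: l => [|l]; first by rewrite !bin0 mul0r subrr.
  by rewrite -[RHS]natrM -mul_bin_diag natrM /= binS natrD; ring.
have T1 : T%:R != 0 :> R by rewrite gt_eqF.
move=> H.
have -> : (1 - d.+1%:R / T%:R) * 'C(d.+1, l)%:R + d.+1%:R / T%:R * 'C(d, l)%:R =
   'C(d.+1, l)%:R - (d.+1%:R * 'C(d.+1, l)%:R - d.+1%:R * 'C(d, l)%:R) / T%:R :> R by field.
by rewrite H; field.
Qed.

Lemma heavy_mean_ge k r' M1 L i :
  (forall d, bin_comb L d <= heavy R k d) ->
  forall d, (d <= r'.+1 * M1)%N ->
  \sum_(al <- L) al.1 * draw_factor r' (r'.+1 * M1) al.2 i * 'C(d, al.2)%:R <= heavy_mean R k r' M1 i d.
Proof.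
move=> Lh; elim: i => [|i IH] d dB /=.
  by apply: le_trans (Lh d); rewrite /bin_comb; under eq_bigr do rewrite mulr1.
case: ifP => [_|nr]; first exact: IH.
have T0 : (0 < r'.+1 * M1 + i.+1)%N by rewrite addnS.
have dT : (d <= r'.+1 * M1 + i.+1)%N by apply: leq_trans dB (leq_addr _ _).
have /andP[w0 w1] := draw_weight R (r'.+1 * M1 + i.+1) d.
have d1B : (d.-1 <= r'.+1 * M1)%N by apply: leq_trans dB; exact: leq_pred.
apply: le_trans (lerD (ler_wpM2l _ (IH d dB)) (ler_wpM2l w0 (IH _ d1B))); last by rewrite subr_ge0.
rewrite !big_distrr -big_split /= le_eqVlt; apply/orP; left; apply/eqP.
apply: eq_bigr => al _.
have := draw_bin al.2 T0 dT; rewrite /draw.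
move: (Num.min _ _) ('C(d, _)%:R) ('C(d.-1, _)%:R) => w c c' H.
have -> : al.1 * (draw_factor r' (r'.+1 * M1) al.2 i * (1 - al.2%:R / (r'.+1 * M1 + i.+1)%:R)) * c =
   al.1 * draw_factor r' (r'.+1 * M1) al.2 i * ((1 - al.2%:R / (r'.+1 * M1 + i.+1)%:R) * c) by ring.
by rewrite -H; ring.
Qed.

Lemma draw_factor_01 r' B l i : (l <= B)%N -> 0 <= draw_factor r' B l i <= 1.
Proof.
move=> lB; elim: i => [|i /andP[IH0 IH1]] /=; first by rewrite ler01 lexx.
case: ifP => _; first by rewrite IH0 IH1.
have T0 : 0 < (B + i.+1)%:R :> R by rewrite ltr0n addnS.
have f1 : l%:R / (B + i.+1)%:R <= 1 :> R.
  by rewrite ler_pdivrMr // mul1r ler_nat; lia.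
have f0 : 0 <= l%:R / (B + i.+1)%:R :> R by rewrite divr_ge0.
by rewrite mulr_ge0 ?subr_ge0 //= mulr_ile1 ?subr_ge0 // lerBlDr lerDl.
Qed.

Lemma mul_bin_le d l : (d * 'C(d, l) <= l.+1 * ('C(d, l.+1) + 'C(d, l)))%N.
Proof. by rewrite -binS -mul_bin_diag leq_mul2r leqnSn orbT. Qed.

(* Past [r M1] the polynomial bound may fail; the correction is harmless as its
   mean is of order [1 / M1]. *)
Lemma heavy_mean_ge_global k r' M1 L i d : (0 < k)%N -> (0 < M1)%N ->
  (forall d, bin_comb L d <= heavy R k d) ->
  (forall al, al \in L -> (al.2 <= r'.+1 * M1)%N) ->
  \sum_(al <- L) (al.1 * draw_factor r' (r'.+1 * M1) al.2 i * 'C(d, al.2)%:R -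
     (`|al.1| * al.2.+1%:R / (r'.+1 * M1)%:R * ('C(d, al.2.+1)%:R + 'C(d, al.2)%:R)))
   <= heavy_mean R k r' M1 i d.
Proof.
move=> k0 M10 Lh LB; set B := (r'.+1 * M1)%N.
have B0 : 0 < B%:R :> R by rewrite ltr0n muln_gt0.
have err0 (al : R * nat) :
    0 <= `|al.1| * al.2.+1%:R / B%:R * ('C(d, al.2.+1)%:R + 'C(d, al.2)%:R).
  by rewrite mulr_ge0 ?divr_ge0 ?mulr_ge0 ?addr_ge0 // ltW.
have [dB|Bd] := leqP d B.
  apply: le_trans (heavy_mean_ge _ Lh dB); apply: ler_sum => al _.
  by rewrite lerBlDr lerDl.
apply: (@le_trans _ _ 0); last first.
  have [h0 hd] := heavy_mean_slow R r' M1 k0 i.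
  elim: {Bd err0} d => [|e IH]; first by rewrite h0.
  by apply: le_trans IH _; have /andP[] := hd e; rewrite subr_ge0.
rewrite big_seq; apply: sumr_le0 => al alL; rewrite subr_le0.
have /andP[f0 f1] := draw_factor_01 r' i (LB al alL).
apply: (@le_trans _ _ (`|al.1| * 'C(d, al.2)%:R)).
  rewrite ler_wpM2r //; apply: le_trans (ler_norm _) _.
  by rewrite normrM (ger0_norm f0) ler_piMr.
set X := _ + 'C(d, al.2)%:R.
have H : B%:R * 'C(d, al.2)%:R <= al.2.+1%:R * X.
  apply: (@le_trans _ _ (d%:R * 'C(d, al.2)%:R)); first by rewrite ler_wpM2r // ler_nat ltnW.
  by rewrite /X -natrD -!natrM ler_nat mul_bin_le.
have -> : `|al.1| * al.2.+1%:R / B%:R * X = `|al.1| * (al.2.+1%:R * X / B%:R) by ring.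
by rewrite ler_wpM2l // ler_pdivlMr // mulrC.
Qed.

End BinomialMoments.

Section AddMean.
Variables (R : realFieldType) (V : finType).
Hypothesis V_gt0 : (0 < #|V|)%N.
Local Notation n := #|V|.
Implicit Types (h : nat -> R).

Lemma add_mean_le h h' i d : (forall d, h d <= h' d) -> add_mean V h i d <= add_mean V h' i d.
Proof.
move=> hh; have /andP[a0 a1] := inv_card_01 R V_gt0.
elim: i d => [|i IH] d //=.
by apply: lerD; rewrite ler_wpM2l ?subr_ge0.
Qed.

Lemma add_mean_sum (I : Type) (L : seq I) (F : I -> nat -> R) i d :
  add_mean V (fun d => \sum_(j <- L) F j d) i d = \sum_(j <- L) add_mean V (F j) i d.
Proof.
elim: i d => [|i IH] d //=.
by rewrite !IH !big_distrr -big_split.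
Qed.

Lemma add_mean_lin a b h h' i d :
  add_mean V (fun d => a * h d + b * h' d) i d = a * add_mean V h i d + b * add_mean V h' i d.
Proof. by elim: i d => [|i IH] d //=; rewrite !IH; ring. Qed.

(** Each set of [l] of the [i] new clones falls entirely on the given vertex with probability
    [n ^ (- l)]. *)
Lemma add_mean_bin l i : add_mean V (fun d => 'C(d, l)%:R : R) i 0 = 'C(i, l)%:R / n%:R ^+ l.
Proof.
have n0 : n%:R != 0 :> R by rewrite pnatr_eq0 -lt0n.
have pascal i' l' d : add_mean V (fun d => 'C(d, l'.+1)%:R : R) i' d.+1 =
    add_mean V (fun d => 'C(d, l'.+1)%:R) i' d + add_mean V (fun d => 'C(d, l')%:R) i' d.
  by elim: i' d => [|i' IH] d /=; [rewrite binS natrD|rewrite !IH; ring].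
have const i' d : add_mean V (fun d => 'C(d, 0)%:R : R) i' d = 1.
  elim: i' d => [|i' IH] d /=; first by rewrite bin0.
  by rewrite !IH; ring.
elim: i l => [|i IH] [|l]; rewrite ?const ?bin0 ?expr0 ?divr1 //=.
  by rewrite bin0n mul0r.
rewrite pascal !IH binS natrD exprS.
by field; rewrite n0 expf_neq0.
Qed.

End AddMean.

Section Bonferroni.
Variable R : realFieldType.

Lemma sum_sign_bin x L :
  \sum_(l < L.+1) (-1) ^+ l * 'C(x.+1, l)%:R = (-1) ^+ L * 'C(x, L)%:R :> R.
Proof.
elim: L => [|L IH]; first by rewrite big_ord1 !bin0.
by rewrite big_ord_recr /= IH binS natrD exprS; ring.
Qed.

Lemma mul_bin_split d j l : ('C(d, j) * 'C(d - j, l) = 'C(j + l, j) * 'C(d, j + l))%N.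
Proof.
have [jd|dj] := leqP (j + l) d; last first.
  rewrite (bin_small dj) muln0; apply/eqP; rewrite muln_eq0.
  by have [jd|jd] := ltnP d j; [rewrite (bin_small jd)|rewrite (@bin_small (d - j)) ?eqxx ?orbT //; lia].
have jd' : (j <= d)%N by lia.
have ld : (l <= d - j)%N by lia.
have H1 := bin_fact jd'; have H2 := bin_fact ld; have H3 := bin_fact jd.
have H4 := bin_fact (leq_addr l j); rewrite addKn in H4; rewrite subnDA in H3.
have P : (0 < j`! * (l`! * (d - j - l)`!))%N by rewrite !muln_gt0 !fact_gt0.
apply/eqP; rewrite -(eqn_pmul2r P); apply/eqP.
transitivity d`!; first by rewrite -H1 -H2; ring.
by rewrite -H3 -H4; ring.
Qed.

(* [d] on [k <= d] and [0] below, with each indicator [d = j] replaced by its Bonferroni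
   upper bound of order [2 s] in the binomials ['C(d, _)]. *)
Definition heavy_poly k s : seq (R * nat) :=
  (1, 1%N) :: [seq (- (j%:R * (-1) ^+ l * 'C(j + l, j)%:R), (j + l)%N) | j <- iota 0 k, l <- iota 0 s.*2.+1].

Lemma bin_comb_heavy_poly k s d : bin_comb (heavy_poly k s) d <= heavy R k d.
Proof.
rewrite /bin_comb /heavy_poly big_cons big_allpairs_dep /= mul1r bin1.
have step j : \sum_(l <- iota 0 s.*2.+1) - (j%:R * (-1) ^+ l * 'C(j + l, j)%:R) * 'C(d, j + l)%:R
   <= - (j%:R * (d == j)%:R) :> R.
  have -> : \sum_(l <- iota 0 s.*2.+1) - (j%:R * (-1) ^+ l * 'C(j + l, j)%:R) * 'C(d, j + l)%:R =
     - (j%:R * ('C(d, j)%:R * \sum_(l < s.*2.+1) (-1) ^+ l * 'C(d - j, l)%:R)) :> R.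
    rewrite -[iota 0 s.*2.+1]/(index_iota 0 s.*2.+1) big_mkord.
    rewrite !big_distrr /= -sumrN; apply: eq_bigr => l _.
    have : ('C(d, j)%:R * 'C(d - j, l)%:R = 'C(j + l, j)%:R * 'C(d, j + l)%:R :> R).
      by rewrite -!natrM mul_bin_split.
    move: ('C(d, j)%:R : R) ('C(d - j, l)%:R : R) => x y H.
    have -> : j%:R * (x * ((-1) ^+ l * y)) = j%:R * (-1) ^+ l * (x * y) :> R by ring.
    by rewrite H; ring.
  rewrite lerN2 ler_wpM2l //.
  have [dj|jd|<-] := ltngtP d j.
  - by rewrite bin_small // mul0r.
  (* The last index [s.*2] is even, so the truncated alternating sum is nonnegative: it bounds the
     indicator from above. *)
  - have -> : (d - j = (d - j).-1.+1)%N by rewrite prednK // subn_gt0.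
    by rewrite sum_sign_bin -signr_odd odd_double mul1r mulr_ge0.
  rewrite subnn binn mul1r big_ord_recl /= bin0 mulr1 big1 ?addr0 // => l _.
  by rewrite bin_small ?mulr0.
apply: (@le_trans _ _ (d%:R + \sum_(j <- iota 0 k) - (j%:R * (d == j)%:R))).
  by rewrite lerD2l; apply: ler_sum => j _; exact: step.
rewrite /heavy; case: leqP => kd.
  rewrite gerDl; apply: sumr_le0 => j _; by rewrite oppr_le0 mulr_ge0.
rewrite (bigD1_seq d) ?iota_uniq ?mem_iota //= eqxx mulr1 addrA subrr add0r.
by apply: sumr_le0 => j _; rewrite oppr_le0 mulr_ge0.
Qed.

End Bonferroni.

(** * From words to random edge sets *)

Section Transfer.
Variables (R : realFieldType).

Lemma wsum_exchange (S T : finType) m n (F : seq S -> seq T -> R) :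
  wsum m (fun x => wsum n (fun y => F x y)) = wsum n (fun y => wsum m (fun x => F x y)).
Proof.
elim: m F => [|m IH] F //=.
rewrite wsum_sum; apply: eq_bigr => a _; exact: IH.
Qed.

Lemma wsum_eq (T : finType) (s : seq T) : wsum (size s) (fun x => (x == s)%:R) = 1 :> R.
Proof.
elim: s => [|a s IH] //=.
rewrite (bigD1 a) //= big1 ?addr0 => [|b ba].
  by rewrite -[RHS]IH; apply: eq_wsum => x _; rewrite eqseq_cons eqxx.
rewrite -(wsum0 R T (size s)); apply: eq_wsum => x _.
by rewrite eqseq_cons (negbTE ba).
Qed.

Lemma wsum_uniq (T : finType) m (A : {set T}) :
  wsum m (fun x => (uniq x && all (mem A) x)%:R) = (#|A| ^_ m)%:R :> R.
Proof.
elim: m A => [|m IH] A //=.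
rewrite (bigID (mem A)) /= [X in _ + X]big1 ?addr0 => [|a /negbTE aA]; last first.
  by rewrite -(wsum0 R T m); apply: eq_wsum => x _; rewrite aA !andbF.
transitivity (\sum_(a in A) (#|A|.-1 ^_ m)%:R : R); last first.
  by rewrite sumr_const -[LHS]mulr_natl -natrM ffactnS.
apply: eq_bigr => a aA; have -> : #|A|.-1 = #|A :\ a| by rewrite (cardsD1 a A) aA.
rewrite -IH; apply: eq_wsum => x _; rewrite aA /= -andbA andbC -andbA; congr (_ && _)%:R.
elim: x => [|b x IHx] //=; rewrite in_cons negb_or !inE -IHx.
by rewrite [a == b]eq_sym; case: (b == a); case: (b \in A); case: (all _ x); case: (a \notin x).
Qed.

Variables (V : finType) (k r : nat).

Definition set_peelable (E : {set {set V}}) :=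
  [forall F : {set {set V}}, (F \subset E) && (F != set0) ==>
     [exists v, 0 < #|[set e in F | v \in e]| < k]%N].

Lemma set_peelableS (E F : {set {set V}}) : F \subset E -> set_peelable E -> set_peelable F.
Proof.
move=> FE /forallP H; apply/forallP => G; apply/implyP => /andP[GF G0].
by have := H G; rewrite G0 (subset_trans GF FE).
Qed.

Definition row_of (e : {set V}) (t : r.-tuple V) := uniq t && all (mem e) t.

Definition rowset (t : seq V) : {set V} := [set x in t].

Lemma row_of_rowset (e : {set V}) t : #|e| = r -> row_of e t -> e = rowset t.
Proof.
move=> er /andP[ut /allP te]; apply/esym/eqP; rewrite eqEcard; apply/andP; split.
  by apply/fintype.subsetP => x; rewrite inE => /te.
by rewrite er cardsE (card_uniqP ut) size_tuple.
Qed.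

Lemma all2_rows (f : seq {set V}) (X : seq (r.-tuple V)) :
  all (fun e : {set V} => #|e| == r) f -> all2 row_of f X ->
  f = map (rowset \o val) X /\ all (fun t : r.-tuple V => uniq t) X.
Proof.
elim: f X => [|e f IH] [|t X] //= /andP[/eqP er fr] /andP[et fX].
have [-> ->] := IH _ fr fX; rewrite -(row_of_rowset er et).
by case/andP: et => ->.
Qed.

(** As rows repeat no vertex and come from distinct edges, a sublist of rows has the same degrees as
    the family of their sets. *)
Lemma rows_peelable (f : seq {set V}) (X : seq (r.-tuple V)) :
  uniq f -> all (fun e : {set V} => #|e| == r) f -> all2 row_of f X ->
  set_peelable [set e in f] -> peelable k (map val X).
Proof.
move=> uf fr fX /forallP pf; have [fE uX] := all2_rows fr fX.
apply/peelableP => Y Z XYZ Y0.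
have XYZ' : perm_eq f (map rowset Y ++ map rowset Z).
  by rewrite fE map_comp -map_cat; exact: perm_map.
have uY : uniq (map rowset Y).
  by move: uf; rewrite (perm_uniq XYZ') cat_uniq => /and3P[].
have YX y : y \in Y -> uniq y.
  move=> yY; have : y \in map val X by rewrite (perm_mem XYZ) mem_cat yY.
  by case/mapP => t /(allP uX) ut ->.
pose F := [set e in map rowset Y].
have FE : F \subset [set e in f].
  by apply/fintype.subsetP => e; rewrite !inE (perm_mem XYZ') mem_cat => ->.
have F0 : F != set0.
  have [y yY] : exists y, y \in Y.
    by case: (Y) Y0 => [|y Y'] // _; exists y; rewrite mem_head.
  by apply/set0Pn; exists (rowset y); rewrite in_set; exact: map_f.
have := pf F; rewrite FE F0 => /existsP[v Fv]; exists v.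
rewrite /light_in; suff <- : #|[set e in F | v \in e]| = count_mem v (flatten Y) by [].
have -> : #|[set e in F | v \in e]| = count (fun e : {set V} => v \in e) (map rowset Y).
  rewrite -size_filter -(card_uniqP (filter_uniq _ uY)); apply: eq_card => e.
  by rewrite !inE mem_filter andbC.
rewrite count_map count_flatten sumnE big_map -sum1_count big_mkcond big_seq [RHS]big_seq.
apply: eq_bigr => y yY; rewrite (count_uniq_mem _ (YX y yY)) /= inE.
by case: (v \in y).
Qed.

Lemma wsum_rows (f : seq {set V}) : all (fun e : {set V} => #|e| == r) f ->
  wsum (size f) (fun X => (all2 row_of f X)%:R) = r`!%:R ^+ size f :> R.
Proof.
elim: f => [|e f IH] //= /andP[/eqP er fr].
rewrite exprS -(IH fr).
have -> : r`!%:R = \sum_(t : r.-tuple V) (row_of e t)%:R :> R.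
  rewrite (sum_tuple r (fun t : seq V => (uniq t && all (mem e) t)%:R)).
  by rewrite wsum_uniq er ffactnn.
rewrite big_distrl /=.
apply: eq_bigr => t _; rewrite -wsumZ; apply: eq_wsum => X _.
by rewrite /row_of -natrM mulnb.
Qed.

Definition peel_sets (D : {set {set V}}) m : {set {set {set V}}} :=
  [set E : {set {set V}} | [&& E \subset D, #|E| == m & set_peelable E]].

(** A family of [M] edges gives [M!] orders of its edges and [r!] rows for each edge. All these
    words are peelable, and a word determines its family. Words with loops or repeated edges make
    this an inequality. *)
Lemma card_peel_sets (D : {set {set V}}) M :
  (forall e : {set V}, e \in D -> #|e| = r) ->
  #|peel_sets D M|%:R * (M`!%:R * r`!%:R ^+ M) <=
  wsum M (fun X : seq (r.-tuple V) => (peelable k (map val X))%:R) :> R.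
Proof.
move=> Dr.
pose ok (f : seq {set V}) := [&& uniq f, all (fun e : {set V} => #|e| == r) f &
  set_peelable [set e in f]].
have H1 : #|peel_sets D M|%:R * M`!%:R <= wsum M (fun f => (ok f)%:R) :> R.
  rewrite mulr_natl -sumr_const.
  have -> : \sum_(E in peel_sets D M) M`!%:R =
     \sum_(E in peel_sets D M) wsum M (fun f => (uniq f && all (mem E) f)%:R) :> R.
    by apply: eq_bigr => E; rewrite inE => /and3P[_ /eqP <- _]; rewrite wsum_uniq ffactnn.
  rewrite -wsum_sum; apply: wsum_le => f sf.
  have key E : E \in peel_sets D M -> uniq f && all (mem E) f -> ok f /\ E = [set e in f].
    rewrite inE => /and3P[ED /eqP EM pE] /andP[uf /allP fE].
    have Ef : E = [set e in f].
      apply/esym/eqP; rewrite eqEcard; apply/andP; split.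
        by apply/fintype.subsetP => x; rewrite inE => /fE.
      by rewrite EM cardsE (card_uniqP uf) sf.
    split=> //; rewrite /ok uf -Ef pE andbT /=; apply/allP => e /fE /= eE.
    by apply/eqP/Dr/(fintype.subsetP ED).
  have [okf|nok] := boolP (ok f); last first.
    rewrite big1 // => E EP; case H: (_ && _) => //.
    by have [okf] := key E EP H; rewrite okf in nok.
  rewrite (bigID (pred1 [set e in f])) /= [X in _ + X]big1 ?addr0; last first.
    move=> E /andP[EP nE]; case H: (_ && _) => //.
    by have [_ EE] := key E EP H; rewrite EE eqxx in nE.
  rewrite (eq_bigl (fun E => (E == [set e in f]) && ([set e in f] \in peel_sets D M))); last first.
    by move=> E; case: eqP => [->|]; rewrite ?andbT ?andbF.
  case: (_ \in peel_sets D M); last by rewrite big_pred0 // => E; rewrite andbF.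
  rewrite (big_pred1 [set e in f]) => [|E]; last by rewrite andbT.
  by rewrite lern1 leq_b1.
rewrite mulrA; apply: le_trans (ler_wpM2r _ H1) _; first by rewrite exprn_ge0.
rewrite mulrC -wsumZ.
apply: (@le_trans _ _ (wsum M (fun f => wsum M (fun X => (ok f && all2 row_of f X)%:R)))).
  apply: wsum_le => f sf; have [okf|nok] := boolP (ok f); last first.
    by rewrite mulr0; apply: wsum_ge0.
  by rewrite mulr1 -sf -wsum_rows //; case/and3P: okf.
rewrite wsum_exchange; apply: wsum_le => X sX.
pose g := map (rowset \o val) X.
apply: (@le_trans _ _ (wsum M (fun f => (peelable k (map val X))%:R * (f == g)%:R))).
  apply: wsum_le => f sf; case H: (_ && _); last by rewrite mulr_ge0.
  case/andP: H => /and3P[uf fr pf] fX.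
  rewrite (rows_peelable uf fr fX pf) /g.
  by have [{1}-> _] := all2_rows fr fX; rewrite eqxx mulr1.
have sg : size g = M by rewrite size_map.
by rewrite wsumZ -{1}sg wsum_eq mulr1.
Qed.

Lemma card_peel_setsS (D : {set {set V}}) m :
  (m.+1 * #|peel_sets D m.+1| <= (#|D| - m) * #|peel_sets D m|)%N.
Proof.
have -> : (m.+1 * #|peel_sets D m.+1| = \sum_(E in peel_sets D m.+1) \sum_(x in E) 1)%N.
  rewrite mulnC -sum_nat_const; apply: eq_bigr => E; rewrite inE => /and3P[_ /eqP Em _].
  by rewrite sum1_card.
have -> : ((#|D| - m) * #|peel_sets D m| = \sum_(E in peel_sets D m) \sum_(x in D :\: E) 1)%N.
  rewrite mulnC -sum_nat_const; apply: eq_bigr => E; rewrite inE => /and3P[ED /eqP Em _].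
  by rewrite sum1_card cardsD (setIidPr ED) Em.
rewrite !pair_big_dep /= !sum1dep_card.
pose g (x : {set {set V}} * {set V}) := (x.1 :\ x.2, x.2).
rewrite -(@card_in_imset _ _ g).
  apply: subset_leq_card; apply/fintype.subsetP => _ /imsetP[[E x] + ->].
  rewrite inE /= inE => /andP[/and3P[ED /eqP Em pE] xE].
  rewrite inE /= in_setD in_setD1 eqxx (fintype.subsetP ED) // inE.
  rewrite (subset_trans (subD1set _ _) ED) (set_peelableS (subD1set _ _) pE) !andbT /=.
  by have := cardsD1 x E; rewrite xE Em add1n => -[<-].
move=> [E x] [F y]; rewrite !inE /= => /andP[_ xE] /andP[_ yF] [EF xy].
by rewrite -(setD1K xE) -(setD1K yF) EF xy.
Qed.

(* Peelable families are closed under subsets, so their proportion among the families of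
   [m] edges decreases with [m]. *)
Lemma peel_sets_ratio (D : {set {set V}}) M m : (M <= m <= #|D|)%N ->
  #|peel_sets D m|%:R <= #|peel_sets D M|%:R / 'C(#|D|, M)%:R * 'C(#|D|, m)%:R :> R.
Proof.
case/andP; elim: m => [|m IH].
  by rewrite leqn0 => /eqP -> _; rewrite bin0 divr1 mulr1.
rewrite leq_eqVlt => /orP[/eqP <- MD|Mm mD].
  by rewrite divfK // pnatr_eq0 -lt0n bin_gt0.
have H := IH Mm (ltnW mD); have S := card_peel_setsS D m.
have m0 : 0 < m.+1%:R :> R by [].
rewrite -(ler_pM2l m0) -natrM; apply: (le_trans (y := ((#|D| - m) * #|peel_sets D m|)%:R)).
  by rewrite ler_nat.
rewrite natrM; apply: le_trans (ler_wpM2l (ler0n _ _) H) _.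
rewrite le_eqVlt; apply/orP; left; apply/eqP.
have := mul_bin_left #|D| m => /(congr1 (fun x => x%:R : R)); rewrite !natrM => B.
by rewrite mulrCA -B; ring.
Qed.

End Transfer.

(** * From fixed size to independent edges *)

Section BernoulliSize.
Variables (R : realFieldType) (T : finType) (p : R).
Hypothesis p01 : 0 <= p <= 1.

Lemma eq_bernE_in (s : seq T) (f g : {set T} -> R) :
  (forall E : {set T}, E \subset [set x in s] -> f E = g E) -> bernE p s f = bernE p s g.
Proof.
by move=> fg; apply/eqP; rewrite eq_le; apply/andP; split;
  apply: bernE_le => // E Es; rewrite fg.
Qed.

Lemma bernE_card_square (s : seq T) (a : R) : uniq s ->
  bernE p s (fun E => (#|E|%:R - a) ^+ 2) =
  ((size s)%:R * p - a) ^+ 2 + (size s)%:R * p * (1 - p).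
Proof.
elim: s a => [|x s IH] a /=; first by rewrite cards0 !mul0r addr0.
case/andP=> xs us; rewrite IH //.
rewrite (@eq_bernE_in s _ (fun E => (#|E|%:R - (a - 1)) ^+ 2)); last first.
  move=> E Es; rewrite cardsU1; have -> : x \notin E.
    by apply: contra xs => /(fintype.subsetP Es); rewrite inE.
  by rewrite natrD /=; congr (_ ^+ 2); ring.
by rewrite IH // -natr1; ring.
Qed.

Lemma bernP_card_lt (s : seq T) (M : R) : uniq s -> M < (size s)%:R * p ->
  bernP p s (fun E => #|E|%:R < M) <= (size s)%:R * p / ((size s)%:R * p - M) ^+ 2.
Proof.
move=> us Ms; have /andP[p0 p1] := p01; set a := _ * p in Ms *.
have d0 : 0 < (a - M) ^+ 2 by rewrite exprn_gt0 // subr_gt0.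
rewrite ler_pdivlMr // mulrC /bernP -bernEZ.
apply: (@le_trans _ _ (bernE p s (fun E => (#|E|%:R - a) ^+ 2))).
  apply: bernE_le => // E _; have [EM|_] := boolP (#|E|%:R < M).
    rewrite mulr1; have : 0 <= #|E|%:R :> R by []; move: EM Ms; nra.
  by rewrite mulr0 sqr_ge0.
rewrite bernE_card_square // subrr expr0n /= add0r -/a.
have a0 : 0 <= a by rewrite mulr_ge0.
by rewrite ler_piMr // lerBlDr lerDl.
Qed.

End BernoulliSize.

Section BernoulliPeelable.
Variables (R : realFieldType) (V : finType) (p : R) (k : nat).
Hypothesis p01 : 0 <= p <= 1.

Lemma bern_weight (T : finType) (D E : {set T}) : E \subset D ->
  \prod_(x in D) (if x \in E then p else 1 - p) = p ^+ #|E| * (1 - p) ^+ (#|D| - #|E|).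
Proof.
move=> ED; rewrite (bigID (mem E)) /=; congr (_ * _).
  rewrite -prodr_const; apply: eq_big => x; last by move=> /andP[_ ->].
  by case: (boolP (x \in E)) => [/(fintype.subsetP ED) ->|]; rewrite ?andbF.
rewrite -[X in (X - _)%N](cardsID E D) (setIidPr ED) addKn -prodr_const.
apply: eq_big => x; first by rewrite inE andbC.
by move=> /andP[_ /negbTE ->].
Qed.

(** Given its size, [E] is uniform. If the size is at least [M], the proportion of peelable families
    is at most that at size [M], by [peel_sets_ratio]. *)
Lemma bernP_set_peelable (s : seq {set V}) M : uniq s ->
  bernP p s (set_peelable k) <= bernP p s (fun E => #|E|%:R < (M%:R : R)) +
    #|peel_sets k [set e in s] M|%:R / 'C(size s, M)%:R.
Proof.
move=> us; have /andP[p0 p1] := p01; set D := [set e in s].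
have sD : size s = #|D| by rewrite cardsE (card_uniqP us).
pose rho : R := #|peel_sets k D M|%:R / 'C(size s, M)%:R; rewrite -/rho.
have rho0 : 0 <= rho by rewrite divr_ge0.
apply: (@le_trans _ _ (bernP p s (fun E => #|E|%:R < (M%:R : R)) +
    bernP p s (fun E => (M <= #|E|)%N && set_peelable k E))).
  rewrite /bernP -bernED; apply: bernE_le => // E _.
  rewrite ltr_nat ltnNge; case: (leqP M #|E|) => _ /=; first by rewrite add0r.
  by rewrite addr0 lern1 leq_b1.
rewrite lerD2l.
have -> : bernP p s (fun E => (M <= #|E|)%N && set_peelable k E) =
   \sum_(m < #|D|.+1 | (M <= m)%N) (p ^+ m * (1 - p) ^+ (#|D| - m)) * #|peel_sets k D m|%:R.
  rewrite /bernP bernE_setE // -/D.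
  rewrite (partition_big (fun E : {set {set V}} => inord #|E| : 'I_#|D|.+1) xpredT) //= big_mkcond /=.
  rewrite [RHS]big_mkcond /=; apply: eq_bigr => m _.
  have cE (E : {set {set V}}) : E \subset D -> (inord #|E| == m) = (#|E| == m :> nat).
    by move=> ED; rewrite -val_eqE /= inordK // ltnS subset_leq_card.
  case: ifP => Mm; last first.
    rewrite big1 // => E /andP[ED]; rewrite cE // => /eqP ->.
    by rewrite Mm mulr0.
  have -> : #|peel_sets k D m|%:R = \sum_(E in peel_sets k D m) 1 :> R by rewrite sumr_const.
  rewrite big_distrr /= [LHS]big_mkcond [RHS]big_mkcond /=.
  apply: eq_bigr => E _; rewrite inE; case: (boolP (E \subset D)) => //= ED.
  rewrite cE //; case: eqP => //= Em; rewrite bern_weight // Em Mm /=.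
  by case: (set_peelable k E); rewrite ?mulr1 ?mulr0.
apply: (@le_trans _ _ (\sum_(m < #|D|.+1 | (M <= m)%N)
    rho * ((p ^+ m * (1 - p) ^+ (#|D| - m)) * 'C(#|D|, m)%:R))).
  apply: ler_sum => m Mm; rewrite mulrCA ler_wpM2l ?mulr_ge0 ?exprn_ge0 ?subr_ge0 //.
  by rewrite /rho sD; apply: peel_sets_ratio; rewrite Mm -ltnS ltn_ord.
rewrite -big_distrr /= -[leRHS]mulr1 ler_wpM2l //.
apply: (@le_trans _ _ (\sum_(m < #|D|.+1) 'C(#|D|, m)%:R * (p ^+ m * (1 - p) ^+ (#|D| - m)))).
  rewrite big_mkcond /=; apply: ler_sum => m _; case: ifP => _; first by rewrite mulrC.
  by rewrite mulr_ge0 ?mulr_ge0 ?exprn_ge0 ?subr_ge0.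
have := exprDn (1 - p) p #|D|; rewrite subrK expr1n => E; rewrite [leRHS]E.
by apply: ler_sum => m _; rewrite -[leRHS]mulr_natl [p ^+ _ * _]mulrC.
Qed.

End BernoulliPeelable.

(** * Density evolution below the threshold *)

Require Import Defs.
From mathcomp Require Import all_classical all_reals all_analysis.

Import numFieldNormedType.Exports.

Local Open Scope classical_set_scope.
Local Open Scope ring_scope.

Section PoissonTail.
Variable R : realType.
Implicit Types (l u x : R) (m : nat).

Definition exp_sum m l : R := \sum_(j < m) l ^+ j / j`!%:R.

Definition poisson_tail m l : R := 1 - expR (- l) * exp_sum m l.

Lemma exp_sumE m l : exp_sum m l = series (exp_coeff l) m.
Proof. by rewrite /exp_sum /series /= big_mkord. Qed.

Lemma cvg_exp_sum l : exp_sum m l @[m --> \oo] --> expR l.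
Proof.
rewrite (_ : (fun m => exp_sum m l) = series (exp_coeff l)).
  exact: is_cvg_series_exp_coeff.
by apply/funext => m; exact: exp_sumE.
Qed.

Lemma exp_sumS m l : exp_sum m.+1 l = exp_sum m l + l ^+ m / m`!%:R.
Proof. by rewrite /exp_sum big_ord_recr. Qed.

Lemma exp_term_ge0 m l : 0 <= l -> 0 <= l ^+ m / m`!%:R.
Proof. by move=> l0; rewrite divr_ge0 ?exprn_ge0. Qed.

Lemma exp_sum_ge0 m l : 0 <= l -> 0 <= exp_sum m l.
Proof. by move=> l0; apply: sumr_ge0 => i _; exact: exp_term_ge0. Qed.

Lemma exp_sum_mono l : 0 <= l -> {homo exp_sum^~ l : m m' / (m <= m')%N >-> m <= m'}.
Proof.
move=> l0; apply: homo_leq => [x|x y z|m]; [exact: lexx|exact: le_trans|].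
by rewrite exp_sumS lerDl exp_term_ge0.
Qed.

Lemma exp_sum_le m l : 0 <= l -> exp_sum m l <= expR l.
Proof.
move=> l0; have -> : expR l = limn (exp_sum^~ l) by apply/esym/cvg_lim => //; exact: cvg_exp_sum.
apply: (nondecreasing_cvgn_le (u_ := exp_sum^~ l)).
  by move=> a b ab; exact: exp_sum_mono.
by apply/cvg_ex; exists (expR l); exact: cvg_exp_sum.
Qed.

Lemma poisson_tail_ge0 m l : 0 <= l -> 0 <= poisson_tail m l.
Proof.
move=> l0; rewrite /poisson_tail subr_ge0 expRN mulrC ler_pdivrMr ?expR_gt0 // mul1r.
exact: exp_sum_le.
Qed.

Lemma poisson_tail_le1 m l : 0 <= l -> poisson_tail m l <= 1.
Proof. by move=> l0; rewrite gerBl mulr_ge0 ?expR_ge0 ?exp_sum_ge0. Qed.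

Lemma poisson_tail0 l : poisson_tail 0 l = 1.
Proof. by rewrite /poisson_tail /exp_sum big_ord0 mulr0 subr0. Qed.

Lemma poisson_tailS m l : 0 < l -> poisson_tail m.+1 l < poisson_tail m l.
Proof.
move=> l0; rewrite /poisson_tail ltrD2l ltrN2 ltr_pM2l ?expR_gt0 // exp_sumS ltrDl.
by rewrite divr_gt0 ?exprn_gt0 // ltr0n fact_gt0.
Qed.

Lemma exp_sumD m l u :
  exp_sum m (l + u) = \sum_(i < m) u ^+ i / i`!%:R * exp_sum (m - i) l.
Proof.
elim: m => [|m IH]; first by rewrite /exp_sum !big_ord0.
rewrite exp_sumS IH big_ord_recr /= subSnn.
have -> : exp_sum 1 l = 1 by rewrite /exp_sum big_ord1 expr0 fact0 divr1.
rewrite mulr1.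
have -> : \sum_(i < m) u ^+ i / i`!%:R * exp_sum (m.+1 - i) l =
    \sum_(i < m) u ^+ i / i`!%:R * exp_sum (m - i) l +
    \sum_(i < m) u ^+ i / i`!%:R * (l ^+ (m - i) / (m - i)`!%:R).
  rewrite -big_split /=; apply: eq_bigr => i _.
  by rewrite subSn ?(ltnW (ltn_ord i)) // exp_sumS mulrDr.
rewrite -addrA; congr (_ + _).
rewrite exprDn big_ord_recr /= subnn expr0 mul1r binn mulr1n mulrDl; congr (_ + _).
rewrite mulr_suml; apply: eq_bigr => i _; rewrite -mulr_natr.
have im : (i <= m)%N by exact: ltnW.
have F j : j`!%:R != 0 :> R by rewrite pnatr_eq0 -lt0n fact_gt0.
have := bin_fact im => /(congr1 (fun j : nat => j%:R : R)); rewrite !natrM => <-.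
have C0 : 'C(m, i)%:R != 0 :> R by rewrite pnatr_eq0 -lt0n bin_gt0.
by move: (F i) (F (m - i)%N) => Fi Fmi; field; rewrite C0 Fi Fmi.
Qed.

(* A Poisson variable of mean [l + u] is the sum of independent ones of means [l] and [u];
   the second one is bounded below by the indicator that it is positive. *)
Lemma poisson_tailD m l u : 0 <= l -> 0 <= u ->
  expR (- u) * poisson_tail m.+1 l + (1 - expR (- u)) * poisson_tail m l
    <= poisson_tail m.+1 (l + u).
Proof.
move=> l0 u0.
have key : exp_sum m.+1 (l + u) <= exp_sum m.+1 l + (expR u - 1) * exp_sum m l.
  rewrite exp_sumD big_ord_recl /= subn0 expr0 fact0 divr1 mul1r lerD2l.
  apply: (@le_trans _ _ (\sum_(i < m) u ^+ i.+1 / i.+1`!%:R * exp_sum m l)).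
    apply: ler_sum => i _; rewrite ler_wpM2l ?exp_term_ge0 //.
    by apply: exp_sum_mono => //; rewrite /bump /= add1n subSS leq_subr.
  rewrite -mulr_suml ler_wpM2r ?exp_sum_ge0 // lerBrDl.
  apply: le_trans (exp_sum_le m.+1 u0).
  by rewrite /exp_sum big_ord_recl expr0 fact0 divr1.
rewrite /poisson_tail opprD expRD.
have eu : expR (- u) * expR u = 1 by rewrite mulrC expRxMexpNx_1.
have L0 : 0 <= expR (- l) * expR (- u) by rewrite mulr_ge0 ?expR_ge0.
have := ler_wpM2l L0 key.
have -> : expR (- l) * expR (- u) * (exp_sum m.+1 l + (expR u - 1) * exp_sum m l) =
  expR (- l) * (expR (- u) * exp_sum m.+1 l + (expR (- u) * expR u - expR (- u)) * exp_sum m l) by ring.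
rewrite eu => H; nra.
Qed.

Lemma poisson_tail_lt m l u : 0 < l -> 0 < u -> poisson_tail m.+1 l < poisson_tail m.+1 (l + u).
Proof.
move=> l0 u0; apply: lt_le_trans (poisson_tailD m (ltW l0) (ltW u0)).
have e1 : expR (- u) < 1 by rewrite expR_lt1 oppr_lt0.
have := poisson_tailS m l0; move: (expR _) e1 => e; nra.
Qed.

Lemma poisson_tail_le m l l' : 0 <= l -> l <= l' -> poisson_tail m l <= poisson_tail m l'.
Proof.
move=> l0 ll'; case: m => [|m]; first by rewrite !poisson_tail0.
have u0 : 0 <= l' - l by rewrite subr_ge0.
have := poisson_tailD m l0 u0; rewrite subrKC; apply: le_trans.
have e1 : expR (- (l' - l)) <= 1 by rewrite expR_le1 oppr_le0.
have H : poisson_tail m.+1 l <= poisson_tail m l.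
  rewrite /poisson_tail lerD2l lerN2 ler_wpM2l ?expR_ge0 // exp_sumS lerDl exp_term_ge0 //.
move: (expR _) e1 => e; nra.
Qed.

(** A Poisson variable of mean [u] is positive with probability at least [a], so it dominates one
    trial; [N] independent ones add up to mean [N u]. *)
Lemma binom_tail_poisson m N (a u : R) : 0 <= a <= 1 -> 0 <= u -> expR (- u) <= 1 - a ->
  binom_tail m N a <= poisson_tail m (N%:R * u).
Proof.
move=> a01 u0 au; have /andP[a0 a1] := a01.
elim: N m => [|N IH] [|m] /=; rewrite ?poisson_tail0 //.
  by rewrite mul0r poisson_tail_ge0.
have -> : N.+1%:R * u = N%:R * u + u by rewrite -natr1 mulrDl mul1r.
apply: le_trans (poisson_tailD m _ u0); last by rewrite mulr_ge0.
have e0 : 0 <= expR (- u) by rewrite expR_ge0.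
have := IH m.+1; have := IH m; have := binom_tailS m N a01.
move: (expR _) e0 au => e e0 au; nra.
Qed.

Lemma continuous_exp_sum m : continuous (exp_sum m).
Proof.
elim: m => [|m IH] x.
  rewrite (_ : exp_sum 0 = fun=> 0); first exact: cvg_cst.
  by apply/funext => y; rewrite /exp_sum big_ord0.
rewrite (_ : exp_sum m.+1 = fun y => exp_sum m y + y ^+ m / m`!%:R); last first.
  by apply/funext => y; rewrite exp_sumS.
apply: cvgD; first exact: IH.
by apply: cvgMr_tmp; exact: exprn_continuous.
Qed.

Lemma continuous_poisson_tail m : continuous (poisson_tail m).
Proof.
move=> x; apply: cvgB; first exact: cvg_cst.
apply: cvgM; last exact: continuous_exp_sum.
apply: (@continuous_comp _ _ _ (fun x : R => - x) expR); last exact: continuous_expR.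
exact: opp_continuous.
Qed.

End PoissonTail.

Section Glue.
Variable R : realType.

Lemma hgraph_probE (n r : nat) (p : R) (A : pred (hypergraph 'I_n)) :
  hgraph_prob r p A =
  bernP p (enum (rsubsets n r)) (fun E => A (Hypergraph [set: 'I_n]%SET E)).
Proof.
rewrite /bernP bernE_setE ?enum_uniq // set_enum /hgraph_prob.
rewrite [RHS]big_mkcond [LHS]big_mkcond /=; apply: eq_bigr => E _.
case: (E \subset _) => //=; case: (A _) => /=; by rewrite ?mulr1 ?mulr0.
Qed.

Lemma card_rsubsets n r : #|rsubsets n r| = 'C(n, r).
Proof. by have := card_draws 'I_n r; rewrite card_ord /rsubsets. Qed.

Lemma mem_rsubsets n r (e : {set 'I_n}) : (e \in enum (rsubsets n r)) = (#|e| == r).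
Proof. by rewrite mem_enum inE. Qed.

Section Survivors.
Variables (n k : nat) (E : {set {set 'I_n}}).
Let H := Hypergraph [set: 'I_n]%SET E.

Definition survivors t := vertices (after_rounds k H t).

Lemma edges_after_rounds t e :
  e \in edges (after_rounds k H t) -> e \in E /\ e \subset survivors t.
Proof.
elim: t => [|t IH] /=; first by move=> eE; split=> //; exact: finset.subsetT.
rewrite inE => /andP[/IH[eE es] d]; split=> //.
by rewrite /survivors /= finset.subsetD es d.
Qed.

Lemma survivors_degree t v : v \in survivors t.+1 ->
  (k <= #|[set e in E | (v \in e) && (e \subset survivors t)]%SET|)%N.
Proof.
rewrite /survivors /= !inE => /andP[vl vV]; rewrite vV /= -leqNgt in vl.
apply: leq_trans vl _; apply: subset_leq_card; apply/fintype.subsetP => e.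
rewrite !inE => /andP[/edges_after_rounds[-> es] ->]; exact: es.
Qed.

Lemma rounds_gt_survivor T : (T < rounds k H)%N -> exists v, v \in survivors T.
Proof.
rewrite /rounds; case: ex_minnP => m _ mmin Tm.
have [/eqP L0|/set0Pn[v vL]] := boolP (light k (after_rounds k H T) == finset.set0).
  by have := mmin T; rewrite L0 eqxx => /(_ isT); rewrite leqNgt Tm.
by exists v; move: vL; rewrite inE => /andP[].
Qed.

(** A nonempty family without light vertex is never touched by peeling, and the vertices that it
    covers stay in the core. *)
Lemma empty_core_peelable : (forall e, e \in E -> e != finset.set0) ->
  empty_core k H -> set_peelable k E.
Proof.
move=> E0 /eqP core0; apply: contraT => /forallPn[F].
rewrite negb_imply => /andP[/andP[FE F0] /existsPn nolight].
have deg v : v \in finset.cover F -> (k <= #|[set e in F | v \in e]%SET|)%N.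
  case/bigcupP => e eF ve; have := nolight v.
  rewrite negb_and -leqNgt -leqNgt leqn0 => /orP[|//].
  rewrite cards_eq0 => /eqP F00.
  suff : e \in finset.set0 by rewrite inE.
  by rewrite -F00 inE eF.
have inv t : finset.cover F \subset survivors t /\ F \subset edges (after_rounds k H t).
  elim: t => [|t [IHv IHe]]; first by split; [exact: finset.subsetT|].
  have nl v : v \in finset.cover F -> v \notin light k (after_rounds k H t).
    move=> vF; rewrite inE negb_and -leqNgt; apply/orP; right.
    apply: leq_trans (deg v vF) _; apply: subset_leq_card; apply/fintype.subsetP => e.
    by rewrite !inE => /andP[/(fintype.subsetP IHe) -> ->].
  split; apply/fintype.subsetP.
    move=> v vF; rewrite /survivors /= finset.in_setD nl //=.
    exact: (fintype.subsetP IHv).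
  move=> e eF; rewrite inE (fintype.subsetP IHe) //=.
  apply: contraT => /disjointPn[v ve vl].
  have vF : v \in finset.cover F by apply/bigcupP; exists e.
  by have := nl v vF; rewrite vl.
have /set0Pn[e eF] := F0; have /set0Pn[v ve] := E0 e (fintype.subsetP FE _ eF).
have vF : v \in finset.cover F by apply/bigcupP; exists e.
have := fintype.subsetP (inv (rounds k H)).1 v vF.
by rewrite /survivors -/(core k H) core0 inE.
Qed.

End Survivors.

End Glue.

Section SequenceLimits.
Variable R : realType.
Implicit Types (a b : R).

Lemma cvg_natV : (n%:R^-1 : R) @[n --> \oo] --> (0 : R).
Proof.
rewrite -(cvg_shiftS (fun n => n%:R^-1 : R)).
exact: cvg_harmonic.
Qed.

Lemma cvg_seq_sum (I : Type) (L : seq I) (u : I -> nat -> R) (l : I -> R) :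
  (forall i, u i n @[n --> \oo] --> l i) ->
  \sum_(i <- L) u i n @[n --> \oo] --> \sum_(i <- L) l i.
Proof.
move=> ul; elim: L => [|i L IH].
  rewrite big_nil (_ : (fun n => _) = fun=> 0); first exact: cvg_cst.
  by apply/funext => n; rewrite big_nil.
rewrite big_cons (_ : (fun n => _) = fun n => u i n + \sum_(j <- L) u j n).
  exact: cvgD.
by apply/funext => n; rewrite big_cons.
Qed.

Lemma cvg_expn (u : nat -> R) a m : u n @[n --> \oo] --> a -> u n ^+ m @[n --> \oo] --> a ^+ m.
Proof.
move=> ua; elim: m => [|m IH].
  rewrite expr0 (_ : (fun n => _) = fun=> 1); first exact: cvg_cst.
  by apply/funext => n; rewrite expr0.
rewrite exprS (_ : (fun n => _) = fun n => u n * u n ^+ m); first exact: cvgM.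
by apply/funext => n; rewrite exprS.
Qed.

(** From the factorisation of [a ^ (m + 1) - u ^ (m + 1)], whose cofactor is at least [a ^ m]. *)
Lemma cvg_root (u : nat -> R) a m : (\forall n \near \oo, 0 <= u n) -> 0 < a ->
  u n ^+ m.+1 @[n --> \oo] --> a ^+ m.+1 -> u n @[n --> \oo] --> a.
Proof.
move=> u0 a0 /cvgrPdist_lt H; apply/cvgrPdist_lt => e e0.
have am : 0 < a ^+ m by rewrite exprn_gt0.
near=> n.
have Hn : `|a ^+ m.+1 - u n ^+ m.+1| < e * a ^+ m.
  by near: n; apply: H; rewrite mulr_gt0.
rewrite -(ltr_pM2r am); apply: le_lt_trans Hn.
have un0 : 0 <= u n by near: n.
rewrite subrXX normrM ler_wpM2l //.
rewrite ger0_norm; last by apply: sumr_ge0 => i _; rewrite mulr_ge0 ?exprn_ge0 // ltW.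
rewrite big_ord_recl /= subn0 expr0 mulr1 lerDl; apply: sumr_ge0 => i _.
by rewrite mulr_ge0 ?exprn_ge0 // ltW.
Unshelve. all: by end_near. Qed.

Lemma cvg_truncn a : 0 <= a -> (Num.truncn (a * n%:R))%:R / n%:R @[n --> \oo] --> a.
Proof.
move=> a0; apply: (@squeeze_cvgr _ _ _ _ (fun n => a - n%:R^-1) (fun=> a)).
- near=> n; have n0 : 0 < n%:R :> R by rewrite ltr0n; near: n; exact: nbhs_infty_gt.
  have an : 0 <= a * n%:R by rewrite mulr_ge0 // ltW.
  have /andP[h1 h2] := truncn_itv an.
  rewrite ler_pdivrMr // h1 andbT ler_pdivlMr // mulrBl mulVf ?gt_eqF //.
  by rewrite lerBlDr natr1 ltW.
- rewrite -[X in _ --> X]subr0; apply: cvgB; [exact: cvg_cst|exact: cvg_natV].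
- exact: cvg_cst.
Unshelve. all: by end_near. Qed.

Lemma cvg_ffact (u : nat -> nat) a l : (u n)%:R / n%:R @[n --> \oo] --> a ->
  ((u n) ^_ l)%:R / n%:R ^+ l @[n --> \oo] --> a ^+ l.
Proof.
move=> ua.
have sub j : (u n - j)%:R / n%:R @[n --> \oo] --> a.
  apply: (@squeeze_cvgr _ _ _ _ (fun n => (u n)%:R / n%:R - j%:R * n%:R^-1) (fun n => (u n)%:R / n%:R)) => //.
    near=> n; rewrite -mulrBl !ler_wpM2r ?invr_ge0 // ?ler_nat ?leq_subr //.
    by rewrite lerBlDr -natrD ler_nat -leq_subLR; lia.
  rewrite -[X in _ --> X]subr0; apply: cvgB => //.
  by rewrite -(mulr0 j%:R); apply: cvgMl_tmp; exact: cvg_natV.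
elim: l => [|l IH].
  rewrite expr0 (_ : (fun n => _) = fun=> 1); first exact: cvg_cst.
  by apply/funext => n; rewrite expr0 ffactn0 divr1.
rewrite exprSr (_ : (fun n => _) = fun n => ((u n) ^_ l)%:R / n%:R ^+ l * ((u n - l)%:R / n%:R)).
  exact: cvgM.
by apply/funext => n; rewrite ffactnSr natrM exprSr invfM; ring.
Unshelve. all: by end_near. Qed.

Lemma cvg_bin (u : nat -> nat) a l : (u n)%:R / n%:R @[n --> \oo] --> a ->
  'C(u n, l)%:R / n%:R ^+ l @[n --> \oo] --> a ^+ l / l`!%:R.
Proof.
move=> ua; rewrite (_ : (fun n => _) = fun n => ((u n) ^_ l)%:R / n%:R ^+ l * l`!%:R^-1).
  by apply: cvgMr_tmp; exact: cvg_ffact.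
apply/funext => n; rewrite -bin_ffact natrM.
have : l`!%:R != 0 :> R by rewrite pnatr_eq0 -lt0n fact_gt0.
by move=> l0; rewrite mulrAC mulfK.
Qed.

End SequenceLimits.

Section DrawFactor.
Variables (R : realType) (r' : nat).
Local Notation r := r'.+1.

Let f (l T : nat) : R := 1 - l%:R / T%:R.

Lemma draw_factor_block B l q t : (t <= r')%N ->
  draw_factor R r' B l (r * q + t) =
  draw_factor R r' B l (r * q) * \prod_(j < t) f l (B + r * q + j.+1).
Proof.
elim: t => [|t IH] tr; first by rewrite addn0 big_ord0 mulr1.
rewrite addnS /= big_ord_recr /= mulrA -IH ?(ltnW tr) // ifF; last first.
  by rewrite -addnS dvdn_addr ?dvdn_mulr // gtnNdvd.
by rewrite /f !addnS !addnA.
Qed.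

Lemma draw_factor_next B l q :
  draw_factor R r' B l (r * q.+1) =
  draw_factor R r' B l (r * q) * \prod_(j < r') f l (B + r * q + j.+1).
Proof.
rewrite -draw_factor_block // mulnSr addnS /= ifT //.
by rewrite -addnS -mulnSr dvdn_mulr.
Qed.

(* The draws of each block skip one clone out of [r]; as the factors vary slowly,
   the product over the drawn positions is nearly the [r'/r]-th power of the full
   telescoping product. *)
Lemma draw_factor_pow B l m : (l <= B)%N -> (0 < B)%N ->
  (f l B) ^+ r' * ((B ^_ l)%:R / ((B + r * m) ^_ l)%:R) ^+ r' <= draw_factor R r' B l (r * m) ^+ r
  <= ((B ^_ l)%:R / ((B + r * m) ^_ l)%:R) ^+ r'.
Proof.
move=> lB B0.
have f01 T : (B <= T)%N -> 0 <= f l T <= 1.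
  move=> BT; have T0 : 0 < T%:R :> R by rewrite ltr0n; apply: leq_trans BT.
  have h1 : l%:R / T%:R <= 1 :> R by rewrite ler_pdivrMr // mul1r ler_nat (leq_trans lB).
  have h0 : 0 <= l%:R / T%:R :> R by rewrite divr_ge0.
  by rewrite subr_ge0 h1 gerBl h0.
have fmono T T' : (B <= T)%N -> (T <= T')%N -> f l T <= f l T'.
  move=> BT TT'; have T0 : 0 < T%:R :> R by rewrite ltr0n; apply: leq_trans BT.
  rewrite lerD2l lerN2 ler_wpM2l // lef_pV2 ?posrE ?ler_nat //.
  by apply: lt_le_trans T0 _; rewrite ler_nat.
(* [s] collects the skipped positions, at the end of each block, and [w] the positions one block
   earlier; [c] lies between their powers as [f l] is nondecreasing. With [c * s] telescoping,
   [c ^ r] is compared with [(c * s) ^ r']. *)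
pose s q := \prod_(j < q) f l (B + r * j.+1).
pose w q := \prod_(j < q) f l (B + r * j).
pose c q := draw_factor R r' B l (r * q).
have s0 q : 0 <= s q by apply: prodr_ge0 => j _; have /andP[] := f01 _ (leq_addr (r * j.+1) B).
have w0 q : 0 <= w q by apply: prodr_ge0 => j _; have /andP[] := f01 _ (leq_addr (r * j) B).
have ws q : f l B * s q <= w q.
  have -> : f l B * s q = w q.+1 by rewrite /w big_ord_recl /= muln0 addn0.
  rewrite /w big_ord_recr /= ler_piMr //; first exact: w0.
  by have /andP[] := f01 _ (leq_addr (r * q) B).
have c01 q : 0 <= c q <= 1 by apply: draw_factor_01.
have bounds q : w q ^+ r' <= c q <= s q ^+ r'.
  elim: q => [|q /andP[IH1 IH2]]; first by rewrite /w /s !big_ord0 !expr1n /c muln0 /= lexx.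
  rewrite /w /s !big_ord_recr /= -/(w q) -/(s q) !exprMn /c draw_factor_next -/(c q).
  have prodX (z : R) : z ^+ r' = \prod_(j < r') z by rewrite prodr_const card_ord.
  have BT j : (B <= B + r * q + j)%N by rewrite -addnA leq_addr.
  rewrite [f l (B + r * q) ^+ _]prodX [f l (B + r * q.+1) ^+ _]prodX.
  have P0 : 0 <= \prod_(j < r') f l (B + r * q + j.+1).
    by apply: prodr_ge0 => j _; have /andP[] := f01 _ (BT j.+1).
  apply/andP; split; apply: ler_pM => //; rewrite ?exprn_ge0 //.
  - by apply: prodr_ge0 => j _; have /andP[] := f01 _ (leq_addr (r * q) B).
  - apply: ler_prod => j _; have /andP[-> _] /= := f01 _ (leq_addr (r * q) B).
    by apply: fmono; rewrite ?leq_addr.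
  - by have /andP[] := c01 q.
  - apply: ler_prod => j _; have /andP[-> _] /= := f01 _ (BT j.+1).
    by apply: fmono => //; rewrite -addnA leq_add2l mulnSr leq_add2l ltnS; exact: ltnW.
have full q : c q * s q = (B ^_ l)%:R / ((B + r * q) ^_ l)%:R.
  have ff i : (\prod_(j < i) f l (B + j.+1)) * ((B + i) ^_ l)%:R = (B ^_ l)%:R.
    elim: i => [|i IH]; first by rewrite big_ord0 mul1r addn0.
    rewrite big_ord_recr /= -IH -mulrA; congr (_ * _); rewrite /f.
    have T0 : (B + i.+1)%:R != 0 :> R by rewrite pnatr_eq0 addnS.
    have : ((B + i.+1) * (B + i) ^_ l = (B + i.+1) ^_ l * (B + i.+1 - l))%N.
      by rewrite -ffactnSr ffactnS addnS.
    move=> /(congr1 (fun j : nat => j%:R : R)); rewrite !natrM natrB; last by lia.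
    move: ((B + i.+1)%:R : R) T0 (((B + i) ^_ l)%:R : R) => t t0 X H.
    by apply: (mulfI t0); rewrite H; field.
  have -> : c q * s q = \prod_(j < r * q) f l (B + j.+1).
    elim: q => [|q IH]; first by rewrite /c /s muln0 !big_ord0 /= mulr1.
    rewrite /c draw_factor_next -/(c q) /s big_ord_recr /= -/(s q).
    rewrite mulrACA IH mulnSr [RHS]big_split_ord /=; congr (_ * _).
    rewrite big_ord_recr /=; congr (_ * _); last by rewrite -addnS.
    by apply: eq_bigr => j _; rewrite -addnS addnA.
  have d0 : ((B + r * q) ^_ l)%:R != 0 :> R by rewrite pnatr_eq0 -lt0n ffact_gt0; lia.
  by apply: (mulIf d0); rewrite divfK // ff.
rewrite -full -/(c m); have /andP[b1 b2] := bounds m; have /andP[c0 c1] := c01 m.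
have /andP[fB0 fB1] := f01 _ (leqnn B).
rewrite exprS exprMn; apply/andP; split.
  rewrite mulrCA [leRHS]mulrC ler_wpM2l ?exprn_ge0 // -exprMn; apply: le_trans b1.
  by apply: lerXn2r; rewrite ?nnegrE ?mulr_ge0.
by rewrite mulrC ler_wpM2l ?exprn_ge0.
Qed.

End DrawFactor.

(** * The surplus of heavy clones *)

Section CoreLowerBound.
Variables (R : realType) (k r' : nat) (al x : R).
Local Notation r := r'.+1.
Hypothesis k_gt1 : (1 < k)%N.
Hypothesis al_gt0 : 0 < al.
Hypothesis x_gt0 : 0 < x.
Hypothesis x_le1 : x <= 1.

Definition rows n := Num.truncn (al * n%:R).
Definition last_rows n := Num.truncn (al * x ^+ r * n%:R).

Lemma last_rows_le n : (last_rows n <= rows n)%N.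
Proof.
apply: le_truncn; rewrite ler_wpM2r // ler_piMr ?exprn_ile1 //; exact: ltW.
Qed.

Let be : R := r%:R * (al * x ^+ r).
(** The limiting mean degree: a vertex starts with mean [r * al], and each clone escapes the draws
    with probability tending to [x ^ r']. The number of clones left is about [be * n], with
    [be = mu * x]. *)
Let mu : R := r%:R * al * x ^+ r'.

Let be_gt0 : 0 < be. Proof. by rewrite !mulr_gt0 ?exprn_gt0. Qed.

Lemma cvg_rows : (r * rows n)%:R / n%:R @[n --> \oo] --> r%:R * al.
Proof.
rewrite (_ : (fun n => _) = fun n => r%:R * ((rows n)%:R / n%:R)).
  by apply: cvgMl_tmp; apply: cvg_truncn; exact: ltW.
by apply/funext => n; rewrite natrM mulrA.
Qed.

Lemma cvg_last_rows : (r * last_rows n)%:R / n%:R @[n --> \oo] --> be.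
Proof.
rewrite (_ : (fun n => _) = fun n => r%:R * ((last_rows n)%:R / n%:R)).
  by apply: cvgMl_tmp; apply: cvg_truncn; rewrite mulr_ge0 ?exprn_ge0 // ltW.
by apply/funext => n; rewrite natrM mulrA.
Qed.

Lemma cvg_last_rowsV : ((r * last_rows n)%:R^-1 : R) @[n --> \oo] --> (0 : R).
Proof.
have H : ((r * last_rows n)%:R / n%:R : R)^-1 * n%:R^-1 @[n --> \oo] --> be^-1 * 0.
  by apply: cvgM; [apply: cvgV; [rewrite gt_eqF|exact: cvg_last_rows]|exact: cvg_natV].
rewrite mulr0 in H; apply: cvg_trans H; apply: near_eq_cvg; near=> n.
have n0 : n%:R != 0 :> R by rewrite pnatr_eq0 -lt0n; near: n; exact: nbhs_infty_gt.
by rewrite invfM invrK -mulrA divff // mulr1.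
Unshelve. all: by end_near. Qed.

Lemma last_rows_ge l : \forall n \near \oo, (l <= r * last_rows n)%N.
Proof.
have H : l.+1%:R * ((r * last_rows n)%:R^-1 : R) @[n --> \oo] --> l.+1%:R * (0 : R).
  by apply: cvgMl_tmp; exact: cvg_last_rowsV.
have B : \forall n \near \oo, 0 < (r * last_rows n)%:R / n%:R :> R.
  exact: (cvgr_gt _ cvg_last_rows).
rewrite mulr0 in H; near=> n.
have Bn : 0 < (r * last_rows n)%:R :> R.
  have : 0 < (r * last_rows n)%:R / n%:R :> R by near: n.
  by case: (posnP (r * last_rows n)%N) => [->|]; rewrite ?mul0r ?ltxx // ltr0n.
have : l.+1%:R * (r * last_rows n)%:R^-1 < 1 :> R by near: n; apply: (cvgr_lt _ H).
by rewrite ltr_pdivrMr // mul1r ltr_nat => /ltnW/ltnW.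
Unshelve. all: by end_near. Qed.

Let steps n := (rows n - last_rows n)%N.

Let rowsE n : (r * last_rows n + r * steps n = r * rows n)%N.
Proof. by rewrite -mulnDr subnKC // last_rows_le. Qed.

(** [draw_factor_pow] controls only the [r]-th power, through the ratio of falling factorials, which
    tends to [x ^ (r l)]; hence the detour by [cvg_root]. *)
Lemma cvg_draw_factor l :
  draw_factor R r' (r * last_rows n) l (r * steps n) @[n --> \oo] --> (x ^+ l) ^+ r'.
Proof.
apply: (@cvg_root _ _ _ r').
- near=> n; have ln : (l <= r * last_rows n)%N by near: n; exact: last_rows_ge.
  by have /andP[] := draw_factor_01 R r' (r * steps n) ln.
- by rewrite !exprn_gt0.
have ratio : ((r * last_rows n) ^_ l)%:R / ((r * rows n) ^_ l)%:R @[n --> \oo] --> (x ^+ r) ^+ l.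
  have -> : (x ^+ r) ^+ l = be ^+ l / (r%:R * al) ^+ l.
    rewrite -expr_div_n; congr (_ ^+ _); rewrite /be mulrA mulrC mulKf //.
    by rewrite mulf_neq0 ?pnatr_eq0 // gt_eqF.
  have H : ((r * last_rows n) ^_ l)%:R / n%:R ^+ l * (((r * rows n) ^_ l)%:R / n%:R ^+ l)^-1
      @[n --> \oo] --> be ^+ l / (r%:R * al) ^+ l.
    apply: cvgM; first exact/cvg_ffact/cvg_last_rows.
    apply: cvgV; last exact/cvg_ffact/cvg_rows.
    by rewrite expf_neq0 // mulf_neq0 ?pnatr_eq0 // gt_eqF.
  apply: cvg_trans H; apply: near_eq_cvg; near=> n.
  have n0 : n%:R ^+ l != 0 :> R.
    by rewrite expf_neq0 // pnatr_eq0 -lt0n; near: n; exact: nbhs_infty_gt.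
  by rewrite invfM invrK [X in _ * X]mulrC mulrA divfK.
have ratioX := cvg_expn (m := r') ratio.
have fcvg : (1 - l%:R / (r * last_rows n)%:R) ^+ r' @[n --> \oo] --> (1 : R).
  rewrite -[X in _ --> X](expr1n _ r'); apply: cvg_expn.
  rewrite -[X in _ --> X]subr0; apply: cvgB; first exact: cvg_cst.
  by rewrite -(mulr0 l%:R); apply: cvgMl_tmp; exact: cvg_last_rowsV.
have E : ((x ^+ l) ^+ r') ^+ r = ((x ^+ r) ^+ l) ^+ r'.
  by rewrite -!exprM [(l * _)%N]mulnA [(l * r' * r)%N]mulnC.
rewrite E; apply: (squeeze_cvgr _ (f := fun n => (1 - l%:R / (r * last_rows n)%:R) ^+ r' *
   (((r * last_rows n) ^_ l)%:R / ((r * rows n) ^_ l)%:R) ^+ r')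
   (h := fun n => (((r * last_rows n) ^_ l)%:R / ((r * rows n) ^_ l)%:R) ^+ r')) => //.
  near=> n; have ln : (l.+1 <= r * last_rows n)%N by near: n; exact: last_rows_ge.
  have := @draw_factor_pow R r' (r * last_rows n) l (steps n) (ltnW ln) (leq_ltn_trans (leq0n l) ln).
  by rewrite rowsE.
rewrite -[X in _ --> X]mul1r; exact: cvgM.
Unshelve. all: by end_near. Qed.

Let moment l n : R := 'C(r * rows n, l)%:R / n%:R ^+ l.

Let heavy_term (c : R * nat) n : R :=
  c.1 * draw_factor R r' (r * last_rows n) c.2 (r * steps n) * moment c.2 n -
  `|c.1| * c.2.+1%:R / (r * last_rows n)%:R * (moment c.2.+1 n + moment c.2 n).

Lemma add_mean_heavy_ge s : \forall n \near \oo,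
  \sum_(c <- heavy_poly R k s) heavy_term c n <=
  add_mean 'I_n (heavy_mean R k r' (last_rows n) (r * steps n)) (r * rows n) 0.
Proof.
pose lmax := (\max_(c <- heavy_poly R k s) c.2)%N.
near=> n.
have n0 : (0 < #|'I_n|)%N by rewrite card_ord; near: n; exact: nbhs_infty_gt.
have lB : (lmax.+1 <= r * last_rows n)%N by near: n; exact: last_rows_ge.
have M10 : (0 < last_rows n)%N.
  by move: lB; case: (last_rows n) => //; rewrite muln0.
have LB c : c \in heavy_poly R k s -> (c.2 <= r * last_rows n)%N.
  by move=> cL; apply: leq_trans (ltnW lB); rewrite /lmax (big_rem c) //= leq_maxl.
have Lh d : bin_comb (heavy_poly R k s) d <= heavy R k d by exact: bin_comb_heavy_poly.
pose g d : R := \sum_(c <- heavy_poly R k s) (c.1 * draw_factor R r' (r * last_rows n) c.2 (r * steps n) * 'C(d, c.2)%:R +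
  - (`|c.1| * c.2.+1%:R / (r * last_rows n)%:R) * (1 * 'C(d, c.2.+1)%:R + 1 * 'C(d, c.2)%:R)).
apply: (@le_trans _ _ (add_mean 'I_n g (r * rows n) 0)); last first.
  apply: add_mean_le => // d.
  apply: le_trans (heavy_mean_ge_global _ d (ltnW k_gt1) M10 Lh LB).
  by rewrite /g; apply: ler_sum => c _; rewrite !mul1r mulNr.
rewrite add_mean_sum le_eqVlt; apply/orP; left; apply/eqP; apply: eq_bigr => c _.
rewrite add_mean_lin (add_mean_lin _ 1 1) !add_mean_bin // card_ord !mul1r mulNr.
by [].
Unshelve. all: by end_near. Qed.

Let limit s : R := \sum_(c <- heavy_poly R k s) c.1 * (mu ^+ c.2 / c.2`!%:R).

Lemma cvg_heavy_terms s :
  \sum_(c <- heavy_poly R k s) heavy_term c n @[n --> \oo] --> limit s.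
Proof.
have mcvg l : moment l n @[n --> \oo] --> (r%:R * al) ^+ l / l`!%:R.
  by apply: cvg_bin; exact: cvg_rows.
apply: cvg_seq_sum => c.
have -> : c.1 * (mu ^+ c.2 / c.2`!%:R) =
   c.1 * (x ^+ c.2) ^+ r' * ((r%:R * al) ^+ c.2 / c.2`!%:R) -
   `|c.1| * c.2.+1%:R * 0 * ((r%:R * al) ^+ c.2.+1 / c.2.+1`!%:R + (r%:R * al) ^+ c.2 / c.2`!%:R).
  by rewrite mulr0 mul0r subr0 /mu exprMn -!exprM mulnC; ring.
apply: cvgB; apply: cvgM => //.
- by apply: cvgMl_tmp; exact: cvg_draw_factor.
- by apply: cvgMl_tmp; exact: cvg_last_rowsV.
- exact: cvgD.
Qed.

(** The limit is the mean of a Poisson variable of mean [mu] restricted to values at least [k]; the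
    identity [j * mu ^ j / j! = mu * mu ^ (j - 1) / (j - 1)!] shifts the tail to [k.-1]. *)
Lemma cvg_limit : limit s @[s --> \oo] --> mu * poisson_tail k.-1 mu.
Proof.
have mu0 : 0 <= mu by rewrite !mulr_ge0 ?exprn_ge0 // ltW.
have limitE s : limit s = mu - \sum_(j <- iota 0 k) j%:R * (mu ^+ j / j`!%:R) * exp_sum s.*2.+1 (- mu).
  rewrite /limit /heavy_poly big_cons big_allpairs_dep [X in X + _]/= mul1r expr1 (_ : 1`! = 1%N) // divr1; congr (_ + _).
  rewrite -sumrN; apply: eq_bigr => j _.
  rewrite -[iota 0 s.*2.+1]/(index_iota 0 s.*2.+1) big_mkord /exp_sum big_distrr /= -sumrN.
  apply: eq_bigr => l _.
  have F i : i`!%:R != 0 :> R by rewrite pnatr_eq0 -lt0n fact_gt0.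
  have := bin_fact (leq_addr l j); rewrite addKn => /(congr1 (fun i : nat => i%:R : R)).
  rewrite !natrM => <-.
  have C0 : 'C(j + l, j)%:R != 0 :> R by rewrite pnatr_eq0 -lt0n bin_gt0 leq_addr.
  rewrite (exprNn mu) exprD /=; move: (F j) (F l) C0.
  move: (j`!%:R : R) (l`!%:R : R) ('C(j + l, j)%:R : R) => fj fl cjl Fj Fl C0.
  move: ((-1 : R) ^+ l) (mu ^+ j) (mu ^+ l) => sg mj ml.
  by field; rewrite C0 Fj Fl.
have -> : mu * poisson_tail k.-1 mu =
    mu - \sum_(j <- iota 0 k) j%:R * (mu ^+ j / j`!%:R) * expR (- mu).
  rewrite /poisson_tail mulrBr mulr1; congr (_ - _).
  rewrite -mulr_suml [RHS]mulrC mulrCA; congr (_ * _).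
  have -> : iota 0 k = index_iota 0 k by rewrite /index_iota subn0.
  rewrite big_mkord -(prednK (ltnW k_gt1)) big_ord_recl /= mul0r add0r.
  rewrite /exp_sum big_distrr /=; apply: eq_bigr => j _.
  rewrite /bump /= add1n factS natrM exprS.
  have F : j`!%:R != 0 :> R by rewrite pnatr_eq0 -lt0n fact_gt0.
  have J : j.+1%:R != 0 :> R by rewrite pnatr_eq0.
  by move: (j.+1%:R : R) J => y J; field; rewrite F J.
rewrite (_ : (fun s => limit s) = fun s => mu - \sum_(j <- iota 0 k) j%:R * (mu ^+ j / j`!%:R) * exp_sum s.*2.+1 (- mu)); last first.
  by apply/funext => s; exact: limitE.
apply: cvgB; first exact: cvg_cst.
apply: cvg_seq_sum => j; apply: cvgMl_tmp.
apply: (@cvg_comp _ _ _ (fun s => s.*2.+1) (fun m => exp_sum m (- mu)) \oo \oo).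
  apply/cvgnyPge => N; near=> s; rewrite -addnn.
  have : (N <= s)%N by near: s; exact: nbhs_infty_ge.
  lia.
exact: cvg_exp_sum.
Unshelve. all: by end_near. Qed.

Lemma heavy_surplus : x < poisson_tail k.-1 mu ->
  exists2 e : R, 0 < e & \forall n \near \oo,
    (r * last_rows n)%:R + e * n%:R <=
    n%:R * add_mean 'I_n (heavy_mean R k r' (last_rows n) (r * (rows n - last_rows n))) (r * rows n) 0.
Proof.
move=> xmu; have mu0 : 0 < mu by rewrite !mulr_gt0 ?exprn_gt0.
have bmu : be = mu * x by rewrite /be /mu exprSr; ring.
have gap : be < mu * poisson_tail k.-1 mu by rewrite bmu ltr_pM2l.
have [s hs] : exists s, be < limit s.
  have [N _ HN] := cvgr_gt _ cvg_limit be gap.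
  by exists N; apply: HN => /=.
(* One third of the gap is lost in the count of remaining clones, one third in the convergence of
   the means, and one third is the surplus. *)
pose e := (limit s - be) / 3.
have e0 : 0 < e by rewrite divr_gt0 // subr_gt0.
have lim_e : limit s - e < limit s by rewrite gtrBl.
exists e => //; near=> n.
have n0 : 0 < n%:R :> R by rewrite ltr0n; near: n; exact: nbhs_infty_gt.
have h1 : (r * last_rows n)%:R / n%:R < be + e.
  by near: n; apply: (cvgr_lt _ cvg_last_rows); rewrite ltrDl.
have h2 : limit s - e < \sum_(c <- heavy_poly R k s) heavy_term c n.
  by near: n; exact: (cvgr_gt _ (@cvg_heavy_terms s) _ lim_e).
have h3 : \sum_(c <- heavy_poly R k s) heavy_term c n <=
  add_mean 'I_n (heavy_mean R k r' (last_rows n) (r * steps n)) (r * rows n) 0.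
  by near: n; exact: add_mean_heavy_ge.
rewrite ltr_pdivrMr // in h1.
set a := add_mean _ _ _ _ in h3 *.
have h4 : be + e + e <= a.
  apply: le_trans h3; apply: le_trans (ltW h2); rewrite /e; lra.
have : (be + e + e) * n%:R <= a * n%:R by rewrite ler_wpM2r // ltW.
rewrite [n%:R * a]mulrC; apply: le_trans; rewrite [leRHS]mulrDl lerD2r; exact: ltW.
Unshelve. all: by end_near. Qed.

End CoreLowerBound.

(** * Comparison with the threshold *)

Section Threshold.
Variable R : realType.

Lemma bernoulli_ineq (y : R) m : 0 <= y <= 1 -> 1 - m%:R * y <= (1 - y) ^+ m.
Proof.
move=> /andP[y0 y1]; elim: m => [|m IH]; first by rewrite mul0r subr0 expr0.
rewrite exprS; apply: le_trans (ler_wpM2l _ IH); last by rewrite subr_ge0.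
rewrite -natr1; have : 0 <= m%:R * y ^+ 2 by rewrite mulr_ge0 ?sqr_ge0.
nra.
Qed.

Lemma expR_ge_inv (y : R) : 0 <= y <= 1 / 2 -> 1 <= (1 - y) * expR (2 * y).
Proof.
move=> /andP[y0 y1]; apply: (@le_trans _ _ ((1 - y) * (1 + 2 * y))); first by nra.
by rewrite ler_wpM2l ?expR_ge1Dx // subr_ge0; lra.
Qed.

Lemma expn_le_ffact N M : ((N - M) ^ M <= N ^_ M)%N.
Proof.
have [MN|NM] := leqP M N; last first.
  by have -> : (N - M = 0)%N by [lia]; rewrite exp0n //; lia.
rewrite ffact_prod -[X in (_ ^ X)%N]card_ord -prod_nat_const.
by apply: leq_prod => i _; have := ltn_ord i; lia.
Qed.

(** Words of [M] distinct edges without repeated vertices are at least a fraction [exp (- 2 K y)] of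
    all words: each of the [M <= y n] rows loses at most a proportion [K / n], where [r ^ 2]
    accounts for repeated vertices and [r! y] for repeated edges. *)
Lemma peel_sets_ratio_le (n k r' M : nat) (y C K : R) (N := 'C(n, r'.+1)) :
  0 <= C -> 0 <= K -> (0 < n)%N -> (0 < r')%N -> M%:R <= y * n%:R -> 0 <= y ->
  (r'.+1%:R ^+ 2 + r'.+1`!%:R * y) / n%:R <= K / n%:R -> K / n%:R <= 1 / 2 ->
  #|peel_sets k (rsubsets n r'.+1) M|%:R * (M`!%:R * r'.+1`!%:R ^+ M) <= n%:R ^+ (r'.+1 * M) * C ->
  #|peel_sets k (rsubsets n r'.+1) M|%:R / 'C(N, M)%:R <= expR (2 * K * y) * C.
Proof.
move=> C0 K0 n0 r0 My y0 Kn K2; set a : R := #|peel_sets _ _ _|%:R => H.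
have nR : 0 < n%:R :> R by rewrite ltr0n.
have n1 : 1 <= n%:R :> R by rewrite ler1n.
have F0 : 0 < r'.+1`!%:R :> R by rewrite ltr0n fact_gt0.
have fact_ge1 : 1 <= r'.+1`!%:R :> R by rewrite ler1n fact_gt0.
have rn : r'.+1%:R / n%:R <= 1 :> R.
  have : r'.+1%:R ^+ 2 / n%:R <= 1 / 2 :> R.
    apply: le_trans K2; apply: le_trans Kn; apply: ler_wpM2r; first by rewrite invr_ge0 ltW.
    by rewrite lerDl mulr_ge0 // ltW.
  have : r'.+1%:R / n%:R <= r'.+1%:R ^+ 2 / n%:R :> R.
    apply: ler_wpM2r; first by rewrite invr_ge0 ltW.
    by rewrite ler_eXnr // ler1n.
  lra.
have NM : n%:R ^+ r'.+1 * (1 - K / n%:R) <= r'.+1`!%:R * (N - M)%:R.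
  have NN : n%:R ^+ r'.+1 * (1 - r'.+1%:R ^+ 2 / n%:R) <= r'.+1`!%:R * N%:R :> R.
    rewrite -natrM mulnC bin_ffact; apply: (@le_trans _ _ ((n - r'.+1) ^ r'.+1)%:R); last first.
      by rewrite ler_nat expn_le_ffact.
    have rn' : (r'.+1 <= n)%N by move: rn; rewrite ler_pdivrMr // mul1r ler_nat.
    rewrite natrX natrB //.
    have -> : n%:R - r'.+1%:R = n%:R * (1 - r'.+1%:R / n%:R) :> R.
      by rewrite mulrBr mulr1 mulrC divfK // gt_eqF.
    rewrite exprMn; apply: ler_wpM2l; first by rewrite exprn_ge0 // ltW.
    have rn01 : 0 <= (r'.+1%:R / n%:R : R) <= 1 by rewrite rn andbT divr_ge0 // ltW.
    by apply: le_trans (@bernoulli_ineq _ r'.+1 rn01); rewrite expr2 mulrA.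
  have MM : r'.+1`!%:R * M%:R <= n%:R ^+ r'.+1 * (r'.+1`!%:R * y / n%:R).
    apply: (@le_trans _ _ (r'.+1`!%:R * (y * n%:R))); first by rewrite ler_wpM2l // ltW.
    have -> : n%:R ^+ r'.+1 * (r'.+1`!%:R * y / n%:R) = r'.+1`!%:R * (y * n%:R ^+ r').
      by rewrite exprSr; field; rewrite gt_eqF.
    rewrite ler_wpM2l ?(ltW F0) // ler_wpM2l // ler_eXnr //.
  apply: (@le_trans _ _ (r'.+1`!%:R * N%:R - r'.+1`!%:R * M%:R)); last first.
    rewrite -mulrBr; apply: ler_wpM2l; first exact: ltW.
    by rewrite lerBlDr -natrD ler_nat addnC -leq_subLR.
  apply: le_trans (lerB NN MM).
  rewrite -mulrBr; apply: ler_wpM2l; first by rewrite exprn_ge0 // ltW.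
  move: Kn; rewrite mulrDl => Kn; lra.
have c0 : 0 < 1 - K / n%:R by lra.
have e0 : 0 < expR (2 * (K / n%:R)) by exact: expR_gt0.
have base : n%:R ^+ r'.+1 <= expR (2 * (K / n%:R)) * (r'.+1`!%:R * (N - M)%:R).
  have E := expR_ge_inv (_ : 0 <= K / n%:R <= 1 / 2).
  apply: (@le_trans _ _ (expR (2 * (K / n%:R)) * (n%:R ^+ r'.+1 * (1 - K / n%:R)))).
    rewrite mulrCA -[leLHS]mulr1; apply: ler_wpM2l; first by rewrite exprn_ge0 // ltW.
    by rewrite mulrC; apply: E; rewrite K2 andbT divr_ge0 // ltW.
  by rewrite ler_wpM2l // ltW.
have NMpos : (0 < N - M)%N.
  rewrite lt0n; apply/eqP => N0; move: NM; rewrite N0 mulr0.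
  by rewrite leNgt mulr_gt0 // exprn_gt0.
have CM : 0 < 'C(N, M)%:R :> R by rewrite ltr0n bin_gt0 ltnW // -subn_gt0.
rewrite ler_pdivrMr //.
have D0 : 0 < M`!%:R * r'.+1`!%:R ^+ M :> R.
  by rewrite mulr_gt0 ?exprn_gt0 // ltr0n fact_gt0.
rewrite -(ler_pM2r D0); apply: le_trans H _.
rewrite -[leRHS]mulrA.
have -> : expR (2 * K * y) * C * ('C(N, M)%:R * (M`!%:R * r'.+1`!%:R ^+ M)) =
   expR (2 * K * y) * ('C(N, M)%:R * M`!%:R * r'.+1`!%:R ^+ M) * C by ring.
rewrite ler_wpM2r // -natrM bin_ffact exprM.
apply: (@le_trans _ _ ((expR (2 * (K / n%:R)) * (r'.+1`!%:R * (N - M)%:R)) ^+ M)).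
  by apply: lerXn2r => //; rewrite nnegrE ?exprn_ge0 // ?mulr_ge0 ?expR_ge0 // ltW.
rewrite exprMn -expRM_natl; apply: ler_pM; rewrite ?expR_ge0 ?exprn_ge0 ?mulr_ge0 //.
  rewrite ler_expR; have -> : M%:R * (2 * (K / n%:R)) = 2 * K * (M%:R / n%:R) by ring.
  rewrite ler_wpM2l ?mulr_ge0 // ler_pdivrMr //.
rewrite exprMn mulrC ler_wpM2r ?exprn_ge0 // ?(ltW F0) // -natrX ler_nat.
exact: expn_le_ffact.
Qed.

Variables (k r' : nat).
Local Notation r := r'.+1.
Hypothesis k_gt1 : (1 < k)%N.
Hypothesis r'_gt0 : (0 < r')%N.

Lemma cvg_edge_count (c : R) :
  'C(n, r)%:R * (c / n%:R ^+ r') / n%:R @[n --> \oo] --> c / r`!%:R.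
Proof.
have H : 'C(n, r)%:R / n%:R ^+ r @[n --> \oo] --> (1 ^+ r / r`!%:R : R).
  apply: (cvg_bin (u := id)); apply: (@cvg_trans _ ((fun=> 1 : R) @ \oo)); last exact: cvg_cst.
  apply: near_eq_cvg; near=> n; rewrite divff // pnatr_eq0 -lt0n; near: n.
  exact: nbhs_infty_gt.
rewrite expr1n mul1r in H.
rewrite (_ : (fun n => _) = fun n => c * ('C(n, r)%:R / n%:R ^+ r)).
  exact: cvgMl_tmp.
by apply/funext => n; rewrite exprSr invfM; ring.
Unshelve. all: by end_near. Qed.

(** The number of edges is about [n * c / r!], so [al < c / r!] leaves room for [al n] of them.
    Having fewer has probability at most [B1 / n], and a uniform family of that size is peelable
    with probability at most [B2 / n]; 1/4 for each is enough to contradict a.a.s. emptiness. *)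
Lemma core_nonempty_above (al c x : R) : 0 < al -> al < c / r`!%:R -> 0 < x -> x <= 1 ->
  x < poisson_tail k.-1 (r%:R * al * x ^+ r') ->
  \forall n \near \oo, hgraph_prob r (c / n%:R ^+ r') (@empty_core 'I_n k) <= (1 / 2 : R).
Proof.
move=> al0 alc x0 x1 /(heavy_surplus k_gt1 al0 x0 x1)[e e0 surplus].
have r0 : 0 < r`!%:R :> R by rewrite ltr0n fact_gt0.
have c0 : 0 < c.
  by have := lt_trans al0 alc; rewrite pmulr_lgt0 // invr_gt0.
pose N n := 'C(n, r); pose p n : R := c / n%:R ^+ r'.
pose M := rows al.
pose K : R := r%:R ^+ 2 + r`!%:R * al.
have K0 : 0 < K by rewrite addr_gt0 ?exprn_gt0 ?mulr_gt0.
pose g := c / r`!%:R - al.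
have g0 : 0 < g by rewrite subr_gt0.
have Np_hi : \forall n \near \oo, (N n)%:R * p n / n%:R < c / r`!%:R + 1.
  by apply: (cvgr_lt _ (@cvg_edge_count c)); rewrite ltrDl.
have Np_lo : \forall n \near \oo, c / r`!%:R - g / 2 < (N n)%:R * p n / n%:R.
  by apply: (cvgr_gt _ (@cvg_edge_count c)); rewrite gtrBl divr_gt0.
have small (b : R) : \forall n \near \oo, b / n%:R < 1 / 4.
  have H : b * n%:R^-1 @[n --> \oo] --> b * 0 by apply: cvgMl_tmp; exact: cvg_natV.
  by rewrite mulr0 in H; apply: (cvgr_lt _ H); rewrite divr_gt0.
pose B1 : R := (c / r`!%:R + 1) / (g / 2) ^+ 2.
pose B2 : R := expR (2 * K * al) * (2 * k%:R ^+ 2 * (r%:R * al) / e ^+ 2).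
near=> n.
have n0 : (0 < n)%N by near: n; exact: nbhs_infty_gt.
have nR : 0 < n%:R :> R by rewrite ltr0n.
have pn0 : 0 <= p n by rewrite divr_ge0 ?exprn_ge0 // ltW.
have p01 : 0 <= p n <= 1.
  rewrite pn0 /=; have n1 : 1 <= n%:R :> R by rewrite ler1n.
  apply: (@le_trans _ _ (c / n%:R)).
    rewrite ler_wpM2l ?(ltW c0) // lef_pV2 ?posrE ?exprn_gt0 // ler_eXnr //.
  have : c / n%:R < 1 / 4 by near: n; exact: small.
  lra.
have MR : (M n)%:R <= al * n%:R by rewrite truncn_le mulr_ge0 // ltW.
have hi : (N n)%:R * p n / n%:R < c / r`!%:R + 1 by near: n.
have lo : c / r`!%:R - g / 2 < (N n)%:R * p n / n%:R by near: n.
rewrite ltr_pdivrMr // in hi; rewrite ltr_pdivlMr // in lo.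
have gap : g / 2 * n%:R <= (N n)%:R * p n - (M n)%:R.
  rewrite lerBrDr; apply: le_trans (ltW lo); apply: le_trans (lerD (lexx _) MR) _.
  by rewrite -mulrDl ler_wpM2r ?(ltW nR) // /g; lra.
rewrite hgraph_probE.
apply: (@le_trans _ _ (bernP (p n) (enum (rsubsets n r)) (set_peelable k))).
  apply: bernP_le => // E /fintype.subsetP Es; apply: empty_core_peelable => f fE.
  have := Es f fE; rewrite inE mem_rsubsets => /eqP fr.
  by rewrite -card_gt0 fr.
have sz : size (enum (rsubsets n r)) = N n by rewrite -cardE card_rsubsets.
apply: le_trans (bernP_set_peelable k p01 (M n) (enum_uniq _)) _.
rewrite set_enum sz.
have -> : (1 / 2 : R) = 1 / 4 + 1 / 4 by field.
apply: lerD.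
  have sM : (M n)%:R < (size (enum (rsubsets n r)))%:R * p n.
    rewrite sz -subr_gt0; apply: lt_le_trans gap; by rewrite !mulr_gt0.
  apply: le_trans (bernP_card_lt p01 (enum_uniq _) sM) _; rewrite sz.
  have bn : B1 / n%:R < 1 / 4 by near: n; exact: small.
  apply: le_trans (ltW bn).
  have d0 : 0 < g / 2 * n%:R by rewrite !mulr_gt0.
  rewrite ler_pdivrMr; last by rewrite exprn_gt0 //; apply: lt_le_trans gap.
  apply: (@le_trans _ _ (B1 / n%:R * (g / 2 * n%:R) ^+ 2)).
    apply: le_trans (ltW hi) _; rewrite le_eqVlt; apply/orP; left; apply/eqP.
    rewrite /B1; move: (c / r`!%:R + 1) => cc; field.
    by rewrite !gt_eqF.
  rewrite ler_wpM2l //; last by apply: lerXn2r; rewrite ?nnegrE ?(ltW d0) // (le_trans (ltW d0)).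
  rewrite divr_ge0 ?(ltW nR) // divr_ge0 ?sqr_ge0 // addr_ge0 // divr_ge0 ?(ltW c0) //.
have bn : B2 / n%:R < 1 / 4 by near: n; exact: small.
apply: le_trans (ltW bn).
pose A : R := n%:R * add_mean 'I_n (heavy_mean R k r' (last_rows r' al x n)
    (r * (M n - last_rows r' al x n))) (r * M n) 0.
have sA : (r * last_rows r' al x n)%:R + e * n%:R <= A.
  by rewrite /A /M; near: n; exact: surplus.
have en : 0 < e * n%:R by rewrite mulr_gt0.
have C0 : 0 <= 2 * k%:R ^+ 2 * (r * M n)%:R / (A - (r * last_rows r' al x n)%:R) ^+ 2.
  by rewrite divr_ge0 ?sqr_ge0 // !mulr_ge0 // sqr_ge0.
have Kn : K / n%:R <= 1 / 2.
  have : K / n%:R < 1 / 4 by near: n; exact: small.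
  lra.
have V0 : (0 < #|'I_n|)%N by rewrite card_ord.
have MM : (last_rows r' al x n + (M n - last_rows r' al x n) = M n)%N.
  by rewrite subnKC // last_rows_le.
have P := @peelable_wsum_le R 'I_n k V0 r' (last_rows r' al x n) (M n - last_rows r' al x n) (ltnW k_gt1).
rewrite MM card_ord -/A in P.
have AB : (r * last_rows r' al x n)%:R < A by apply: lt_le_trans sA; rewrite ltrDl.
have Dr (f : {set 'I_n}) : f \in rsubsets n r -> #|f| = r by rewrite inE => /eqP.
have Q := le_trans (card_peel_sets R k (M n) Dr) (P AB).
apply: le_trans (peel_sets_ratio_le C0 (ltW K0) n0 r'_gt0 MR (ltW al0) (lexx _) Kn Q) _.
rewrite /B2 -[leRHS]mulrA; apply: ler_wpM2l; first exact: expR_ge0.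
have rM : (r * M n)%:R <= r%:R * al * n%:R :> R.
  by rewrite natrM -mulrA ler_wpM2l.
have d0 : e * n%:R <= A - (r * last_rows r' al x n)%:R by rewrite lerBrDl.
rewrite ler_pdivrMr; last by rewrite exprn_gt0 //; apply: lt_le_trans d0.
set d := A - _ in d0 *.
apply: (@le_trans _ _ (2 * k%:R ^+ 2 * (r%:R * al) / e ^+ 2 / n%:R * (e * n%:R) ^+ 2)).
  apply: (@le_trans _ _ (2 * k%:R ^+ 2 * (r%:R * al * n%:R))).
    by rewrite ler_wpM2l // mulr_ge0 ?sqr_ge0.
  rewrite le_eqVlt; apply/orP; left; apply/eqP; move: (r%:R * al : R) => ra.
  by field; rewrite !gt_eqF.
apply: ler_wpM2l; last by apply: lerXn2r; rewrite ?nnegrE ?(ltW en) // (le_trans (ltW en)).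
by rewrite !divr_ge0 ?sqr_ge0 ?(ltW nR) // !mulr_ge0 ?sqr_ge0 // ltW.
Unshelve. all: by end_near. Qed.

Lemma density_evolution_lt (c_rk c x : R) : core_threshold r k c_rk ->
  0 < c -> c < c_rk -> 0 < x -> x <= 1 ->
  poisson_tail k.-1 (c * x ^+ r' / r'`!%:R) < x.
Proof.
case=> _ below_thr _ c0 ck x0 x1; rewrite ltNge; apply/negP => xP.
have r0 : 0 < r`!%:R :> R by rewrite ltr0n fact_gt0.
have r0' : 0 < r'`!%:R :> R by rewrite ltr0n fact_gt0.
have k1_gt0 : (0 < k.-1)%N by rewrite -ltnS prednK // ltnW.
(* The step from [c] to [c1] makes the inequality at [x] strict; that from [c1] to [c2] leaves room
   for the number of edges; and [c2] is still below [c_rk]. *)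
pose d := (c_rk - c) / 3; have d0 : 0 < d by rewrite divr_gt0 // subr_gt0.
pose c1 := c + d; pose c2 := c + d + d.
have c2k : c2 < c_rk by rewrite /c2 /d; lra.
have c20 : 0 < c2 by rewrite /c2; lra.
have al0 : 0 < c1 / r`!%:R by rewrite divr_gt0 // /c1; lra.
have alc : c1 / r`!%:R < c2 / r`!%:R by rewrite ltr_pM2r ?invr_gt0 // /c1 /c2; lra.
have xmu : x < poisson_tail k.-1 (r%:R * (c1 / r`!%:R) * x ^+ r').
  apply: le_lt_trans xP _.
  have -> : r%:R * (c1 / r`!%:R) * x ^+ r' = c * x ^+ r' / r'`!%:R + d * x ^+ r' / r'`!%:R.
    by rewrite factS natrM /c1; field; rewrite gt_eqF //= -natr1 gt_eqF // ltr_wpDl.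
  rewrite -(prednK k1_gt0).
  by apply: poisson_tail_lt; rewrite divr_gt0 // mulr_gt0 ?exprn_gt0.
have near_half := core_nonempty_above al0 alc x0 x1 xmu.
have near_one := cvgr_gt _ (below_thr c2 c20 c2k) (1 / 2).
have half1 : (1 / 2 : R) < 1 by lra.
have [N _ HN] := filterI near_half (near_one _ half1).
by have [h1 h2] := HN N (leqnn N); move: (lt_le_trans h2 h1); rewrite ltxx.
Qed.

End Threshold.

(** * Decay of the survival probabilities *)

Section DensityEvolution.
Variables (R : realType) (k r' : nat) (c1 : R).
Hypothesis c1_gt0 : 0 < c1.

Fixpoint density t : R :=
  if t is t'.+1 then poisson_tail k.-1 (c1 * density t' ^+ r' / r'`!%:R) else 1.

Let F0 : 0 < r'`!%:R :> R. Proof. by rewrite ltr0n fact_gt0. Qed.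

Let arg_ge0 (y : R) : 0 <= y -> 0 <= c1 * y ^+ r' / r'`!%:R.
Proof. by move=> y0; rewrite divr_ge0 ?mulr_ge0 ?exprn_ge0 // ltW. Qed.

Lemma density_01 t : 0 <= density t <= 1.
Proof.
elim: t => [|t /andP[IH0 _]] /=; first by rewrite ler01 lexx.
by rewrite poisson_tail_ge0 ?poisson_tail_le1 ?arg_ge0.
Qed.

Lemma density_step_le (y z : R) : 0 <= y -> y <= z ->
  poisson_tail k.-1 (c1 * y ^+ r' / r'`!%:R) <= poisson_tail k.-1 (c1 * z ^+ r' / r'`!%:R).
Proof.
move=> y0 yz; apply: poisson_tail_le; first exact: arg_ge0.
rewrite ler_pM2r ?invr_gt0 // ler_pM2l //; apply: lerXn2r => //; rewrite nnegrE //.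
exact: le_trans yz.
Qed.

Lemma density_nonincr t : density t.+1 <= density t.
Proof.
elim: t => [|t IH]; first by have /andP[] := density_01 1.
by apply: density_step_le => //; have /andP[] := density_01 t.+1.
Qed.

(** The sequence decreases to a fixed point of a continuous map, and the hypothesis excludes
    positive ones. *)
Lemma density_small (e : R) : 0 < e ->
  (forall x, 0 < x -> x <= 1 -> poisson_tail k.-1 (c1 * x ^+ r' / r'`!%:R) < x) ->
  exists I, density I < e.
Proof.
move=> e0 sub.
have mono : nonincreasing_seq density.
  apply/nonincreasing_seqP => n; exact: density_nonincr.
have cv : cvgn density.
  apply: nonincreasing_is_cvgn => //; exists 0 => _ [n _ <-].
  by have /andP[] := density_01 n.
set L := limn density.
have L0 : 0 <= L by apply: limr_ge => //; near=> n; have /andP[] := density_01 n.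
have L1 : L <= 1 by apply: (nonincreasing_cvgn_ge mono cv 0).
have cvS : density n.+1 @[n --> \oo] --> L by rewrite (cvg_shiftS density).
have arg_cvg : c1 * density n ^+ r' / r'`!%:R @[n --> \oo] --> c1 * L ^+ r' / r'`!%:R.
  by apply: cvgMr_tmp; apply: cvgMl_tmp; exact: cvg_expn.
have cvT : density n.+1 @[n --> \oo] --> poisson_tail k.-1 (c1 * L ^+ r' / r'`!%:R).
  apply: (@cvg_comp _ _ _ (fun n => c1 * density n ^+ r' / r'`!%:R) (poisson_tail k.-1)
    _ _ _ arg_cvg).
  exact: continuous_poisson_tail.
have fixL : L = poisson_tail k.-1 (c1 * L ^+ r' / r'`!%:R).
  exact: (cvg_unique _ cvS cvT).
have LE : L = 0.
  apply/eqP; rewrite eq_le L0 andbT leNgt; apply/negP => Lpos.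
  by have := sub L Lpos L1; rewrite -fixL ltxx.
have : \forall n \near \oo, density n < e by apply: (cvgr_lt _ cv); rewrite -/L LE.
by case=> N _ H; exists N; exact: (H N (leqnn N)).
Unshelve. all: by end_near. Qed.

(** The slack [eta] pays for replacing binomial by Poisson: [exp (- a (1 + eta)) <= 1 - a] as soon
    as [a <= eta / (1 + eta)]. *)
Lemma tree_bound_density (N : nat) (p eta : R) t : 0 <= p <= 1 -> 0 < eta ->
  p <= eta / (1 + eta) -> N%:R * p * (1 + eta) <= c1 / r'`!%:R ->
  tree_bound k.-1 r'.+1 N p t <= density t.
Proof.
move=> p01 eta0 peta Np; have /andP[p0 p1] := p01.
elim: t => [|t IH] //=.
have /andP[q0 q1] := tree_bound_ge0_le1 k.-1 r'.+1 N t p01.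
move: IH q0 q1; set q := tree_bound _ _ _ _ _ => IH q0 q1.
set a := p * q ^+ r'.
have a0 : 0 <= a by rewrite mulr_ge0 ?exprn_ge0.
have ap : a <= p by rewrite ler_piMr ?exprn_ile1.
have a01 : 0 <= a <= 1 by rewrite a0 (le_trans ap).
pose u := a * (1 + eta).
have u0 : 0 <= u by rewrite mulr_ge0 // addr_ge0 // ltW.
have eu : expR (- u) <= 1 - a.
  rewrite expRN -[X in _ <= X]invrK lef_pV2 ?posrE ?expR_gt0 //; last first.
    rewrite invr_gt0 subr_gt0; apply: le_lt_trans ap _; apply: le_lt_trans peta _.
    by rewrite ltr_pdivrMr ?addr_gt0 // mul1r ltrDr.
  apply: le_trans (expR_ge1Dx u).
  have a1 : 0 < 1 - a.
    rewrite subr_gt0; apply: le_lt_trans ap _; apply: le_lt_trans peta _.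
    by rewrite ltr_pdivrMr ?addr_gt0 // mul1r ltrDr.
  rewrite -div1r ler_pdivrMr //.
  have ae : a * (1 + eta) <= eta.
    by rewrite -ler_pdivlMr ?addr_gt0 // (le_trans ap).
  have : a * (a * (1 + eta)) <= a * eta by rewrite ler_wpM2l.
  by rewrite /u; nra.
apply: le_trans (binom_tail_poisson _ _ a01 u0 eu) _.
apply: poisson_tail_le; first by rewrite mulr_ge0.
have -> : N%:R * u = N%:R * p * (1 + eta) * q ^+ r' by rewrite /u /a; ring.
have -> : c1 * density t ^+ r' / r'`!%:R = c1 / r'`!%:R * density t ^+ r' by ring.
apply: ler_pM => //; rewrite ?exprn_ge0 //.
  by rewrite !mulr_ge0 // addr_ge0 // ltW.
apply: lerXn2r => //; rewrite nnegrE //; exact: le_trans IH.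
Qed.

(** With [D = C ^ (k - 1)] and [b = r' * (k - 1)], one step gives
    [D q' <= D ^ 2 * q ^ b <= (D q) ^ b] since [b >= 2]. The normalised quantity is thus raised to
    the power [b] at each step. *)
Lemma tree_bound_decay (N I t : nat) (p C : R) : 0 <= p <= 1 -> 1 <= C -> N%:R * p <= C ->
  (1 < r' * k.-1)%N ->
  C ^+ k.-1 * tree_bound k.-1 r'.+1 N p I <= expR (-1) ->
  tree_bound k.-1 r'.+1 N p (I + t)%N <= expR (- ((r' * k.-1) ^ t)%:R).
Proof.
move=> p01 C1 NC b1 start; have /andP[p0 p1] := p01.
have C0 : 0 <= C by exact: le_trans C1.
have D1 : 1 <= C ^+ k.-1 by rewrite exprn_ege1.
have D0 : 0 <= C ^+ k.-1 by exact: le_trans D1.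
set b := (r' * k.-1)%N in b1 *; set q := tree_bound k.-1 r'.+1 N p in start *.
have q01 i : 0 <= q i <= 1 by exact: tree_bound_ge0_le1.
suff H : C ^+ k.-1 * q (I + t)%N <= expR (- (b ^ t)%:R).
  apply: le_trans H; have /andP[h0 _] := q01 (I + t)%N.
  by rewrite ler_peMl.
elim: t => [|t IH]; first by rewrite addn0 expn0.
rewrite addnS; have /andP[h0 h1] := q01 (I + t)%N.
have a01 : 0 <= p * q (I + t)%N ^+ r' <= 1.
  by rewrite mulr_ge0 ?exprn_ge0 //= mulr_ile1 ?exprn_ge0 ?exprn_ile1.
have step : q (I + t).+1%N <= C ^+ k.-1 * q (I + t)%N ^+ b.
  apply: le_trans (binom_tail_le_exp _ _ a01) _.
  rewrite mulrA /b exprM -exprMn; apply: lerXn2r; rewrite ?nnegrE.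
  - by rewrite !mulr_ge0 ?exprn_ge0.
  - by rewrite mulr_ge0 ?exprn_ge0.
  - by rewrite ler_wpM2r ?exprn_ge0.
apply: (@le_trans _ _ ((C ^+ k.-1 * q (I + t)%N) ^+ b)).
  apply: le_trans (ler_wpM2l D0 step) _.
  rewrite mulrA exprMn ler_wpM2r ?exprn_ge0 // -expr2.
  by apply: ler_weXn2l.
apply: (@le_trans _ _ (expR (- (b ^ t)%:R) ^+ b)).
  by apply: lerXn2r; rewrite ?nnegrE ?expR_ge0 ?mulr_ge0.
by rewrite -expRM_natl expnS natrM mulrN.
Qed.

End DensityEvolution.

(** * The number of rounds *)

Section DenseFamiliesVanish.
Variable R : realType.

(** The single vertex that a dense family saves leaves one factor [1 / n] in each term after the
    powers of [n] cancel. *)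
Lemma dense_sum_le (n r' L : nat) (c G : R) : (0 < n)%N -> (0 < r')%N -> 0 <= c ->
  1 <= G -> c * ((r' * L) ^ r'.+1)%:R <= G ->
  \sum_(m < L) (#|'I_n| ^ (r'.+1.-1 * m.+1).-1 * ((r'.+1.-1 * m.+1).-1 ^ r'.+1) ^ m.+1)%:R
     * (c / n%:R ^+ r') ^+ m.+1 <= L%:R * G ^+ L / n%:R.
Proof.
move=> n0 r0 c0 G1 cG; have nR : 0 < n%:R :> R by rewrite ltr0n.
have G0 : 0 <= G by exact: le_trans G1.
apply: (@le_trans _ _ (\sum_(m < L) G ^+ L / n%:R)); last first.
  by rewrite sumr_const card_ord -[leLHS]mulr_natl mulrA.
apply: ler_sum => m _ /=; rewrite card_ord natrM natrX expr_div_n -exprM.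
have rm : (0 < r' * m.+1)%N by rewrite muln_gt0 r0.
have -> : n%:R ^+ (r' * m.+1).-1 * (((r' * m.+1).-1 ^ r'.+1) ^ m.+1)%:R * (c ^+ m.+1 / n%:R ^+ (r' * m.+1))
   = (((r' * m.+1).-1 ^ r'.+1) ^ m.+1)%:R * c ^+ m.+1 / n%:R :> R.
  have -> : n%:R ^+ (r' * m.+1) = n%:R * n%:R ^+ (r' * m.+1).-1 :> R by rewrite -exprS prednK.
  have P0 : n%:R ^+ (r' * m.+1).-1 != 0 :> R by rewrite expf_neq0 // gt_eqF.
  have cancel (P q W z : R) : P != 0 -> z != 0 -> P * W * (q / (z * P)) = W * q / z.
    by move=> P0' z0; field; rewrite P0' z0.
  by rewrite cancel // gt_eqF.
rewrite ler_wpM2r ?invr_ge0 ?(ltW nR) // natrX -exprMn mulrC.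
apply: (@le_trans _ _ (G ^+ m.+1)); last by apply: ler_weXn2l.
apply: lerXn2r; rewrite ?nnegrE ?mulr_ge0 //; apply: le_trans cG.
rewrite ler_wpM2l // ler_nat leq_exp2r //.
apply: leq_trans (leq_pred _) _; rewrite leq_mul2l; apply/orP; right; exact: ltn_ord.
Qed.

Lemma near_lnln (B : R) : \forall n \near \oo, B <= ln (ln (n%:R : R)).
Proof.
near=> n; have nB : expR (expR B) <= n%:R by near: n; exact: nbhs_infty_ger.
have n0 : 0 < n%:R :> R by apply: lt_le_trans nB; exact: expR_gt0.
have h : expR B <= ln n%:R by rewrite -ler_expR lnK.
have l0 : 0 < ln (n%:R : R) by apply: lt_le_trans h; exact: expR_gt0.
by rewrite -ler_expR lnK.
Unshelve. all: by end_near. Qed.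

Lemma near_lnlnK : \forall n \near \oo, expR (expR (ln (ln (n%:R : R)))) = n%:R.
Proof.
near=> n; have nB : expR (expR 0) <= n%:R :> R by near: n; exact: nbhs_infty_ger.
have n0 : 0 < n%:R :> R by apply: lt_le_trans nB; exact: expR_gt0.
have h : expR 0 <= ln (n%:R : R) by rewrite -ler_expR lnK.
have l0 : 0 < ln (n%:R : R) by apply: lt_le_trans h; exact: expR_gt0.
by rewrite !lnK.
Unshelve. all: by end_near. Qed.

(* [L] is at most a multiple of [Y = ln (ln n)], so [L G ^ L] is at most
   [exp (D Y ^ 2)], which is negligible with respect to [n = exp (exp Y)]. *)
Lemma near_dense_sum (r' : nat) (c a : R) (L : nat -> nat) : (0 < r')%N -> 0 <= c -> 0 <= a ->
  (\forall n \near \oo, (L n)%:R <= a * ln (ln (n%:R : R))) ->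
  \forall n \near \oo,
    \sum_(m < L n) (#|'I_n| ^ (r'.+1.-1 * m.+1).-1 * ((r'.+1.-1 * m.+1).-1 ^ r'.+1) ^ m.+1)%:R
     * (c / n%:R ^+ r') ^+ m.+1 <= expR (- ln (ln (n%:R : R))).
Proof.
move=> r0 c0 a0 La.
pose C : R := c * (r' ^ r'.+1)%:R + 1.
have C0 : 0 <= c * (r' ^ r'.+1)%:R by rewrite mulr_ge0.
pose D : R := a * (C + a * r'.+1%:R) + a.
have D0 : 0 <= D by rewrite /D /C !(addr_ge0, mulr_ge0).
near=> n.
(* The 6 is [3!]: the bound is chosen for [(D + 1) * Y ^ 2 <= Y ^ 3 / 3! <= exp Y]. *)
have Y1 : Num.max 1 (6 * (D + 1)) <= ln (ln (n%:R : R)) by near: n; exact: near_lnln.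
have LY : (L n)%:R <= a * ln (ln (n%:R : R)) by near: n.
have EY : expR (expR (ln (ln (n%:R : R)))) = n%:R by near: n; exact: near_lnlnK.
have n0 : (0 < n)%N by near: n; exact: nbhs_infty_gt.
move: LY EY Y1; set Y := ln (ln n%:R); set l := L n => LY EY.
rewrite ge_max => /andP[Y1 YD].
pose G : R := expR (C + r'.+1%:R * l%:R).
have G1 : 1 <= G.
  by rewrite -expR0 ler_expR /C !(addr_ge0, mulr_ge0).
have cG : c * ((r' * l) ^ r'.+1)%:R <= G.
  rewrite expnMn natrM mulrA /G expRD; apply: ler_pM => //.
    by apply: le_trans (expR_ge1Dx _); rewrite /C; lra.
  rewrite natrX expRM_natl; apply: lerXn2r; rewrite ?nnegrE ?expR_ge0 //.
  by apply: le_trans (expR_ge1Dx _); rewrite lerDr.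
apply: le_trans (dense_sum_le n0 r0 c0 G1 cG) _.
have l0 : 0 <= l%:R :> R by [].
have Y0 : 0 <= Y by lra.
have h1 : l%:R * G ^+ l <= expR (l%:R + l%:R * (C + r'.+1%:R * l%:R)).
  rewrite expRD expRM_natl ler_wpM2r ?exprn_ge0 ?expR_ge0 //.
  by apply: le_trans (expR_ge1Dx _); rewrite lerDr.
have h2 : l%:R + l%:R * (C + r'.+1%:R * l%:R) <= D * Y ^+ 2.
  have C1 : 0 <= C by rewrite /C addr_ge0.
  have Y2 : Y <= Y ^+ 2 by rewrite expr2 ler_peMl.
  have e1 : l%:R <= a * Y ^+ 2 by apply: le_trans LY _; rewrite ler_wpM2l.
  have e2 : C + r'.+1%:R * l%:R <= (C + a * r'.+1%:R) * Y.
    rewrite mulrDl; apply: lerD; first by rewrite ler_peMr.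
    by rewrite [a * _]mulrC -mulrA ler_wpM2l.
  have e3 : l%:R * (C + r'.+1%:R * l%:R) <= a * Y * ((C + a * r'.+1%:R) * Y).
    by apply: ler_pM => //; rewrite addr_ge0 // mulr_ge0.
  apply: le_trans (lerD e1 e3) _; rewrite le_eqVlt; apply/orP; left; apply/eqP.
  by rewrite /D; ring.
have h3 : D * Y ^+ 2 + Y <= expR Y.
  have e3 := expR_ge1Dxn 2 Y0.
  apply: (le_trans _ e3); apply: (@le_trans _ _ (Y ^+ 3 / 3`!%:R)); last by rewrite lerDr.
  have -> : (3`!%:R : R) = 6 by [].
  have Y2 : Y <= Y ^+ 2 by rewrite expr2 ler_peMl.
  have : (D + 1) * Y ^+ 2 <= Y ^+ 3 / 6.
    rewrite ler_pdivlMr // [leRHS]exprS mulrAC [(D + 1) * _]mulrC.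
    by rewrite ler_wpM2r ?sqr_ge0.
  by rewrite mulrDl mul1r; move: (Y ^+ 2) Y2 => Z; move: (Y ^+ 3 / 6) (D * Z) => W DZ; lra.
rewrite -EY ler_pdivrMr ?expR_gt0 // -expRD; apply: le_trans h1 _.
by rewrite ler_expR; lra.
Unshelve. all: by end_near. Qed.

End DenseFamiliesVanish.

Section FewRounds.
Variables (R : realType) (k r' : nat).
Local Notation r := r'.+1.
Hypothesis k_gt1 : (1 < k)%N.
Hypothesis r'_gt0 : (0 < r')%N.
Hypothesis kr : (k, r) <> (2%N, 2%N).

Lemma ffact_le_expn n m : (n ^_ m <= n ^ m)%N.
Proof.
rewrite ffact_prod -[X in (_ ^ X)%N]card_ord -prod_nat_const.
by apply: leq_prod => i _; exact: leq_subr.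
Qed.

Lemma rsubsets_degree n (u : 'I_n) :
  (size [seq e : {set 'I_n} <- enum (rsubsets n r) | u \in e] <= 'C(n.-1, r'))%N.
Proof.
rewrite -(card_uniqP (filter_uniq _ (enum_uniq _))).
have -> : n.-1 = #|[set~ u]%SET| by rewrite cardsC1 card_ord.
rewrite -cards_draws -(@card_in_imset _ _ (fun e : {set 'I_n} => e :\ u)%SET).
  apply: subset_leq_card; apply/fintype.subsetP => _ /imsetP[e + ->].
  rewrite mem_filter mem_rsubsets => /andP[ue /eqP er].
  rewrite inE; apply/andP; split.
    by apply/fintype.subsetP => w; rewrite !inE => /andP[].
  by have := cardsD1 u e; rewrite ue er add1n => -[->].
move=> e f; rewrite !mem_filter => /andP[ue _] /andP[uf _] ef.
by rewrite -(finset.setD1K ue) -(finset.setD1K uf) ef.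
Qed.

Lemma long_peeling_prob n (p : R) T (Om := enum (rsubsets n r)) : 0 <= p <= 1 ->
  bernP p Om (fun E => (T.+1 < rounds k (Hypergraph [set: 'I_n]%SET E))%N) <=
  n%:R * tree_bound k.-1 r 'C(n.-1, r') p T +
  \sum_(m < 4 * T.+2) (#|'I_n| ^ (r.-1 * m.+1).-1 * ((r.-1 * m.+1).-1 ^ r) ^ m.+1)%:R * p ^+ m.+1.
Proof.
move=> p01; have uOm : uniq Om by exact: enum_uniq.
have cOm (e : {set 'I_n}) : e \in Om -> #|e| = r by rewrite mem_rsubsets => /eqP.
pose D (E : {set {set 'I_n}}) := [exists F : {set {set 'I_n}},
     [&& F \subset E, F != finset.set0, (#|F| <= 4 * T.+2)%N & dense_family r F]].
pose W (E : {set {set 'I_n}}) := [exists u, tree_witness k.-1 Om T u E].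
apply: (@le_trans _ _ (bernP p Om W + bernP p Om D)).
  rewrite /bernP -bernED; apply: bernE_le => // E Es.
  have EOm : {subset E <= Om} by move=> e /(fintype.subsetP Es); rewrite inE.
  case: (boolP (_ < _)%N) => [/rounds_gt_survivor[v vS]|_]; last by rewrite addr_ge0.
  have [DE|nD] := boolP (D E); first by rewrite lerDr.
  suff -> : W E by rewrite addr0.
  apply/existsP.
  (* [T.+3] is the least truncation of distances allowed by [B_large]. *)
  apply: (@exists_tree_witness _ E r v T.+3 _ _ _ k T (survivors k E)) => //.
  - by move=> e /EOm; exact: cOm.
  - by move=> t x; exact: survivors_degree.
  - move=> F FE F0 FL; rewrite leqNgt; apply: contra nD => dF; apply/existsP; exists F.
    by rewrite FE F0 FL.
apply: lerD; last exact: bernP_dense_family.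
apply: le_trans (bernP_exists _ _ p01) _.
rewrite -[X in X%:R * _](card_ord n) mulr_natl -sumr_const; apply: ler_sum => u _.
apply: bernP_tree_witness => // w; exact: rsubsets_degree.
Qed.

(** Equivalent to [1 < (k - 1) * r'], which fails only for [(2, 2)]. It makes the logarithm in the
    rate positive and the decay doubly exponential. *)
Lemma growth_gap : (r < k * r')%N.
Proof.
have : ~ (k = 2%N /\ r' = 1%N) by move=> [k2 r2]; apply: kr; rewrite k2 r2.
case: (ltnP 2 k) => [k3 _|k2]; first nia.
have k2' : k = 2%N by lia.
by move=> H; have r1 : r' <> 1%N by [move=> r1; apply: H]; lia.
Qed.

Lemma long_peeling_vanishes (c c1 a : R) : 0 < c -> c < c1 -> 0 < a ->
  (forall x, 0 < x -> x <= 1 -> poisson_tail k.-1 (c1 * x ^+ r' / r'`!%:R) < x) ->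
  1 < a * ln ((r' * k.-1)%:R : R) ->
  \forall n \near \oo,
    hgraph_prob r (c / n%:R ^+ r')
      (fun H : hypergraph 'I_n => (Num.truncn (a * ln (ln (n%:R : R))) < rounds k H)%N) <=
    n%:R^-1 + expR (- ln (ln (n%:R : R))).
Proof.
move=> c0 cc1 a0 sub ab.
have c10 : 0 < c1 by exact: lt_trans cc1.
pose b := (r' * k.-1)%N.
have b1 : (1 < b)%N by have := growth_gap; rewrite /b; nia.
pose eta := c1 / c - 1.
have eta0 : 0 < eta by rewrite subr_gt0 ltr_pdivlMr // mul1r.
pose C : R := c + 1.
have C1 : 1 <= C by rewrite lerDr ltW.
have D0 : 0 < C ^+ k.-1 by rewrite exprn_gt0 //; apply: lt_le_trans C1.
have [I smallI] := density_small c10 (divr_gt0 (expR_gt0 (-1)) D0) sub.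
have lnb0 : 0 < ln (b%:R : R) by rewrite ln_gt0 // ltr1n.
pose S n := Num.truncn (a * ln (ln (n%:R : R))).
(* Solves [(a * Y - I.+2) * ln b >= ln 2 + Y] for [Y]; the denominator is positive because the rate
   [a] exceeds [1 / ln b]. *)
pose need : R := (ln 2 + (I.+2)%:R * ln (b%:R : R)) / (a * ln (b%:R : R) - 1).
have sums := @near_dense_sum R r' c (4 * (a + 1)) (fun n => (4 * (S n).+1)%N) r'_gt0 (ltW c0) _.
have sums' : \forall n \near \oo,
    \sum_(m < 4 * (S n).+1) (#|'I_n| ^ (r.-1 * m.+1).-1 * ((r.-1 * m.+1).-1 ^ r) ^ m.+1)%:R
     * (c / n%:R ^+ r') ^+ m.+1 <= expR (- ln (ln (n%:R : R))).
  apply: sums; first by rewrite mulr_ge0 // addr_ge0 // ltW.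
  near=> n; have Y1 : 1 <= ln (ln (n%:R : R)) by near: n; exact: near_lnln.
  have aY : 0 <= a * ln (ln (n%:R : R)) by rewrite mulr_ge0 ?(ltW a0) //; lra.
  rewrite natrM -mulrA ler_wpM2l // -natr1 mulrDl mul1r; apply: lerD => //.
  by rewrite truncn_le.
near=> n.
have Yneed : Num.max (Num.max 1 (I.+2%:R / a)) need <= ln (ln (n%:R : R)).
  by near: n; exact: near_lnln.
have EY : expR (expR (ln (ln (n%:R : R)))) = n%:R by near: n; exact: near_lnlnK.
have dsum : \sum_(m < 4 * (S n).+1) (#|'I_n| ^ (r.-1 * m.+1).-1 * ((r.-1 * m.+1).-1 ^ r) ^ m.+1)%:R
     * (c / n%:R ^+ r') ^+ m.+1 <= expR (- ln (ln (n%:R : R))) by near: n.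
have n0 : (0 < n)%N by near: n; exact: nbhs_infty_gt.
have nbig : Num.max c (c * (1 + eta) / eta) <= n%:R by near: n; exact: nbhs_infty_ger.
have nR : 0 < n%:R :> R by rewrite ltr0n.
move: nbig; rewrite ge_max => /andP[nc neta].
set p : R := c / n%:R ^+ r'.
have p0 : 0 <= p by rewrite divr_ge0 ?exprn_ge0 // ltW.
have pn : p <= c / n%:R.
  by rewrite ler_wpM2l ?(ltW c0) // lef_pV2 ?posrE ?exprn_gt0 // ler_eXnr // ler1n.
have p01 : 0 <= p <= 1.
  by rewrite p0 (le_trans pn) // ler_pdivrMr // mul1r.
have peta : p <= eta / (1 + eta).
  apply: le_trans pn _; rewrite ler_pdivrMr // mulrAC (ler_pdivlMr _ _ (addr_gt0 ltr01 eta0)).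
  by move: neta; rewrite ler_pdivrMr // [leRHS]mulrC.
have Np : 'C(n.-1, r')%:R * p <= c / r'`!%:R.
  have F0 : 0 < r'`!%:R :> R by rewrite ltr0n fact_gt0.
  rewrite ler_pdivlMr // mulrC mulrA -natrM mulnC bin_ffact /p mulrCA ler_piMr ?(ltW c0) //.
  rewrite ler_pdivrMr ?exprn_gt0 // mul1r -natrX ler_nat.
  apply: leq_trans (ffact_le_expn _ _) _; rewrite leq_exp2r //; exact: leq_pred.
have Npeta : 'C(n.-1, r')%:R * p * (1 + eta) <= c1 / r'`!%:R.
  apply: le_trans (ler_wpM2r _ Np) _; first by rewrite addr_ge0 // ltW.
  rewrite le_eqVlt; apply/orP; left; apply/eqP; rewrite /eta addrC subrK.
  have F0 : r'`!%:R != 0 :> R by rewrite pnatr_eq0 -lt0n fact_gt0.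
  by field; rewrite F0 gt_eqF.
have NpC : 'C(n.-1, r')%:R * p <= C.
  apply: le_trans Np _; apply: (@le_trans _ _ c); last by rewrite lerDl.
  by rewrite ler_pdivrMr ?ltr0n ?fact_gt0 // ler_peMr ?(ltW c0) // ler1n fact_gt0.
have start : C ^+ k.-1 * tree_bound k.-1 r 'C(n.-1, r') p I <= expR (-1).
  have H := tree_bound_density k I p01 eta0 peta Npeta.
  apply: le_trans (ler_wpM2l (ltW D0) H) _.
  by move/ltW: smallI; rewrite ler_pdivlMr // mulrC.
move: Yneed; set Y := ln (ln n%:R) in EY dsum *.
rewrite !ge_max => /andP[/andP[Y1 YI] Yn].
have aY : 0 <= a * Y by rewrite mulr_ge0 ?(ltW a0) //; lra.
have /andP[S1 S2] := truncn_itv aY; rewrite -/(S n) in S1 S2.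
have SI : (I.+2 <= S n)%N.
  by rewrite truncn_ge_nat // mulrC -ler_pdivrMr.
(* [I] levels bring the density below the starting value, and one round goes to the passage from [v]
   to its neighbour; the other [t] levels give the decay. *)
pose t := (S n - I.+1)%N.
have St : S n = (I + t).+1 by rewrite -addSn subnKC // ltnW.
rewrite hgraph_probE -/(S n) St.
apply: le_trans (@long_peeling_prob n p (I + t) p01) _.
apply: lerD; last by apply: le_trans dsum; rewrite St.
have dec := tree_bound_decay t p01 C1 NpC b1 start; rewrite -/b in dec.
apply: le_trans (ler_wpM2l (ltW nR) dec) _.
(* As [n = exp (exp Y)], this gives [exp (- b ^ t) <= n ^ (- 2)], which beats the union over the [n]
   roots. *)
have bt : 2 * expR Y <= (b ^ t)%:R.
  have bR : 0 < b%:R :> R by rewrite ltr0n ltnW.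
  have -> : (b ^ t)%:R = expR (t%:R * ln b%:R) :> R by rewrite expRM_natl lnK // natrX.
  have -> : 2 * expR Y = expR (ln 2 + Y) by rewrite expRD lnK ?posrE.
  rewrite ler_expR.
  have tR : a * Y - I.+2%:R <= t%:R.
    rewrite lerBlDr -natrD; apply: le_trans (ltW S2) _; by rewrite ler_nat St !addnS addnC.
  apply: le_trans (ler_wpM2r (ltW lnb0) tR).
  have g0 : 0 < a * ln b%:R - 1 by rewrite subr_gt0.
  move: Yn; rewrite ler_pdivrMr // => Yn.
  by move: Yn; move: (ln (b%:R : R)) => lb; lra.
rewrite -ler_pdivlMl // -expr2 -EY -expRN.
rewrite -expRM_natl ler_expR.
by rewrite mulrN lerN2.
Unshelve. all: by end_near. Qed.

End FewRounds.

Theorem theorem1 (R : realType) (k r : nat)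
    (hk : (2 <= k)%N) (hr : (2 <= r)%N) (hkr : (k, r) <> (2%N, 2%N))
    (c_rk : R) (hc_rk : core_threshold r k c_rk)
    (c : R) (hc0 : 0 < c) (hc : c < c_rk) :
  exists o1 : nat -> R,
    o1 @ \oo --> (0 : R) /\
    aas r c (fun n H =>
      (rounds k H)%:R <=
        (1 / ln (k%:R * (r%:R - 1) / r%:R) + o1 n) * ln (ln (n%:R : R))).
Proof.
case: r hr hkr hc_rk => // r' hr' hkr hc_rk; have r'0 : (0 < r')%N by [].
exists (fun=> 0); split; first exact: cvg_cst.
have -> : r'.+1%:R - 1 = r'%:R :> R by rewrite -natr1 addrK.
set q := k%:R * r'%:R / r'.+1%:R; pose a := 1 / ln q.
have gap := growth_gap hk r'0 hkr.
have q1 : 1 < q by rewrite /q ltr_pdivlMr // mul1r -natrM ltr_nat.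
have lq0 : 0 < ln q by rewrite ln_gt0.
have a0 : 0 < a by rewrite divr_gt0.
(* After clearing denominators this is [k < (k - 1) * r], again equivalent to [gap]: the true rate
   is strictly better than the stated one. *)
have qb : q < (r' * k.-1)%:R.
  rewrite /q ltr_pdivrMr // -!natrM ltr_nat; nia.
have ab : 1 < a * ln ((r' * k.-1)%:R : R).
  rewrite /a mul1r mulrC ltr_pdivlMr // mul1r ltr_ln ?posrE //.
  - exact: lt_trans q1.
  - by apply: lt_trans qb; exact: lt_trans q1.
(* An intermediate constant: being above [c] it provides the slack [eta], being below [c_rk] it
   satisfies the density inequality. *)
pose c1 := (c + c_rk) / 2.
have cc1 : c < c1 by rewrite /c1; lra.
have c1k : c1 < c_rk by rewrite /c1; lra.
have sub x : 0 < x -> x <= 1 -> poisson_tail k.-1 (c1 * x ^+ r' / r'`!%:R) < x.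
  by apply: (density_evolution_lt hk r'0 hc_rk) => //; exact: lt_trans cc1.
have bad := long_peeling_vanishes hk r'0 hkr hc0 cc1 a0 sub ab.
apply: (@squeeze_cvgr _ _ _ _ (fun n => 1 - (n%:R^-1 + expR (- ln (ln (n%:R : R))))) (fun=> 1)); last first.
- exact: cvg_cst.
- rewrite -[X in _ --> X]subr0; apply: cvgB; first exact: cvg_cst.
  rewrite -[X in _ --> X]addr0; apply: cvgD; first exact: cvg_natV.
  apply/cvgrPdist_le => e e0; near=> n.
  rewrite sub0r normrN ger0_norm ?expR_ge0 //.
  have : - ln e <= ln (ln (n%:R : R)) by near: n; exact: near_lnln.
  by rewrite lerNl => h; rewrite -[leRHS](lnK (_ : e \is Num.pos)) ?ler_expR ?posrE.
near=> n.
have n0 : (0 < n)%N by near: n; exact: nbhs_infty_gt.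
have nc : c <= n%:R by near: n; exact: nbhs_infty_ger.
have nR : 0 < n%:R :> R by rewrite ltr0n.
have Y1 : 1 <= ln (ln (n%:R : R)) by near: n; exact: near_lnln.
have p01 : 0 <= c / n%:R ^+ r' <= 1.
  rewrite divr_ge0 ?exprn_ge0 ?(ltW hc0) //= ler_pdivrMr ?exprn_gt0 // mul1r.
  by apply: le_trans nc _; rewrite ler_eXnr // ler1n.
rewrite hgraph_probE /= bernP_le1 // andbT lerBlDr.
have badn : hgraph_prob r'.+1 (c / n%:R ^+ r') (fun H : hypergraph 'I_n =>
    (Num.truncn (a * ln (ln (n%:R : R))) < rounds k H)%N) <=
    n%:R^-1 + expR (- ln (ln (n%:R : R))) by near: n; exact: bad.
rewrite hgraph_probE in badn; apply: le_trans (lerD (lexx _) badn).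
rewrite /bernP -bernED -[leLHS](bernE_cst (c / n%:R ^+ r') (enum (rsubsets n r'.+1)) 1).
apply: bernE_le => // E _; set s := rounds _ _.
have [h|h] := leqP s (Num.truncn (a * ln (ln n%:R))); last by rewrite lerDr.
have -> : s%:R <= (1 / ln q + 0) * ln (ln (n%:R : R)).
  rewrite addr0 -/a; apply: (@le_trans _ _ (Num.truncn (a * ln (ln n%:R)))%:R).
    by rewrite ler_nat.
  by rewrite truncn_le mulr_ge0 ?(ltW a0) //; lra.
by rewrite lerDl.
Unshelve. all: by end_near. Qed.
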